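(* Let $\mathfrak{S}=(\mathfrak{A},\mathfrak{B},\mathfrak{C})$ be a boundary control system (BCS) which satisfies the system assumptions (S1), (S2), (S3) stated in the context, such that (S1) holds with some $\alpha<0$. Assume that the initial value $x_0$ and the functions $y_{\rm ref}$, $p$, $\varphi$ fulfill the controller assumptions (C1), (C2), (C3) stated in the context. Then the (unique global) solution $x:[0,\infty)\to X$ of the closed-loop system (CL) stated in the context fulfills $$x\in W^{1,\infty}([0,\infty);X)\quad\text{and}\quad u=\mathfrak{B}x\in L^\infty([0,\infty);U).$$
   Context: All spaces are over the same field $\mathbb{K}\in\{\mathbb{R},\mathbb{C}\}$; scalar products are linear in the first argument. $\mathcal{L}(Y,Z)$ denotes bounded linear operators, $\mathcal{R}(\cdot)$ the range. $W^{k,\infty}(J;B)$ denotes the functions $f\in L^\infty(J;B)$ whose (weak) derivatives up to order $k$ are in $L^\infty(J;B)$ (Bochner sense); $W^{k,\infty}_{\rm loc}(J;B)$ consists of all $f$ whose restriction to any compact interval $K\subset J$ is in $W^{k,\infty}(K;B)$. BCS: $X$ and $U$ are Hilbert spaces; $\mathcal{D}(\mathfrak{A})$ is a Hilbert space with norm $\|\cdot\|_{\mathcal{D}(\mathfrak{A})}$, continuously embedded in $X$; $\mathfrak{A}:\mathcal{D}(\mathfrak{A})\to X$ is linear and bounded (with respect to $\|\cdot\|_{\mathcal{D}(\mathfrak{A})}$), and $\mathfrak{B},\mathfrak{C}\in\mathcal{L}(\mathcal{D}(\mathfrak{A}),U)$. The triple $\mathfrak{S}=(\mathfrak{A},\mathfrak{B},\mathfrak{C})$,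 with associated system $\dot x(t)=\mathfrak{A}x(t)$, $x(0)=x_0$, $u(t)=\mathfrak{B}x(t)$, $y(t)=\mathfrak{C}x(t)$, is called a boundary control system. System assumptions: (S1) there exists $\alpha\in\mathbb{R}$ with $\operatorname{Re}\langle\mathfrak{A}x,x\rangle_X\le\operatorname{Re}\langle\mathfrak{B}x,\mathfrak{C}x\rangle_U+\alpha\|x\|_X^2$ for all $x\in\mathcal{D}(\mathfrak{A})$; (S2) there exists $\beta\ge\alpha$ such that $\mathcal{R}(\mathfrak{A}|_{\ker\mathfrak{C}}-\beta I)=X$; (S3) the operator $\begin{bmatrix}\mathfrak{B}\\ \mathfrak{C}\end{bmatrix}:\mathcal{D}(\mathfrak{A})\to U\times U$ is surjective. Controller assumptions: (C1) $y_{\rm ref}\in W^{2,\infty}([0,\infty);U)$; (C2) $p\in W^{2,\infty}([0,\infty))$ has compact support and $p(0)=1$; (C3) $x_0\in\mathcal{D}(\mathfrak{A})$ and $\varphi\in\Phi$ with $\varphi(0)\|\mathfrak{C}x_0-y_{\rm ref}(0)\|_U<1$, where $\Phi$ is the set of real-valued $\varphi\in W^{2,\infty}([0,\infty))$ with $\inf_{t\ge0}\varphi(t)>0$. Closed-loop system (CL): $\dot x(t)=\mathfrak{A}x(t)$, $x(0)=x_0$, $\mathfrak{B}x(t)=u(t)$, $\mathfrak{C}x(t)=y(t)$, $e(t)=y(t)-y_{\rm ref}(t)$, $e_0=\mathfrak{C}x_0-y_{\rm ref}(0)$, $\varphi_0=\varphi(0)$, $u(t)=(\mathfrak{B}x_0+\psi(\varphi_0,e_0))\,p(t)-\psi(\varphi(t),e(t))$,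 where $\psi(\varphi,e)=\frac{1}{1-\varphi^2\|e\|^2}e$ with domain $\mathcal{D}(\psi)=\{(\varphi,e)\in(0,\infty)\times U : \varphi\|e\|<1\}$ (so satisfaction of (CL) at $t$ includes $\varphi(t)\|e(t)\|<1$). Solution: for $T>0$, a solution on $[0,T]$ is an $x\in W^{1,\infty}([0,T];X)$ such that for almost all $t\in[0,T]$, $\dot x$ is continuous at $t$, $x(t)\in\mathcal{D}(\mathfrak{A})$ and (CL) is satisfied. It is known that, whenever the BCS $\mathfrak{S}=(\mathfrak{A},\mathfrak{B},\mathfrak{C})$ satisfies (S1) (with any $\alpha\in\mathbb{R}$), (S2) and (S3), and $x_0$, $y_{\rm ref}$, $p$, $\varphi$ fulfill (C1), (C2) and (C3), such a solution exists and is unique for every $T>0$, and hence there is a unique $x\in W^{1,\infty}_{\rm loc}([0,\infty);X)$ whose restriction to $[0,T]$ is the solution on $[0,T]$ for every $T>0$; this is the global solution referred to in the claim. *)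

(* Defs.v *)
From HB Require Import structures.
From mathcomp Require Import all_boot all_order all_algebra sesquilinear complex.
From mathcomp Require Import all_classical all_reals all_analysis.

Set Implicit Arguments.
Unset Strict Implicit.
Unset Printing Implicit Defensive.

Import Order.TTheory GRing.Theory Num.Theory.
Import numFieldNormedType.Exports.

Local Open Scope classical_set_scope.
Local Open Scope ring_scope.
Local Open Scope complex_scope.

(* The scalar field K is R itself or R[i]. *)
Variant scalar_kind := RealScalars | ComplexScalars.

Definition scalars (R : realType) (kd : scalar_kind) : numFieldType :=
  match kd with RealScalars => R | ComplexScalars => R[i] end.

Definition of_real (R : realType) (kd : scalar_kind) : R -> scalars R kd :=
  match kd with RealScalars => fun r => r | ComplexScalars => fun r => r%:C end.

Definition real_part (R : realType) (kd : scalar_kind) : scalars R kd -> R :=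
  match kd with RealScalars => fun z => z | ComplexScalars => @complex.Re R end.

Definition conj_scalar (R : realType) (kd : scalar_kind) :
    scalars R kd -> scalars R kd :=
  match kd with RealScalars => fun z => z | ComplexScalars => @conjc R end.

HB.mixin Record isHilbert (R : realType) (kd : scalar_kind) (X : Type)
    of CompleteNormedModule (scalars R kd) X := {
  inner : {dot X for @conj_scalar R kd};
  innerE : forall x : X, inner x x = `|x| ^+ 2 }.

(* [{dot X for _}] is linear in its first argument and conjugate-linear in the
   second one. *)
#[short(type="hilbertType")]
HB.structure Definition Hilbert (R : realType) (kd : scalar_kind) :=
  {X of isHilbert R kd X & CompleteNormedModule (scalars R kd) X}.

(* [`|x|] has values in the scalar field; [rnorm x] is the same number in R. *)
Definition rnorm (R : realType) (kd : scalar_kind)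
  (B : normedModType (scalars R kd)) (x : B) : R := real_part `|x|.

Definition bounded_op (R : realType) (kd : scalar_kind)
    (Y Z : normedModType (scalars R kd)) (f : Y -> Z) : Prop :=
  exists M : R, forall y, rnorm (f y) <= M * rnorm y.

Section BochnerSobolev.
Context (R : realType) (kd : scalar_kind) (B : normedModType (scalars R kd)).
Implicit Types (J : set R) (f g : R -> B).

Local Notation mu := (@lebesgue_measure R).

Definition simple_fun (s : R -> B) : Prop :=
  finite_set (range s) /\
  forall b : B, measurable (s @^-1` [set b] : set (measurableTypeR R)).

Definition strongly_measurable J f : Prop :=
  exists s : nat -> R -> B, (forall n, simple_fun (s n)) /\
    {ae mu, forall t, J t -> s n t @[n --> \oo] --> f t}.

Definition Linfty J f : Prop :=
  strongly_measurable J f /\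
  exists M : R, {ae mu, forall t, J t -> rnorm (f t) <= M}.

Definition integrable_simple_fun J (s : R -> B) : Prop :=
  simple_fun s /\
  forall b : B, b != 0 -> (mu (J `&` s @^-1` [set b]) < +oo)%E.

(* The level set of 0 may have infinite measure; its term is 0 in any case. *)
Definition simple_integral J (s : R -> B) : B :=
  \sum_(b \in range s)
    of_real kd (fine (mu (J `&` s @^-1` [set b]))) *: b.

Definition is_bochner_integral J f (v : B) : Prop :=
  strongly_measurable J f /\
  exists s : nat -> R -> B,
    [/\ forall n, integrable_simple_fun J (s n),
        (\int[mu]_(t in J) (rnorm (f t - s n t))%:E)%E @[n --> \oo] --> 0%E
      & simple_integral J (s n) @[n --> \oo] --> v].

Definition test_fun J (eta : R -> R) : Prop :=
  (forall (n : nat) (t : R), derivable (derive1n n eta) t 1) /\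
  exists a b : R, `[a, b]%classic `<=` J° /\
    forall t, ~ `[a, b]%classic t -> eta t = 0.

Definition weak_derivative (n : nat) J f g : Prop :=
  forall eta : R -> R, test_fun J eta ->
    exists v : B,
      is_bochner_integral J (fun t => of_real kd (derive1n n eta t) *: f t) v /\
      is_bochner_integral J (fun t => of_real kd (eta t) *: g t)
        ((-1) ^+ n *: v).

Definition Sobolev_infty (k : nat) J f : Prop :=
  Linfty J f /\
  forall j : nat, (0 < j <= k)%N ->
    exists g : R -> B, Linfty J g /\ weak_derivative j J f g.

Definition Sobolev_infty_loc (k : nat) J f : Prop :=
  forall a b : R, `[a, b]%classic `<=` J ->
    Sobolev_infty k `[a, b]%classic f.

End BochnerSobolev.

(* The domain of A is a Hilbert space of its own, embedded in X by [bcs_emb]. *)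
Record boundary_control_system (R : realType) (kd : scalar_kind)
    (X U : hilbertType R kd) := BCS {
  bcs_dom : hilbertType R kd;
  bcs_emb : {linear bcs_dom -> X};
  bcs_emb_inj : injective bcs_emb;
  bcs_emb_continuous : continuous bcs_emb;
  bcs_A : {linear bcs_dom -> X};
  bcs_A_bounded : bounded_op bcs_A;
  bcs_B : {linear bcs_dom -> U};
  bcs_B_bounded : bounded_op bcs_B;
  bcs_C : {linear bcs_dom -> U};
  bcs_C_bounded : bounded_op bcs_C }.

Section SystemAssumptions.
Context (R : realType) (kd : scalar_kind) (X U : hilbertType R kd).
Variable S : boundary_control_system X U.

Definition system_S1 (alpha : R) : Prop :=
  forall z : bcs_dom S,
    real_part (inner (bcs_A S z) (bcs_emb S z)) <=
    real_part (inner (bcs_B S z) (bcs_C S z)) +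
      alpha * rnorm (bcs_emb S z) ^+ 2.

Definition system_S2 (alpha : R) : Prop :=
  exists2 beta : R, alpha <= beta &
    forall v : X, exists2 z : bcs_dom S, bcs_C S z = 0 &
      bcs_A S z - of_real kd beta *: bcs_emb S z = v.

Definition system_S3 : Prop :=
  forall u y : U, exists z : bcs_dom S, bcs_B S z = u /\ bcs_C S z = y.

End SystemAssumptions.

Definition halfline (R : realType) : set R := `[0, +oo[%classic.
Arguments halfline : clear implicits.

Section Controller.
Context (R : realType) (kd : scalar_kind) (X U : hilbertType R kd).
Variable S : boundary_control_system X U.
Variables (x0 : bcs_dom S) (yref : R -> U) (p : R -> scalars R kd)
  (phi : R -> R).

(* Elements of [W^{k,oo}], [k >= 1], are evaluated pointwise through their
   continuous representative, whence the continuity clauses below. *)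
Definition controller_C1 : Prop :=
  {within halfline R, continuous yref} /\ Sobolev_infty 2 (halfline R) yref.

Definition controller_C2 : Prop :=
  [/\ {within halfline R, continuous p},
      @Sobolev_infty R kd (scalars R kd)^o 2 (halfline R) p,
      compact (closure (halfline R `&` [set t | p t != 0]))
    & p 0 = 1].

Definition funnel_class : Prop :=
  [/\ {within halfline R, continuous phi},
      @Sobolev_infty R RealScalars (scalars R RealScalars)^o 2 (halfline R) phi
    & 0 < inf [set phi t | t in halfline R]].

Definition initial_error : U := bcs_C S x0 - yref 0.

Definition controller_C3 : Prop :=
  funnel_class /\ phi 0 * rnorm initial_error < 1.

Definition psi_dom (r : R) (e : U) : Prop := 0 < r /\ r * rnorm e < 1.

Definition psi (r : R) (e : U) : U :=
  of_real kd (1 - r ^+ 2 * rnorm e ^+ 2)^-1 *: e.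

(* Closed-loop equations at time [t]: [x] is the state, [dx] its derivative. *)
Definition closed_loop_at (t : R) (x dx : X) : Prop :=
  exists (z : bcs_dom S) (u y e : U),
    bcs_emb S z = x /\
    dx = bcs_A S z /\
    bcs_B S z = u /\
    bcs_C S z = y /\
    e = y - yref t /\
    psi_dom (phi t) e /\
    u = p t *: (bcs_B S x0 + psi (phi 0) initial_error) - psi (phi t) e.

(* [dx] is a representative of the weak derivative of [x]; as an L^oo class the
   latter is continuous at almost every point if some representative is. *)
Definition solution_on (T : R) (x : R -> X) : Prop :=
  [/\ {within `[0, T], continuous x},
      Sobolev_infty 1 `[0, T]%classic x,
      x 0 = bcs_emb S x0
    & exists dx : R -> X,
        [/\ Linfty `[0, T]%classic dx,
            weak_derivative 1 `[0, T]%classic x dx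
          & {ae @lebesgue_measure R, forall t, `[0, T]%classic t ->
              {for t, continuous dx} /\ closed_loop_at t (x t) (dx t)}]].

Definition global_solution (x : R -> X) : Prop :=
  Sobolev_infty_loc 1 (halfline R) x /\
  forall T : R, 0 < T -> solution_on T x.

End Controller.

(* Main.v *)
Require Import Defs.
From HB Require Import structures.
From mathcomp Require Import all_boot all_order all_algebra sesquilinear complex.
From mathcomp Require Import all_classical all_reals all_analysis.
From mathcomp Require Import finmap measurable_realfun ring lra zify.

Set Implicit Arguments.
Unset Strict Implicit.
Unset Printing Implicit Defensive.

Import Order.TTheory GRing.Theory Num.Theory.
Import numFieldNormedType.Exports.
Import HBNNSimple.

Local Open Scope classical_set_scope.
Local Open Scope ring_scope.

(** The closed loop is a dissipative system in disguise, and the proof reads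
    off uniform estimates from that dissipativity.

    By (S3) the boundary data can be lifted: there is a twice weakly
    differentiable [q] with values in the domain of [A] such that [B q] is the
    prescribed part [p c] of the input and [C q = yref] ([boundary_lift]).
    Then [w = x - q] satisfies [w' = A w + f], where [f = A q - q'] is bounded
    and Lipschitz, and the control law becomes the pure feedback
    [B w = - psi(phi, C w)].  With (S1) this gives
    [Re <A w, w> <= - gain |C w|^2 + alpha |w|^2] ([funnel_dissipation]), where
    [gain] is the factor of [e] in [psi(phi, e)].  As [alpha < 0], Gronwall's
    inequality bounds [w] on the half-line ([funnel_solution_bounded]).

    The Lipschitz bound comes from comparing [w] with its own time shift.  The
    feedback depends on time through [phi], so the shift is first rescaled:
    the identity [psi(r, th e) = th psi(th r, e)] ([psi_scale]) shows that
    [th w(t + h)] with [th = phi(t + h) / phi(t)] obeys the feedback law of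
    time [t].  As [psi(r, .)] is strongly monotone, the difference
    [D = th w(. + h) - w] obeys
    [Re <A D, D> <= - |C D|^2 + alpha |D|^2] ([funnel_dissipation_scaled]),
    while the equation for [D] is perturbed only by [O(h)].  Gronwall's
    inequality yields [D = O(h)] uniformly in time
    ([funnel_solution_lipschitz]), so that [x' = w' + q'] is bounded.

    Now [A w = w' - f] is bounded, and the first dissipation inequality, read
    backwards, bounds [gain |C w|^2 <= |A w| |w|], therefore the gain and the
    input ([feedback_bounded]).  The second one, applied at two times [s] and
    [t], bounds [|th e(s) - e(t)|^2] by a multiple of [|s - t|]; hence the
    input is continuous on a set of full measure, and so strongly measurable
    ([feedback_rel_continuous]).

    Regularity is only given in the weak Bochner sense.  Each Bochner integral
    is estimated through real functionals that attain the norm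
    ([normed_by_functionals]), which reduces it to real integrals.  Testing
    the weak derivative with differences of smooth steps then shows that a
    continuous function with bounded weak derivative is Lipschitz and is
    differentiable wherever its weak derivative is continuous, and that
    second-order weak derivatives give [C^{1,1}] functions ([sobolev2_C11]).
    The Gronwall argument starts from a one-sided Dini estimate that holds
    almost everywhere: the exceptional null set is covered by an open set of
    small measure, on which the Lipschitz bound takes over ([dini_le]). *)

(** * Real norm and real inner product over either scalar field *)

Section Scalars.
Context (R : realType) (kd : scalar_kind).
Local Notation K := (scalars R kd).
Implicit Types (r s : R) (z : K).

Lemma of_real_is_zmod : zmod_morphism (@of_real R kd).
Proof. by case: kd => r s //=; rewrite rmorphB. Qed.

Lemma of_real_is_monoid : monoid_morphism (@of_real R kd).
Proof. by case: kd; split => //= r s; rewrite rmorphM. Qed.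

HB.instance Definition _ := GRing.isZmodMorphism.Build R K (@of_real R kd)
  of_real_is_zmod.
HB.instance Definition _ := GRing.isMonoidMorphism.Build R K (@of_real R kd)
  of_real_is_monoid.

Lemma real_part_is_zmod : zmod_morphism (@real_part R kd).
Proof. by case: kd => r s //=; rewrite raddfB. Qed.

HB.instance Definition _ := GRing.isZmodMorphism.Build K R (@real_part R kd)
  real_part_is_zmod.

Lemma real_partZ r z : real_part (of_real kd r * z) = r * real_part z.
Proof. by case: kd z => //= -[a b] /=; rewrite mul0r subr0. Qed.

Lemma real_part_conj z : real_part (conj_scalar z) = real_part z.
Proof. by case: kd z => //= -[a b]. Qed.

Lemma real_part_ge0K z : 0 <= z -> of_real kd (real_part z) = z.
Proof.
by case: kd z => //= -[a b]; rewrite lecE/= => /andP[/eqP -> _].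
Qed.

Lemma of_real_norm z : of_real kd (real_part `|z|) = `|z|.
Proof. by apply: real_part_ge0K. Qed.

Lemma of_real_ge0 r : (0 <= of_real kd r) = (0 <= r).
Proof. by case: kd => //=; rewrite lecE/= eqxx. Qed.

Lemma of_real_gt0 r : (0 < of_real kd r) = (0 < r).
Proof. by case: kd => //=; rewrite ltcE/= eqxx. Qed.

Lemma real_part_gt0 z : 0 < z -> 0 < real_part z.
Proof. by move=> z0; rewrite -of_real_gt0 (real_part_ge0K (ltW z0)). Qed.

Lemma ler_of_real r s : (of_real kd r <= of_real kd s) = (r <= s).
Proof. by rewrite -subr_ge0 -rmorphB of_real_ge0 subr_ge0. Qed.

Lemma ltr_of_real r s : (of_real kd r < of_real kd s) = (r < s).
Proof. by rewrite -subr_gt0 -rmorphB of_real_gt0 subr_gt0. Qed.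

Lemma normr_of_real r : `|of_real kd r| = of_real kd `|r|.
Proof.
case: kd => //=.
by rewrite normc_def/= expr0n addr0 sqrtr_sqr.
Qed.

Lemma real_part_le_norm z : real_part z <= real_part `|z|.
Proof.
case: kd z => /=; first exact: ler_norm.
move=> [a b]; rewrite /Normc.normc/=.
apply: (le_trans (ler_norm a)); rewrite -sqrtr_sqr ler_sqrt ?lerDl ?sqr_ge0//.
by rewrite addr_ge0 ?sqr_ge0.
Qed.

Lemma real_part_mulCconj z : real_part (z * conj_scalar z) = real_part `|z| ^+ 2.
Proof.
case: kd z => /= [z|[a b]]; first by rewrite real_normK ?num_real.
by rewrite /Normc.normc/= sqr_sqrtr ?addr_ge0 ?sqr_ge0//; ring.
Qed.

Lemma real_part_normM z z' :
  real_part `|z * z'| = real_part `|z| * real_part `|z'|.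
Proof. by rewrite normrM -{1}of_real_norm real_partZ. Qed.

Lemma norm_conj_scalar z : `|conj_scalar z| = `|z|.
Proof. by case: kd z => //= -[a b]; rewrite !normc_def/= sqrrN. Qed.

Section Norm.
Context (B : normedModType K).
Implicit Types x y : B.

Lemma of_real_rnorm x : of_real kd (rnorm x) = `|x|.
Proof. exact: real_part_ge0K. Qed.

Lemma rnorm_ge0 x : 0 <= rnorm x.
Proof. by rewrite -(of_real_ge0) of_real_rnorm. Qed.

Lemma rnorm0 : rnorm (0 : B) = 0.
Proof. by rewrite /rnorm normr0 raddf0. Qed.

Lemma rnorm_eq0 x : rnorm x = 0 -> x = 0.
Proof.
by move=> h; apply/normr0_eq0; rewrite -of_real_rnorm h rmorph0.
Qed.

Lemma rnormN x : rnorm (- x) = rnorm x.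
Proof. by rewrite /rnorm normrN. Qed.

Lemma rnormB x y : rnorm (x - y) = rnorm (y - x).
Proof. by rewrite /rnorm distrC. Qed.

Lemma rnormD x y : rnorm (x + y) <= rnorm x + rnorm y.
Proof. by rewrite -ler_of_real rmorphD/= !of_real_rnorm ler_normD. Qed.

Lemma rnormDB x y (w : B) : rnorm (x - w) <= rnorm (x - y) + rnorm (y - w).
Proof. by rewrite (le_trans _ (rnormD _ _))// addrA subrK. Qed.

Lemma rnormBD x y : rnorm (x - y) <= rnorm x + rnorm y.
Proof. by rewrite -(rnormN y) rnormD. Qed.

Lemma rnorm_sub x y : rnorm x <= rnorm y + rnorm (x - y).
Proof. by have := rnormD y (x - y); rewrite addrC subrK. Qed.

Lemma rnormZ r x : rnorm (of_real kd r *: x) = `|r| * rnorm x.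
Proof. by rewrite /rnorm normrZ normr_of_real real_partZ. Qed.

Lemma rnormZk (a : K) x : rnorm (a *: x) = real_part `|a| * rnorm x.
Proof. by rewrite /rnorm normrZ -{1}of_real_norm real_partZ. Qed.

Lemma rscalerA r s x :
  of_real kd r *: (of_real kd s *: x) = of_real kd (r * s) *: x.
Proof. by rewrite scalerA rmorphM. Qed.

Lemma rscalerDl r s x :
  of_real kd (r + s) *: x = of_real kd r *: x + of_real kd s *: x.
Proof. by rewrite rmorphD scalerDl. Qed.

Lemma rscaler1 x : of_real kd 1 *: x = x.
Proof. by rewrite rmorph1 scale1r. Qed.

Lemma rnorm_gt0 x : x != 0 -> 0 < rnorm x.
Proof.
by move=> x0; rewrite -of_real_gt0 of_real_rnorm normr_gt0.
Qed.

(** Over the complex field, topological statements quantify over positive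
    complex radii; this reduces them to real ones. *)
Lemma cvg_rnormP (T : Type) (F : set_system T) (FF : Filter F) (f : T -> B) (l : B) :
  (f x @[x --> F] --> l) <->
  (forall e : R, 0 < e -> \forall x \near F, rnorm (f x - l) < e).
Proof.
split=> [/cvgrPdist_lt fl e e0|h].
  have := fl (of_real kd e); rewrite of_real_gt0 => /(_ e0).
  apply: filterS => t; rewrite -of_real_rnorm rnormB => ht.
  by rewrite -subr_gt0 -of_real_gt0 rmorphB/= subr_gt0.
apply/cvgrPdist_lt => e e0.
have ek := real_part_ge0K (ltW e0).
have := h (real_part e); rewrite -of_real_gt0 ek => /(_ e0).
apply: filterS => t; rewrite rnormB -of_real_rnorm => ht.
by rewrite -subr_gt0 -ek -rmorphB/= of_real_gt0 subr_gt0.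
Qed.

End Norm.

(** All limits of vectors below are taken along geometric sequences, with this
    explicit error. *)
Lemma rnorm_complete (B : completeNormedModType K) (a : nat -> B) (C : R) :
  (forall n, rnorm (a n.+1 - a n) <= C * 2^-1 ^+ n) ->
  exists l, forall n, rnorm (a n - l) <= C * 2 * 2^-1 ^+ n.
Proof.
move=> h.
have C0 : 0 <= C.
  by have := h 0%N; rewrite expr0 mulr1; apply/le_trans/rnorm_ge0.
(* partial geometric sums: the sum of 2^-(n+i) over i < k is 2 * 2^-n * (1 - 2^-k) *)
have hk n k : rnorm (a (n + k)%N - a n) <= C * 2 * 2^-1 ^+ n * (1 - 2^-1 ^+ k).
  elim: k => [|k IHk]; first by rewrite addn0 subrr rnorm0 expr0 subrr mulr0.
  apply: (le_trans (rnormDB _ (a (n + k)%N) _)).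
  rewrite addnS; apply: (le_trans (lerD (h _) IHk)).
  by rewrite exprD exprS le_eqVlt; apply/orP; left; apply/eqP; field.
have hm n m : (n <= m)%N -> rnorm (a m - a n) <= C * 2 * 2^-1 ^+ n.
  move=> nm; rewrite -(subnKC nm); apply: (le_trans (hk _ _)).
  rewrite ler_piMr// ?mulr_ge0 ?exprn_ge0// lerBlDr lerDl exprn_ge0//.
have pw0 : (fun n => C * 2 * 2^-1 ^+ n : R) @ \oo --> (0 : R).
  rewrite -[X in _ --> X](mulr0 (C * 2)); apply: cvgMr.
  by apply: cvg_expr; rewrite gtr0_norm ?invr_gt0// invf_lt1 ?ltr1n.
have small (e : R) : 0 < e -> exists n, C * 2 * 2^-1 ^+ n < e.
  move=> e0; move/cvgrPdist_lt : pw0 => /(_ _ e0)[n _ /(_ n (leqnn n))].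
  rewrite sub0r normrN => hn; exists n; exact: le_lt_trans (ler_norm _) hn.
have : cvg (a @ \oo).
  apply: cauchy_cvg; apply: cauchy_exP => e e0.
  have re0 := real_part_gt0 e0.
  have [n hn] := small _ re0.
  rewrite -ball_normE/=; exists (a n), n => // m nm /=.
  rewrite -of_real_rnorm rnormB -(real_part_ge0K (ltW e0)).
  rewrite -subr_gt0 -rmorphB of_real_gt0 subr_gt0.
  by apply: le_lt_trans hn; apply: hm.
move=> /cvg_ex[l /= al]; exists l => n; apply/ler_addgt0Pr => e e0.
move/cvg_rnormP : al => /(_ _ e0)[N _ hN].
have h2 := hN (maxn n N) (leq_maxr _ _).
have h1 := hm n (maxn n N) (leq_maxl _ _).
apply: (le_trans (rnormDB _ (a (maxn n N)) _)).
by rewrite rnormB; apply: lerD => //; apply: ltW.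
Qed.

End Scalars.

Section RealInner.
Context (R : realType) (kd : scalar_kind) (X : hilbertType R kd).
Local Notation K := (scalars R kd).
Implicit Types x y z : X.

(** The real Hilbert space structure underlying a Hilbert space over either
    field; all estimates of the proof only involve this one. *)
Definition rdot x y : R := real_part (inner x y).

Lemma innerC x y : inner x y = conj_scalar (inner y x).
Proof. by have := @hermitian_subproof _ _ _ _ (@inner R kd X) x y; rewrite expr0 mul1r. Qed.

Lemma rdotC x y : rdot x y = rdot y x.
Proof. by rewrite /rdot innerC real_part_conj. Qed.

Lemma rdotDl x y z : rdot (x + y) z = rdot x z + rdot y z.
Proof. by rewrite /rdot linearDl raddfD. Qed.

Lemma rdotNl x z : rdot (- x) z = - rdot x z.
Proof. by rewrite /rdot linearNl raddfN. Qed.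

Lemma rdotBl x y z : rdot (x - y) z = rdot x z - rdot y z.
Proof. by rewrite rdotDl rdotNl. Qed.

Lemma rdotZl (r : R) x z : rdot (of_real kd r *: x) z = r * rdot x z.
Proof. by rewrite /rdot linearZl_LR real_partZ. Qed.

Lemma rdotDr x y z : rdot z (x + y) = rdot z x + rdot z y.
Proof. by rewrite rdotC rdotDl !(rdotC _ z). Qed.

Lemma rdotNr x z : rdot z (- x) = - rdot z x.
Proof. by rewrite rdotC rdotNl rdotC. Qed.

Lemma rdotBr x y z : rdot z (x - y) = rdot z x - rdot z y.
Proof. by rewrite rdotDr rdotNr. Qed.

Lemma rdotZr (r : R) x z : rdot z (of_real kd r *: x) = r * rdot z x.
Proof. by rewrite rdotC rdotZl rdotC. Qed.

Lemma rdot0l y : rdot 0 y = 0.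
Proof. by have := rdotZl 0 0 y; rewrite rmorph0 scale0r mul0r. Qed.

Lemma rdot0r y : rdot y 0 = 0.
Proof. by rewrite rdotC rdot0l. Qed.

Lemma rdotxx x : rdot x x = rnorm x ^+ 2.
Proof. by rewrite /rdot innerE expr2 -{1}of_real_rnorm real_partZ. Qed.

Lemma rdot_le x y : rdot x y <= rnorm x * rnorm y.
Proof.
have [->|x0] := eqVneq x 0.
  by rewrite rdot0l rnorm0 mul0r.
have [->|y0] := eqVneq y 0.
  by rewrite rdot0r rnorm0 mulr0.
have nx := rnorm_gt0 x0; have ny := rnorm_gt0 y0.
have : 0 <= rdot (of_real kd (rnorm y) *: x - of_real kd (rnorm x) *: y)
                 (of_real kd (rnorm y) *: x - of_real kd (rnorm x) *: y).
  by rewrite rdotxx sqr_ge0.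
rewrite !(rdotBl, rdotBr, rdotZl, rdotZr) !rdotxx (rdotC y x) => h.
have : 0 <= 2 * (rnorm x * rnorm y) * (rnorm x * rnorm y - rdot x y) by nra.
by rewrite pmulr_rge0 ?subr_ge0// mulr_gt0// mulr_gt0.
Qed.

Lemma rnormD_sqr x y :
  rnorm (x + y) ^+ 2 = rnorm x ^+ 2 + 2 * rdot x y + rnorm y ^+ 2.
Proof. by rewrite -!rdotxx rdotDl !rdotDr (rdotC y x); ring. Qed.

Lemma rnormB_sqr x y :
  rnorm (x - y) ^+ 2 = rnorm x ^+ 2 - 2 * rdot x y + rnorm y ^+ 2.
Proof. by rewrite rnormD_sqr rnormN rdotNr; ring. Qed.

End RealInner.

(** A real functional is used even over the complex field: it is enough to
    recover the norm and turns vector inequalities into real ones. *)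
Definition norming_fun (R : realType) (kd : scalar_kind)
    (B : normedModType (scalars R kd)) (l : B -> R) : Prop :=
  [/\ forall x y, l (x + y) = l x + l y,
      forall (r : R) x, l (of_real kd r *: x) = r * l x
    & forall x, l x <= rnorm x].

Definition normed_by_functionals (R : realType) (kd : scalar_kind)
    (B : normedModType (scalars R kd)) : Prop :=
  forall b : B, exists2 l : B -> R, norming_fun l & l b = rnorm b.

Section Norming.
Context (R : realType) (kd : scalar_kind).

(** The inner product with [b / |b|] attains the norm at [b], by the
    Cauchy-Schwarz inequality. *)
Lemma hilbert_normed_by_functionals (X : hilbertType R kd) :
  normed_by_functionals X.
Proof.
move=> b; have [->|b0] := eqVneq b 0.
  exists (fun=> 0); last by rewrite rnorm0.
  by split=> *; rewrite ?addr0 ?mulr0// rnorm_ge0.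
have nb := rnorm_gt0 b0.
exists (fun x => (rnorm b)^-1 * rdot x b).
  split=> [x y|r x|x]; first by rewrite rdotDl mulrDr.
    by rewrite rdotZl mulrCA.
  by rewrite ler_pdivrMl// mulrC rdot_le.
by rewrite rdotxx expr2 mulKf// gt_eqF.
Qed.

Lemma scalars_normed_by_functionals :
  @normed_by_functionals R kd (scalars R kd)^o.
Proof.
move=> b; have [->|b0] := eqVneq b 0.
  exists (fun=> 0); last by rewrite rnorm0.
  by split=> *; rewrite ?addr0 ?mulr0// rnorm_ge0.
have nb := rnorm_gt0 b0.
exists (fun x => (rnorm b)^-1 * real_part (x * conj_scalar b)).
  split=> [x y|r x|x].
  - by rewrite mulrDl raddfD mulrDr.
  - by rewrite -scalerAl [_ *: _]/(of_real kd r * _) real_partZ mulrCA.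
  - rewrite ler_pdivrMl// mulrC (le_trans (real_part_le_norm _))//.
    by rewrite real_part_normM norm_conj_scalar.
by rewrite real_part_mulCconj expr2 mulKf// gt_eqF.
Qed.

Variables (B : normedModType (scalars R kd)) (l : B -> R).
Hypothesis hl : norming_fun l.

Lemma norming_fun0 : l 0 = 0.
Proof.
case: hl => lD _ _; have := lD 0 0; rewrite addr0 => h.
by apply: (addrI (l 0)); rewrite -h addr0.
Qed.

Lemma norming_funN x : l (- x) = - l x.
Proof.
case: hl => lD _ _; apply/eqP; rewrite -addr_eq0 -lD addNr; apply/eqP.
exact: norming_fun0.
Qed.

Lemma norming_funB x y : l (x - y) = l x - l y.
Proof. by case: (hl) => lD _ _; rewrite lD norming_funN. Qed.

Lemma norming_fun_abs x : `|l x| <= rnorm x.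
Proof.
case: (hl) => _ _ ll.
by rewrite ler_norml ll andbT lerNl -norming_funN -(rnormN x) ll.
Qed.

Lemma norming_fun_opp : norming_fun (fun x => - l x).
Proof.
case: (hl) => lD lZ ll; split=> [x y|r x|x].
- by rewrite lD opprD.
- by rewrite lZ mulrN.
- by rewrite -norming_funN (le_trans (ll _))// rnormN.
Qed.

End Norming.

(** * Bounded linear lifting of the boundary data *)

Lemma exp_half_small (R : realType) (C e : R) :
  0 < e -> exists n : nat, C * 2^-1 ^+ n < e.
Proof.
move=> e0.
have : (fun n => C * 2^-1 ^+ n : R) @ \oo --> (0 : R).
  rewrite -[X in _ --> X](mulr0 C); apply: cvgMr.
  by apply: cvg_expr; rewrite gtr0_norm ?invr_gt0// invf_lt1 ?ltr1n.
move=> /cvgrPdist_lt /(_ _ e0)[n _ /(_ n (leqnn n))].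
rewrite sub0r normrN => hn; exists n; exact: le_lt_trans (ler_norm _) hn.
Qed.

Lemma ler_approx_exp_half (R : realType) (a b C : R) :
  (forall n : nat, a <= b + C * 2^-1 ^+ n) -> a <= b.
Proof.
move=> h; apply/ler_addgt0Pr => e /(exp_half_small C)[n hn].
by apply: (le_trans (h n)); rewrite lerD2l ltW.
Qed.

Section RightInverse.
Context (R : realType) (kd : scalar_kind).
Local Notation K := (scalars R kd).

Lemma continuous_linear_bounded_op (Y Z : normedModType K) (f : {linear Y -> Z}) :
  continuous f -> bounded_op f.
Proof.
move=> /(_ 0); rewrite /continuous_at linear0 => /cvg_rnormP/(_ 1 ltr01).
move=> /nbhs_ballP[e /= e0 he].
have re0 := real_part_gt0 e0.
exists (2 / real_part e) => y.
have [->|y0] := eqVneq y 0; first by rewrite linear0 !rnorm0 mulr0.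
have ny := rnorm_gt0 y0.
(* rescales y into the ball of radius e around 0, where f is bounded by 1 *)
pose a := real_part e / (2 * rnorm y).
have a0 : 0 < a by rewrite divr_gt0// mulr_gt0.
have he' z : rnorm z < real_part e -> rnorm (f z) < 1.
  move=> hz; have := he z; rewrite -ball_normE/= sub0r normrN subr0; apply.
  by rewrite -of_real_rnorm -(real_part_ge0K (ltW e0)) ltr_of_real.
have := he' (of_real kd a *: y).
rewrite linearZ /= !rnormZ (gtr0_norm a0).
have -> : a * rnorm y = real_part e / 2 by rewrite /a; field; rewrite gt_eqF.
move=> /(_ _)/wrap[]; first by lra.
rewrite -ltr_pdivlMl// mulr1 => /ltW/le_trans; apply.
by rewrite /a invf_div mulrAC.
Qed.

Lemma bounded_op_pos (Y Z : normedModType K) (f : Y -> Z) : bounded_op f ->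
  exists2 M : R, 0 < M & forall y, rnorm (f y) <= M * rnorm y.
Proof.
move=> [M hM]; exists (`|M| + 1) => [|y]; first by rewrite ltr_wpDl.
apply: (le_trans (hM y)); rewrite ler_wpM2r ?rnorm_ge0//.
by rewrite (le_trans (ler_norm M))// lerDl.
Qed.

Variables (D : hilbertType R kd) (V W : hilbertType R kd).
Variables (L1 : {linear D -> W}) (L2 : {linear D -> V}).
Hypotheses (bL1 : bounded_op L1) (bL2 : bounded_op L2).
Hypothesis surj : forall y, exists z, L1 z = 0 /\ L2 z = y.

Let approx (M : R) (y : V) := forall e : R, 0 < e ->
  exists k, [/\ L1 k = 0, rnorm k <= M & rnorm (y - L2 k) < e].

(** The Baire argument of the open mapping theorem: if for every [M] no ball
    consisted of points approximable from elements of norm [M], nested closed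
    balls could be chosen whose [n]-th one avoids the points approximable with
    bound [n]; their common point [l] has an exact preimage, of some finite
    norm, which is a contradiction. *)
Lemma baire_approx : exists (M r : R) (y0 : V), 0 < r /\
  forall y, rnorm (y - y0) < r -> approx M y.
Proof.
apply: contrapT => hneg.
have step (p : nat * (V * R)) : exists q : V * R, 0 < p.2.2 ->
    [/\ 0 < q.2, q.2 <= p.2.2 / 2, rnorm (q.1 - p.2.1) <= p.2.2 / 2
      & forall y, rnorm (y - q.1) <= q.2 -> ~ approx p.1%:R y].
  case: p => n [y0 r] /=; have [r0|] := boolP (0 < r); last first.
    by exists (0, 0).
  have [y [hy /existsNP[e /not_implyP[e0 he]]]] :
      exists y, rnorm (y - y0) < r / 2 /\ ~ approx n%:R y.
    apply: contrapT => h2; apply: hneg; exists n%:R, (r / 2), y0.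
    split; first by lra.
    by move=> y hy; apply: contrapT => h3; apply: h2; exists y.
  exists (y, Num.min (r / 2) (e / 2)) => _ /=; split.
  - by rewrite lt_min !divr_gt0.
  - by rewrite ge_min lexx.
  - exact: ltW.
  - move=> y' hy' /(_ (e / 2))[]; first by lra.
    move=> k [k1 k2 k3]; apply: he; exists k; split=> //.
    apply: (le_lt_trans (rnormDB _ y' _)); rewrite rnormB.
    move: hy'; rewrite le_min => /andP[_]; lra.
have [f hf] := choice step.
pose a := fix a n := if n is m.+1 then f (m, a m) else (0 : V, 1 : R).
have apos n : 0 < (a n).2.
  by elim: n => [|n IHn] /=; [rewrite ltr01 | case: (hf (n, a n) IHn)].
have ahalf n : (a n).2 <= 2^-1 ^+ n.
  elim: n => [|n IHn]; first by rewrite expr0.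
  case: (hf (n, a n) (apos n)) => _ h _ _; apply: (le_trans h) => /=.
  by rewrite exprS mulrC ler_pM2l ?invr_gt0.
have [l hl] : exists l, forall n, rnorm ((a n).1 - l) <= (a n).2.
  have [l hl] : exists l, forall n, rnorm ((a n).1 - l) <= 1 * 2 * 2^-1 ^+ n.
    apply: rnorm_complete => n; case: (hf (n, a n) (apos n)) => _ _ h _.
    apply: (le_trans h) => /=; have := ahalf n.
    by have := apos n; have : 0 <= 2^-1 ^+ n :> R by []; lra.
  exists l => n.
  have hk k : rnorm ((a n).1 - (a (n + k)%N).1) <= (a n).2 - (a (n + k)%N).2.
    elim: k => [|k IHk]; first by rewrite addn0 !subrr rnorm0.
    apply: (le_trans (rnormDB _ (a (n + k)%N).1 _)); rewrite addnS.
    case: (hf ((n + k)%N, a (n + k)%N) (apos _)) => _ h1 h2 _.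
    rewrite (rnormB _ (a (n + k).+1).1).
    move: h1 h2 IHk => /=; lra.
  apply: (@ler_approx_exp_half _ _ _ 2) => k.
  apply: (le_trans (rnormDB _ (a (n + k)%N).1 _)); apply: lerD.
    by apply: (le_trans (hk k)); rewrite gerBl ltW.
  apply: (le_trans (hl _)); rewrite mul1r ler_pM2l// ler_wiXn2l ?leq_addl//.
  by rewrite invf_le1 ?ler1n.
have [z [z1 z2]] := surj l.
have [n hn] : exists n, rnorm z <= n%:R.
  by exists (Num.truncn (rnorm z)).+1; rewrite ltW// truncnS_gt.
case: (hf (n, a n) (apos n)) => _ _ _ /(_ l); apply.
  by rewrite rnormB; exact: hl n.+1.
by move=> e e0; exists z; rewrite z2 subrr rnorm0.
Qed.

(** A small multiple of [y] is the difference of two points of the ball of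
    [baire_approx]; subtracting approximants and scaling back gives a bound
    proportional to [|y|]. *)
Lemma approx_homogeneous : exists2 C : R, 0 < C & forall y, approx (C * rnorm y) y.
Proof.
have [M [r [y0 [r0 h]]]] := baire_approx.
have M0 : 0 <= M.
  have [|k [_ kM _]] := h y0 _ 1 ltr01; first by rewrite subrr rnorm0.
  exact: le_trans (rnorm_ge0 k) kM.
have C0 : 0 < 4 * (M + 1) / r by rewrite divr_gt0// mulr_gt0// ltr_wpDl.
exists (4 * (M + 1) / r) => // y e e0.
have [->|yn0] := eqVneq y 0.
  by exists 0; split; rewrite ?linear0 ?addr0 ?rnorm0 ?mulr0.
have ny := rnorm_gt0 yn0.
pose a := r / (2 * rnorm y).
have a0 : 0 < a by rewrite divr_gt0// mulr_gt0.
have an : a * rnorm y = r / 2 by rewrite /a; field; rewrite gt_eqF.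
have ae : 0 < a * (e / 2) by rewrite mulr_gt0// divr_gt0.
have [|k1 [k11 k12 k13]] := h (y0 + of_real kd a *: y) _ _ ae.
  by rewrite addrAC subrr add0r rnormZ gtr0_norm// an; lra.
have [|k2 [k21 k22 k23]] := h y0 _ _ ae; first by rewrite subrr rnorm0.
exists (of_real kd a^-1 *: (k1 - k2)); split.
- by rewrite linearZ linearB /= k11 k21 subrr scaler0.
- rewrite rnormZ gtr0_norm ?invr_gt0//.
  apply: (@le_trans _ _ (a^-1 * (M + M))).
    by rewrite ler_pM2l ?invr_gt0// (le_trans (rnormBD _ _))// lerD.
  have -> : 4 * (M + 1) / r * rnorm y = a^-1 * (M + M + 2).
    by rewrite /a; field; rewrite !gt_eqF.
  by rewrite ler_pM2l ?invr_gt0// lerDl.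
- have -> : y - L2 (of_real kd a^-1 *: (k1 - k2)) =
    of_real kd a^-1 *: ((y0 + of_real kd a *: y - L2 k1) - (y0 - L2 k2)).
    rewrite linearZ linearB /= -[in LHS](scale1r y) -(rmorph1 (of_real kd)).
    rewrite -[in LHS](mulVf (lt0r_neq0 a0)) rmorphM -scalerA -scalerBr.
    congr (_ *: _); rewrite !opprB !addrA (addrC y0) -!addrA; congr (_ + _).
    by rewrite [- L2 k1 + _]addrC addrA [y0 + _]addrC subrK.
  rewrite rnormZ gtr0_norm ?invr_gt0// ltr_pdivrMl//.
  by apply: (le_lt_trans (rnormBD _ _)); lra.
Qed.

(** Correcting the remainder of each approximation, which halves at every
    step, sums to an exact preimage. *)
Lemma bounded_preimage : exists2 C : R, 0 < C &
  forall y, exists k, [/\ L1 k = 0, L2 k = y & rnorm k <= C * rnorm y].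
Proof.
have [C C0 hC] := approx_homogeneous.
exists (C * 2); first by rewrite mulr_gt0.
move=> y; have [->|yn0] := eqVneq y 0.
  by exists 0; split; rewrite ?linear0 ?rnorm0 ?mulr0.
have ny := rnorm_gt0 yn0.
have step (p : V * R) : exists k, 0 < p.2 ->
    [/\ L1 k = 0, rnorm k <= C * rnorm p.1 & rnorm (p.1 - L2 k) < p.2].
  case: p => v e /=; have [e0|] := boolP (0 < e); last by exists 0.
  by have [k hk] := hC v e e0; exists k.
have [f hf] := choice step.
pose s := fix s n := if n is m.+1
  then s m + f (y - L2 (s m), rnorm y * 2^-1 ^+ m.+1) else 0 : D.
have ep n : 0 < rnorm y * 2^-1 ^+ n by rewrite mulr_gt0// exprn_gt0.
have s1 n : L1 (s n) = 0.
  elim: n => [|n IHn] /=; first by rewrite linear0.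
  by rewrite linearD IHn add0r; case: (hf (y - L2 (s n), rnorm y * 2^-1 ^+ n.+1) (ep _)).
have s2 n : rnorm (y - L2 (s n)) <= rnorm y * 2^-1 ^+ n.
  case: n => [|n] /=; first by rewrite linear0 subr0 expr0 mulr1.
  rewrite linearD opprD addrA.
  by case: (hf (y - L2 (s n), rnorm y * 2^-1 ^+ n.+1) (ep _)) => _ _ /ltW.
have [l hl] : exists l, forall n, rnorm (s n - l) <= C * rnorm y * 2 * 2^-1 ^+ n.
  apply: rnorm_complete => n /=; rewrite addrAC subrr add0r.
  case: (hf (y - L2 (s n), rnorm y * 2^-1 ^+ n.+1) (ep _)) => _ h _.
  by apply: (le_trans h); rewrite -mulrA ler_pM2l//; exact: s2.
exists l; split.
- have [M M0 hM] := bounded_op_pos bL1.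
  apply/rnorm_eq0/eqP; rewrite eq_le rnorm_ge0 andbT.
  apply: (@ler_approx_exp_half _ _ _ (M * (C * rnorm y * 2))) => n.
  rewrite add0r -[L1 l](subrKC (L1 (s n))) s1 add0r -(s1 n) -linearB.
  by apply: (le_trans (hM _)); rewrite rnormB -mulrA ler_pM2l.
- have [M M0 hM] := bounded_op_pos bL2.
  apply/esym/eqP; rewrite -subr_eq0; apply/eqP/rnorm_eq0/eqP.
  rewrite eq_le rnorm_ge0 andbT.
  apply: (@ler_approx_exp_half _ _ _ (rnorm y + M * (C * rnorm y * 2))) => n.
  rewrite add0r mulrDl; apply: (le_trans (rnormDB _ (L2 (s n)) _)).
  apply: lerD; first exact: s2.
  by rewrite -linearB; apply: (le_trans (hM _)); rewrite -mulrA ler_pM2l.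
- by have := hl 0%N; rewrite /= sub0r rnormN expr0 mulr1 mulrAC.
Qed.

Let fiber y := [set z | L1 z = 0 /\ L2 z = y].
Let ortho z := forall n, L1 n = 0 -> L2 n = 0 -> rdot z n = 0.

(** A minimising sequence for the norm on the (closed, affine) fibre is Cauchy
    by the parallelogram identity, because midpoints stay in the fibre.  The
    minimiser is orthogonal to [ker L1 /\ ker L2]. *)
Lemma minimal_preimage y : exists z, fiber y z /\ ortho z.
Proof.
pose N := [set rnorm z ^+ 2 | z in fiber y].
have N0 : has_inf N.
  split; last by exists 0 => _ [z _ <-]; exact: sqr_ge0.
  by have [z hz] := surj y; exists (rnorm z ^+ 2), z.
have dle z : fiber y z -> inf N <= rnorm z ^+ 2.
  by move=> hz; apply: ge_inf; [case: N0|exists z].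
have d0 : 0 <= inf N.
  by apply: lb_le_inf; [case: N0|move=> _ [z _ <-]; exact: sqr_ge0].
set d := inf N in dle d0 *.
have step (n : nat) : exists z, fiber y z /\ rnorm z ^+ 2 < d + (2^-1 ^+ n) ^+ 2.
  have [|_ [z hz <-] hlt] := @inf_adherent _ N ((2^-1 ^+ n) ^+ 2) _ N0.
    by rewrite exprn_gt0// exprn_gt0.
  by exists z.
have [s hs] := choice step.
have [l hl] : exists l, forall n, rnorm (s n - l) <= 2 * 2 * 2^-1 ^+ n.
  apply: rnorm_complete => n.
  have [[a1 a2] a3] := hs n; have [[b1 b2] b3] := hs n.+1.
  have hmid : d <= rnorm (of_real kd 2^-1 *: (s n.+1 + s n)) ^+ 2.
    apply: dle; split; rewrite linearZ linearD /=; first by rewrite a1 b1 addr0 scaler0.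
    rewrite a2 b2; have -> : y + y = of_real kd (1 + 1) *: y.
      by rewrite rscalerDl rscaler1.
    by rewrite rscalerA mulVf ?rscaler1.
  rewrite rnormZ gtr0_norm ?invr_gt0// exprMn rnormD_sqr in hmid.
  have p0 : 0 <= 2^-1 ^+ n :> R by [].
  rewrite -ler_sqr ?nnegrE ?rnorm_ge0 ?mulr_ge0// rnormB_sqr.
  rewrite [2^-1 ^+ n.+1]exprS in b3.
  by move: a3 b3 hmid p0; set p := 2^-1 ^+ n; have := sqr_ge0 p; rewrite !exprMn !expr2; lra.
have L0 (V' : hilbertType R kd) (L : {linear D -> V'}) (y' : V') : bounded_op L ->
    (forall n, L (s n) = y') -> L l = y'.
  move=> /bounded_op_pos[M M0 hM] Ls.
  apply/esym/eqP; rewrite -subr_eq0; apply/eqP/rnorm_eq0/eqP.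
  rewrite eq_le rnorm_ge0 andbT.
  apply: (@ler_approx_exp_half _ _ _ (M * (2 * 2))) => n.
  rewrite add0r -(Ls n) -linearB; apply: (le_trans (hM _)).
  by rewrite -mulrA ler_pM2l.
have fl : fiber y l by split; apply: L0 => // n; case: (hs n) => -[].
have ld : rnorm l ^+ 2 = d.
  apply/eqP; rewrite eq_le dle// andbT -(sqr_sqrtr d0).
  rewrite ler_sqr ?nnegrE ?rnorm_ge0 ?sqrtr_ge0//.
  apply: (@ler_approx_exp_half _ _ _ (1 + 2 * 2)) => n.
  apply: (le_trans (rnorm_sub _ (s n))); rewrite mulrDl addrA lerD//.
    rewrite -ler_sqr ?nnegrE ?rnorm_ge0 ?addr_ge0 ?mulr_ge0 ?sqrtr_ge0//.
    rewrite sqrrD sqr_sqrtr// mul1r; have [_ /ltW/le_trans] := hs n; apply.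
    by rewrite addrAC lerDl mulrn_wge0// mulr_ge0 ?sqrtr_ge0.
  by rewrite rnormB.
exists l; split=> // n n1 n2.
set c := rdot l n.
(* first-order optimality of l in the direction n *)
have ht (t : R) : 0 <= 2 * t * c + t ^+ 2 * rnorm n ^+ 2.
  have : d <= rnorm (l + of_real kd t *: n) ^+ 2.
    apply: dle; case: fl => l1 l2.
    by split; rewrite linearD linearZ /= ?n1 ?n2 scaler0 addr0.
  by rewrite rnormD_sqr rdotZr rnormZ exprMn real_normK ?num_real// ld -/c; lra.
have m0 : 0 <= rnorm n ^+ 2 by rewrite sqr_ge0.
set m := rnorm n ^+ 2 in ht m0.
have m1 : 0 < m + 1 by lra.
(* any small enough t of the sign of - c would do; this one avoids dividing by m = |n|^2,
   which may vanish *)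
have := ht (- c / (m + 1)).
have -> : 2 * (- c / (m + 1)) * c + (- c / (m + 1)) ^+ 2 * m =
  - (c ^+ 2 * (m + 2) / (m + 1) ^+ 2) by field; rewrite gt_eqF.
rewrite oppr_ge0 => h.
have : c ^+ 2 * (m + 2) <= 0.
  by move: h; rewrite ler_pdivrMr ?exprn_gt0// mul0r.
rewrite pmulr_lle0; last by lra.
by move=> h2; apply/eqP; rewrite -sqrf_eq0 eq_le h2 sqr_ge0.
Qed.

(** Taking the preimage orthogonal to the common kernel makes the choice unique,
    hence linear; its minimality makes it bounded by [bounded_preimage]. *)
Lemma bounded_right_inverse : exists Q : V -> D,
  [/\ forall y y', Q (y + y') = Q y + Q y',
      forall (r : R) y, Q (of_real kd r *: y) = of_real kd r *: Q y,
      exists2 C : R, 0 < C & forall y, rnorm (Q y) <= C * rnorm y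
    & forall y, L1 (Q y) = 0 /\ L2 (Q y) = y].
Proof.
have [Q hQ] := choice minimal_preimage.
have uniq y z : fiber y z -> ortho z -> Q y = z.
  move=> [z1 z2] oz; have [[q1 q2] oq] := hQ y.
  apply/eqP; rewrite -subr_eq0; apply/eqP/rnorm_eq0/eqP.
  have d1 : L1 (Q y - z) = 0 by rewrite linearB /= q1 z1 subrr.
  have d2 : L2 (Q y - z) = 0 by rewrite linearB /= q2 z2 subrr.
  by rewrite -sqrf_eq0 -rdotxx rdotBl oq// oz// subrr.
exists Q; split.
- move=> y y'; have [[a1 a2] a3] := hQ y; have [[b1 b2] b3] := hQ y'.
  apply: uniq; first by split; rewrite linearD /= ?a1 ?b1 ?addr0// a2 b2.
  by move=> n n1 n2; rewrite rdotDl a3// b3// addr0.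
- move=> r y; have [[a1 a2] a3] := hQ y.
  apply: uniq; first by split; rewrite linearZ /= ?a1 ?scaler0// a2.
  by move=> n n1 n2; rewrite rdotZl a3// mulr0.
- have [C C0 hC] := bounded_preimage; exists C => // y.
  have [k [k1 k2 k3]] := hC y; have [[a1 a2] a3] := hQ y.
  apply: le_trans k3; rewrite -ler_sqr ?nnegrE ?rnorm_ge0//.
  rewrite -[X in _ <= rnorm X ^+ 2](subrKC (Q y)) rnormD_sqr a3.
  + by rewrite mulr0 addr0 lerDl sqr_ge0.
  + by rewrite linearB /= k1 a1 subrr.
  + by rewrite linearB /= k2 a2 subrr.
- by move=> y; have [] := hQ y.
Qed.

End RightInverse.

(** * Bochner integrals through norming functionals *)

Section AeIntegral.
Context (R : realType).
Local Notation mu := (@lebesgue_measure R).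
Local Notation T := (measurableTypeR R).
Implicit Types (J N : set R) (f : R -> R).

(** The integral of a nonnegative function, measurable or not, is a supremum
    over simple functions below it, and such a simple function may be cut off
    on the null set [N] without changing its integral.  The two
    domains differ so that the lemma can also extend integrals by zero. *)
Lemma ae_le_nnintegral J1 J2 N (f1 f2 : R -> R) :
  measurable (N : set T) -> mu N = 0%E ->
  (forall t, J1 t -> 0 <= f1 t) -> (forall t, J2 t -> 0 <= f2 t) ->
  (forall t, ~ N t -> J1 t -> f1 t = 0 \/ (J2 t /\ f1 t <= f2 t)) ->
  (\int[mu]_(t in J1) (f1 t)%:E <= \int[mu]_(t in J2) (f2 t)%:E)%E.
Proof.
move=> mN N0 p1 p2 h.
rewrite ge0_integralE; last by move=> t /p1; rewrite lee_fin.
rewrite ge0_integralE; last by move=> t /p2; rewrite lee_fin.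
apply: ge_ereal_sup => _ [s hs <-].
have mNC : measurable (~` N : set T) by exact: measurableC.
apply: ereal_sup_ubound; exists (proj_nnsfun s mNC).
  move=> t /=; rewrite mindicE.
  have [Nt|Nt] := pselect (N t).
    rewrite memNset ?mulr0; last by move=> /(_ Nt).
    by rewrite patchE; case: ifPn => // /set_mem /p2; rewrite lee_fin.
  rewrite mem_set// mulr1; have := hs t; rewrite !patchE.
  case: ifPn => [/set_mem J1t hle|_ hle].
    have [f10|[J2t le12]] := h _ Nt J1t.
      rewrite f10 in hle; apply: (le_trans hle).
      by case: ifPn => // /set_mem /p2; rewrite lee_fin.
    by rewrite mem_set//; apply: (le_trans hle); rewrite lee_fin.
  apply: (le_trans hle); case: ifPn => // /set_mem /p2; rewrite lee_fin//.
rewrite -!integralT_nnsfun; apply: ge0_ae_eq_integral => //=.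
- by apply/measurable_EFinP; exact: (@measurable_funPT _ _ _ _ (proj_nnsfun s mNC)).
- by apply/measurable_EFinP.
- by move=> t _; rewrite lee_fin mulr_ge0.
- by move=> t _; rewrite lee_fin.
exists N; split=> // t /= /not_implyP[_]; apply: contra_notP => Nt.
by rewrite mindicE mem_set// mulr1.
Qed.

Lemma integrable_scaled_indic J (E : set R) (c : R) :
  measurable (J : set T) -> measurable (E : set T) ->
  (c != 0 -> (mu (J `&` E) < +oo)%E) ->
  mu.-integrable J (fun t => (c%:E * (\1_E t)%:E)%E) /\
  (\int[mu]_(t in J) (c%:E * (\1_E t)%:E) = (c * fine (mu (J `&` E)))%:E)%E.
Proof.
move=> mJ mE h; have [->|c0] := eqVneq c 0.
  under eq_integral do rewrite mul0e.
  rewrite integral0 mul0r; split=> //.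
  by under eq_fun do rewrite mul0e; exact: integrable0.
have hfin := h c0.
have intE : (\int[mu]_(t in J) (\1_E t)%:E = mu (J `&` E))%E.
  by rewrite integral_indic// setIC.
have i1 : mu.-integrable J (fun t => (\1_E t)%:E).
  apply/integrableP; split; first exact/measurable_EFinP.
  under eq_integral do rewrite gee0_abs ?lee_fin//.
  by rewrite intE.
split; first exact: integrableZl.
by rewrite integralZl// intE EFinM fineK// ge0_fin_numE.
Qed.

End AeIntegral.

Section Bochner.
Context (R : realType) (kd : scalar_kind) (B : normedModType (scalars R kd)).
Local Notation mu := (@lebesgue_measure R).
Local Notation T := (measurableTypeR R).
Variables (J : set R) (l : B -> R).
Hypotheses (mJ : measurable (J : set T)) (hl : norming_fun l).

(** A simple function takes finitely many values, so a linear functional passes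
    through the defining sum.  The value [0] may be taken on a set of infinite
    measure, where [l 0 = 0] saves integrability. *)
Lemma norming_simple_integral (s : R -> B) : integrable_simple_fun J s ->
  mu.-integrable J (fun t => (l (s t))%:E) /\
  (\int[mu]_(t in J) (l (s t))%:E = (l (simple_integral J s))%:E)%E.
Proof.
move=> [[fs ms] sfin].
have dec t : (l (s t))%:E =
    (\sum_(b <- fset_set (range s)) ((l b)%:E * (\1_(s @^-1` [set b]) t)%:E))%E.
  rewrite (big_fsetD1 (s t)) /=; last by rewrite in_fset_set// mem_set//; exists t.
  rewrite indicE mem_set//= mule1 big1_fset ?adde0//= => b.
  rewrite !inE => /andP[bs _] _.
  by rewrite indicE memNset ?mule0// => h; rewrite h eqxx in bs.
have each b : mu.-integrable J (fun t => ((l b)%:E * (\1_(s @^-1` [set b]) t)%:E)%E) /\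
  (\int[mu]_(t in J) ((l b)%:E * (\1_(s @^-1` [set b]) t)%:E) =
    (l b * fine (mu (J `&` s @^-1` [set b])))%:E)%E.
  apply: integrable_scaled_indic => // lb0; apply: sfin.
  by apply: contraNneq lb0 => ->; rewrite (norming_fun0 hl).
split.
  under eq_fun do rewrite dec.
  by apply: integrable_sum => // b _; case: (each b).
under eq_integral do rewrite dec.
rewrite integral_sum//; last by move=> b; case: (each b).
rewrite /simple_integral fsbig_finite//=.
case: (hl) => lD lZ _.
have -> (I : Type) (r : seq I) (F : I -> B) : l (\sum_(i <- r) F i) = \sum_(i <- r) l (F i).
  elim: r => [|i r IHr]; first by rewrite !big_nil (norming_fun0 hl).
  by rewrite !big_cons lD IHr.
rewrite -sumEFin; apply: eq_bigr => b _.
by rewrite lZ mulrC; case: (each b).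
Qed.

(** This is the only way in which Bochner integrals are estimated below: the
    functional commutes with simple integrals, and the error of the simple
    approximation tends to zero in [L^1]. *)
Lemma bochner_integral_le (f : R -> B) (v : B) (m : R -> R) :
  is_bochner_integral J f v ->
  mu.-integrable J (fun t => (m t)%:E) ->
  {ae mu, forall t, J t -> l (f t) <= m t} ->
  ((l v)%:E <= \int[mu]_(t in J) (m t)%:E)%E.
Proof.
move=> [_ [s [si cv0 cvv]]] im [N [mN N0 hN]].
have key n : ((l (simple_integral J (s n)))%:E <=
    \int[mu]_(t in J) (m t)%:E + \int[mu]_(t in J) (rnorm (f t - s n t))%:E)%E.
  have [i1 <-] := norming_simple_integral (si n).
  have fm := integrable_fin_num mJ im.
  rewrite addeC -leeBlDr//.
  have i2 := integrableB mJ i1 im.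
  rewrite -integralB//.
  (* only the positive part of l (s n) - m matters, and almost everywhere it is at most
     the norm of f - s n *)
  apply: (@le_trans _ _ (\int[mu]_(t in J) (`|Num.max 0 (l (s n t) - m t)|)%:E)%E).
    have -> : (\int[mu]_(t in J) (`|Num.max 0 (l (s n t) - m t)|)%:E =
       \int[mu]_(t in J) ((fun t => (l (s n t))%:E) \- (fun t => (m t)%:E))^\+ t)%E.
      apply: eq_integral => t _; rewrite funeposE -EFinB -EFin_max.
      by rewrite ger0_norm ?le_max ?lexx// maxC.
    apply: le_integral => //; first exact: integrable_funepos.
    by move=> t _; rewrite funeposE le_max lexx.
  apply: (ae_le_nnintegral mN N0) => [t _|t _|t Nt Jt] //; first exact: rnorm_ge0.
  right; split=> //; have : l (f t) <= m t.
    by apply: contrapT => h; apply: Nt; apply: hN => /= /(_ Jt).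
  move=> h; rewrite ger0_norm ?le_max ?lexx// ge_max rnorm_ge0 /=.
  have := norming_fun_abs hl (s n t - f t); rewrite rnormB => /ler_normlW.
  by rewrite (norming_funB hl); lra.
have c1 : (l (simple_integral J (s n)))%:E @[n --> \oo] --> (l v)%:E.
  apply/cvg_EFin; first exact: nearW.
  apply/cvgrPdist_lt => e e0; move/cvg_rnormP : cvv => /(_ e e0).
  apply: filterS => n /=; rewrite -(norming_funB hl) => h.
  by apply: le_lt_trans h; rewrite rnormB; exact: norming_fun_abs.
have c2 : (\int[mu]_(t in J) (m t)%:E + \int[mu]_(t in J) (rnorm (f t - s n t))%:E)%E
   @[n --> \oo] --> (\int[mu]_(t in J) (m t)%:E + 0)%E.
  apply: cvgeD => //; first by rewrite fin_num_adde_defl// (integrable_fin_num mJ im).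
  exact: cvg_cst.
rewrite -[leRHS]adde0 -(cvg_lim _ c1)// -(cvg_lim _ c2)//.
apply: lee_lim; first by apply/cvg_ex; eexists; exact: c1.
  by apply/cvg_ex; eexists; exact: c2.
exact: nearW.
Qed.

End Bochner.

(** * Continuity on a set of full measure gives strong measurability *)

Section RelContinuous.
Context (R : realType) (kd : scalar_kind) (B : normedModType (scalars R kd)).
Local Notation mu := (@lebesgue_measure R).

(** Continuity of the restriction to [G]; the exceptional null set outside [G]
    may be dense. *)
Definition rel_continuous (G : set R) (f : R -> B) : Prop :=
  forall t, G t -> forall e : R, 0 < e ->
    exists2 d : R, 0 < d & forall s, G s -> `|s - t| < d -> rnorm (f s - f t) < e.

(** On each cell of length [1/(n+1)] that meets [G], the approximating simple
    function takes the value of [f] at one point of [G] in the cell; the range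
    is made finite by a cut-off at [|t| <= n+1].  Convergence holds at every
    point of [G]. *)
Lemma rel_continuous_strongly_measurable (J G : set R) (f : R -> B) :
  rel_continuous G f -> {ae mu, forall t, J t -> G t} -> strongly_measurable J f.
Proof.
move=> cf aeG.
pose cell (n : nat) (t : R) : int := Num.floor (t * n.+1%:R).
have step (p : nat * int) : exists w : B, (exists2 t, G t & cell p.1 t = p.2) ->
    exists t, [/\ G t, cell p.1 t = p.2 & w = f t].
  have [[t Gt ct]|h] := pselect (exists2 t, G t & cell p.1 t = p.2).
    by exists (f t) => _; exists t.
  by exists 0.
have [v hv] := choice step.
pose s n t := if (`|cell n t| <= (n.+1 ^ 2)%:Z) then v (n, cell n t) else 0 : B.
exists s; split=> [n|].
  split.
    pose W := [set v (n, k) | k in [set k : int | `|k| <= (n.+1 ^ 2)%:Z]] `|` [set 0].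
    apply: (@sub_finite_set _ _ W).
      move=> _ [t _ <-]; rewrite /s; case: ifPn => h; last by right.
      by left; exists (cell n t).
    rewrite finite_setU; split=> //; apply: finite_image.
    apply: (@sub_finite_set _ _ [set i%:Z - (n.+1 ^ 2)%:Z | i in `I_(n.+1 ^ 2).*2.+1]).
      move=> k /=; rewrite ler_norml => /andP[k1 k2].
      move: (n.+1 ^ 2)%N k k1 k2 => N k k1 k2.
      exists (absz (k + N%:Z)) => /=; last by rewrite gez0_abs; lia.
      by rewrite ltnS; lia.
    exact: finite_image.
  move=> b.
  rewrite (_ : _ @^-1` _ = \bigcup_(k in [set k : int |
      (if `|k| <= (n.+1 ^ 2)%:Z then v (n, k) else 0) = b])
      [set` `[k%:~R / n.+1%:R, (k + 1)%:~R / n.+1%:R[%R]); last first.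
    have nP : (0 : R) < n.+1%:R by rewrite ltr0n.
    apply/seteqP; split=> t /=.
      move=> st; exists (cell n t) => //=; rewrite in_itv/=.
      by rewrite ler_pdivrMr// ltr_pdivlMr// floor_itv.
    move=> [k /= kb]; rewrite in_itv/= ler_pdivrMr// ltr_pdivlMr// => h.
    by rewrite /s /cell (floor_def h).
  rewrite bigcup_mkcond; apply: countable_bigcupT_measurable => // k.
  by case: ifP.
case: aeG => N [mN N0 hN]; exists N; split=> // t; apply: contra_notP => Nt.
move=> Jt; have Gt : G t by apply: contrapT => h; apply: Nt; apply: hN => /(_ Jt).
apply/cvg_rnormP => e e0; have [d d0 hd] := cf t Gt e e0.
exists (maxn (Num.truncn `|t|).+1 (Num.truncn d^-1).+1) => // n /=.
rewrite geq_max => /andP[n1 n2].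
have nP : (0 : R) < n.+1%:R by rewrite ltr0n.
have tn : `|t| + 1 <= n.+1%:R.
  rewrite -natr1 lerD2r; apply: ltW; apply: (lt_le_trans (truncnS_gt _)).
  by rewrite ler_nat.
have dn : n.+1%:R^-1 < d.
  rewrite -[d]invrK ltf_pV2 ?posrE ?invr_gt0//.
  by apply: (lt_le_trans (truncnS_gt _)); rewrite ler_nat leqW.
have /andP[c1 c2] := floor_itv (t * n.+1%:R); rewrite -/(cell n t) in c1 c2.
have cellb : `|cell n t| <= (n.+1 ^ 2)%:Z.
  rewrite -(ler_int R) intr_norm -pmulrn natrX ler_norml.
  rewrite intrD in c2; have := ler_norm t; have := ler_norm (- t); rewrite normrN.
  by move=> a1 a2; apply/andP; split; nra.
rewrite /s cellb; have [|r [Gr rc ->]] := hv (n, cell n t); first by exists t.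
apply: hd => //; move: rc => /= rc.
have /andP[e1 e2] := floor_itv (r * n.+1%:R); rewrite -/(cell n r) rc in e1 e2.
rewrite !intrD in c2 e2.
have : `|(r - t) * n.+1%:R| < 1.
  by rewrite mulrBl ltr_norml; apply/andP; split; lra.
by rewrite normrM (gtr0_norm nP) -ltr_pdivlMr// div1r => /lt_trans; apply.
Qed.

End RelContinuous.

(** * A Gronwall inequality for Lipschitz functions *)

Section RealLemmas.
Context (R : realType).
Local Notation mu := (@lebesgue_measure R).
Local Notation T := (measurableTypeR R).

Lemma measure_shift (h : R) (A : set R) : measurable (A : set T) ->
  mu [set t | A (t + h)] = mu A.
Proof.
move=> mA.
have mf : measurable_fun (setT : set T) ((fun t => t + h) : T -> T).
  exact: measurable_funD.
have := @lebesgue_measure_unique R (pushforward mu ((fun t => t + h) : T -> T)).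
move=> /(_ mf _ A mA) ->//.
move=> _ [[a b] /= _ <-]; rewrite /pushforward /=.
have -> : (fun t : T => t + h) @^-1` [set` Interval (BRight a) (BRight b)] =
    [set` Interval (BRight (a - h)) (BRight (b - h))].
  by apply/seteqP; split=> t /=; rewrite !in_itv/= ltrBlDr lerBrDr.
rewrite !lebesgue_measure_itv/= !lte_fin ltrD2r.
by case: ifP => // _; rewrite -!EFinD; congr (_%:E); ring.
Qed.

Lemma ae_imply (P Q : R -> Prop) : (forall t, P t -> Q t) ->
  {ae mu, forall t, P t} -> {ae mu, forall t, Q t}.
Proof.
by move=> PQ [N [mN N0 hN]]; exists N; split=> // t nQ; apply: hN => /PQ.
Qed.

Lemma ae_and (P Q : R -> Prop) : {ae mu, forall t, P t} ->
  {ae mu, forall t, Q t} -> {ae mu, forall t, P t /\ Q t}.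
Proof.
move=> hP hQ; have := negligibleU hP hQ; apply: negligibleS => t /=.
by move=> /not_andP.
Qed.

Lemma le_mu (A B : set R) : measurable (A : set T) -> measurable (B : set T) ->
  A `<=` B -> (mu A <= mu B)%E.
Proof. by move=> mA mB AB; apply: le_measure => //; apply/mem_set. Qed.

Lemma ae_shift (h : R) (P : R -> Prop) :
  {ae mu, forall t, P t} -> {ae mu, forall t, P (t + h)}.
Proof.
move=> [N [mN N0 hN]]; exists [set t | N (t + h)]; split.
- rewrite -[X in measurable X]setTI.
  have mf : measurable_fun setT (fun t : T => t + h : T) by exact: measurable_funD.
  exact: mf.
- by rewrite measure_shift.
- by move=> t /= hP; apply: hN.
Qed.

Lemma ae_open_cover (P : R -> Prop) (e : R) : 0 < e ->
  {ae mu, forall t, P t} ->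
  exists G : set R, [/\ open G, (mu G < e%:E)%E & forall t, ~ G t -> P t].
Proof.
move=> e0 [N [mN N0 hN]].
have N0' : (mu N < +oo)%E by rewrite [mu N]N0.
have [G [oG NG Ge]] := lebesgue_regularity_outer mN N0' e0.
exists G; split=> // [|t Gt].
  have mG : measurable (G : set T) by exact: open_measurable.
  have h : (mu G <= mu N + mu (G `\` N))%E.
    by rewrite -{1}(setDUK NG); apply: measureU2 => //; exact: measurableD.
  by apply: (le_lt_trans h); rewrite N0 add0e.
by apply: contrapT => nP; apply: Gt; apply: NG; exact: hN.
Qed.

(** The null set where the Dini estimate fails is covered by an open [G] of
    measure less than [e].  Then
    [z s <= z a + e (s - a) + L mu(G /\ [a, s])]
    propagates from [a] to [b]: inside [G] the Lipschitz bound is paid for by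
    the last term, outside [G] the Dini estimate is paid for by the middle one.
    At [b] the total excess is at most a multiple of [e]. *)
Lemma dini_le (a b L : R) (z : R -> R) : a <= b ->
  0 <= L ->
  (forall s t, a <= s -> s <= t -> t <= b -> z t - z s <= L * (t - s)) ->
  {ae mu, forall t, a <= t < b -> forall e, 0 < e ->
     exists2 d, 0 < d & forall s, t < s -> s < t + d -> s <= b ->
       z s <= z t + e * (s - t)} ->
  z b <= z a.
Proof.
move=> ab L0 zL aez; apply/ler_addgt0Pr => e0 e00.
pose e := e0 / (b - a + L + 1).
have den : 0 < b - a + L + 1 by rewrite ltr_wpDl// addr_ge0// subr_ge0.
have e_gt0 : 0 < e by rewrite divr_gt0.
have [G [oG Ge hG]] := ae_open_cover e_gt0 aez.
have mG : measurable (G : set T) by exact: open_measurable.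
pose m s := fine (mu (G `&` `[a, s])).
have mfin (A : set R) : measurable (A : set T) -> mu (G `&` A) \is a fin_num.
  move=> mA; rewrite ge0_fin_numE//; apply: le_lt_trans (lt_trans Ge (ltry _)).
  by apply: le_mu; [exact: measurableI|exact: mG|exact: subIsetl].
have m_mono s t : s <= t -> m s <= m t.
  move=> st; apply: fine_le; rewrite ?mfin//.
  apply: le_mu; [exact: measurableI..|].
  by apply: setIS => r /=; rewrite !in_itv/= => /andP[-> h]; exact: le_trans h st.
(* the measure term grows at rate one inside G *)
have m_add c s : a <= c -> c <= s -> (forall r, c < r -> r <= s -> G r) -> m c + (s - c) <= m s.
  move=> ac cs hs.
  have Esc : (mu `]c, s] = (s - c)%:E)%E.
    rewrite lebesgue_measure_itv/= lte_fin; case: ltgtP cs => // -> _.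
    by rewrite subrr.
  rewrite -lee_fin EFinD fineK ?mfin// fineK ?mfin// -Esc -measureU//; last 2 first.
  - exact: measurableI.
  - apply/seteqP; split=> r //= -[[_]]; rewrite !in_itv/= => /andP[_ h1] /andP[h2 _].
    by move: (lt_le_trans h2 h1); rewrite ltxx.
  apply: le_mu.
  - by apply: measurableU => //; exact: measurableI.
  - exact: measurableI.
  - move=> r /= [[Gr]|]; rewrite !in_itv/= => /andP[r1 r2].
      by split=> //; rewrite r1 (le_trans r2).
    by split; [exact: hs|rewrite r2 andbT (le_trans ac (ltW r1))].
have m_a s : 0 <= m s by rewrite /m fine_ge0.
pose bound s := z a + e * (s - a) + L * m s.
pose S := [set t | a <= t <= b /\ forall s, a <= s <= t -> z s <= bound s].
have Sa : S a.
  split; first by rewrite lexx.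
  move=> s /andP[s1 s2]; have -> : s = a by apply/eqP; rewrite eq_le s2.
  by rewrite /bound subrr mulr0 addr0 lerDl mulr_ge0.
have hS : has_sup S by split; [exists a|exists b => t [/andP[]]].
set c := sup S.
have ac : a <= c by apply: ub_le_sup => //; case: hS.
have cb : c <= b by apply: ge_sup; [exists a|move=> t [/andP[]]].
have below s : a <= s -> s < c -> z s <= bound s.
  move=> as_ /(sup_gt hS.1)[t [_ ht] st]; apply: ht.
  by rewrite as_ ltW.
have zc : z c <= bound c.
  move: ac; rewrite le_eqVlt => /predU1P[<-|ac'].
    by case: Sa => _; apply; rewrite lexx.
  apply/ler_addgt0Pr => d d0.
  pose s := Num.max a (c - d / (L + 1)).
  have dL : 0 < d / (L + 1) by rewrite divr_gt0// ltr_wpDl.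
  have sc : s < c by rewrite /s gt_max ac' gtrBl.
  have sa : a <= s by rewrite /s le_max lexx.
  have := zL s c sa (ltW sc) cb; have := below s sa sc.
  have : m s <= m c by apply: m_mono; exact: ltW.
  rewrite /bound => h1 h2 h3.
  have h4 : L * (c - s) <= d.
    apply: (@le_trans _ _ (L * (d / (L + 1)))).
      by rewrite ler_wpM2l// lerBlDr -lerBlDl /s le_max lexx orbT.
    by rewrite mulrA ler_pdivrMr ?ltr_wpDl// mulrC ler_pM2l// lerDl.
  have : e * (s - a) <= e * (c - a) by rewrite ler_pM2l// lerD2r ltW.
  have : L * m s <= L * m c by rewrite ler_wpM2l.
  lra.
(* the estimate holds up to c = sup S and could be continued beyond any c < b *)
have cbE : c = b.
  move: cb; rewrite le_eqVlt => /predU1P[//|cb].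
  have [d d0 hd] : exists2 d, 0 < d & forall s, c < s -> s < c + d -> s <= b ->
      z s <= bound s.
    have [Gc|Gc] := pselect (G c).
      have /nbhs_ballP[d /= d0 hd] : nbhs c G by exact: open_nbhs_nbhs.
      exists d => // s cs scd sb.
      have : m c + (s - c) <= m s.
        apply: m_add (ltW cs) _ => // r cr rs; apply: hd; rewrite /ball/=.
        by rewrite ltr_norml; apply/andP; split; lra.
      move=> /(ler_wpM2l L0); have := zL c s ac (ltW cs) sb.
      have : 0 <= e * (s - c) by rewrite mulr_ge0 ?subr_ge0 ?ltW.
      by move: zc; rewrite /bound; lra.
    have := hG c Gc; rewrite ac cb => /(_ isT e e_gt0)[d d0 hd].
    exists d => // s cs scd sb; have := hd s cs scd sb.
    have := ler_wpM2l L0 (m_mono _ _ (ltW cs)).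
    by move: zc; rewrite /bound; lra.
  pose s := Num.min b (c + d / 2).
  have cs : c < s by rewrite /s lt_min cb ltrDl divr_gt0.
  have : S s.
    split; first by rewrite (le_trans ac (ltW cs)) /s ge_min lexx.
    move=> r /andP[ar rs]; have [rc|cr|->//] := ltgtP r c; first exact: below.
    apply: hd => //.
      by apply: (le_lt_trans rs); rewrite /s gt_min; apply/orP; right; lra.
    by apply: (le_trans rs); rewrite /s ge_min lexx.
  by move=> /(ub_le_sup hS.2); rewrite -/c leNgt cs.
have mb : m b <= e.
  rewrite -lee_fin fineK ?mfin//; apply: le_trans (ltW Ge).
  by apply: le_mu; [exact: measurableI|exact: mG|exact: subIsetl].
move: zc; rewrite cbE /bound => /le_trans; apply.
rewrite -addrA lerD2l.
have : L * m b <= L * e by rewrite ler_wpM2l.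
have -> : e0 = e * (b - a + L + 1) by rewrite /e divfK// gt_eqF.
by move: e_gt0; lra.
Qed.

(** Above the level [K / k] the right slope is nonpositive, so [max(z, M)] is
    nonincreasing in the sense of [dini_le]. *)
Lemma dini_gronwall (a b L k K : R) (z : R -> R) : a <= b -> 0 <= L -> 0 < k ->
  (forall s t, a <= s -> s <= t -> t <= b -> z t - z s <= L * (t - s)) ->
  {ae mu, forall t, a <= t < b -> forall e, 0 < e ->
     exists2 d, 0 < d & forall s, t < s -> s < t + d -> s <= b ->
       z s <= z t + (K - k * z t + e) * (s - t)} ->
  z b <= Num.max (z a) (K / k).
Proof.
move=> ab L0 k0 zL aez; set M := Num.max _ _.
have MK : K / k <= M by rewrite /M le_max lexx orbT.
have : Num.max (z b) M <= Num.max (z a) M.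
  apply: (@dini_le a b L (fun t => Num.max (z t) M)) => //.
    move=> s t as_ st tb; rewrite lerBlDr ge_max; apply/andP; split.
      by have := zL s t as_ st tb; rewrite lerBlDr => /le_trans; apply; rewrite lerD2l le_max lexx.
    by rewrite ler_wpDl ?mulr_ge0 ?subr_ge0// le_max lexx orbT.
  apply: ae_imply aez => t hz tab e e0.
  have [zM|Mz] := ltP (z t) M.
    have dP : 0 < (M - z t) / (L + 1) by rewrite divr_gt0 ?subr_gt0// ltr_wpDl.
    exists ((M - z t) / (L + 1)) => // s ts std sb.
    have tst : 0 <= e * (s - t) by rewrite mulr_ge0// ?subr_ge0 ltW.
    have zsM : z s <= M.
      move: tab => /andP[at_ _]; have := zL t s at_ (ltW ts) sb.
      have h1 : (s - t) * (L + 1) <= M - z t by rewrite -ler_pdivlMr ?ltr_wpDl//; lra.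
      by move=> h2; nra.
    by rewrite (max_idPr zsM) lerDl.
  have [d d0 hd] := hz tab e e0; exists d => // s ts std sb.
  have h := hd s ts std sb.
  have tst : 0 <= e * (s - t) by rewrite mulr_ge0// ?subr_ge0 ltW.
  rewrite ge_max; apply/andP; split; last by lra.
  apply: (le_trans h); rewrite lerD2l ler_wpM2r ?subr_ge0 ?(ltW ts)//.
  rewrite gerDr subr_le0 mulrC -ler_pdivrMr//.
  exact: le_trans MK Mz.
rewrite ge_max => /andP[+ _]; rewrite /M maxA maxxx; by [].
Qed.

End RealLemmas.

(** * Smooth test functions *)

Section Smooth.
Context (R : realType).
Implicit Types (f g : R -> R) (s t d e : R).

(** The same estimate with a norm on the left defines derivatives of
    vector-valued functions below. *)
Lemma is_deriveP f t d : is_derive t 1 f d <->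
  (forall e, 0 < e -> exists2 r, 0 < r & forall s, `|s - t| < r ->
     `|f s - f t - (s - t) * d| <= e * `|s - t|).
Proof.
split=> [[fd fE] e e0|h].
  have cv : (fun h : R => h^-1 *: (f (h *: 1 + t) - f t)) @ 0^' --> d.
    by move: fd; rewrite -fE /derivable /derive; exact.
  move/cvgrPdist_lt : cv => /(_ e e0); rewrite near_withinE => /nbhs_ballP[r /= r0 hr].
  exists r => // s str.
  have [->|st] := eqVneq s t; first by rewrite !subrr mul0r subr0 normr0 mulr0.
  have st0 : s - t != 0 by rewrite subr_eq0.
  have := hr (s - t); rewrite /ball/= sub0r normrN => /(_ str st0).
  rewrite /GRing.scale/= mulr1 subrK => /ltW hh.
  rewrite -ler_pdivrMr ?normr_gt0// -normf_div.
  rewrite distrC in hh; apply: le_trans hh; rewrite le_eqVlt; apply/orP; left; apply/eqP.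
  by congr (`|_|); field.
have cv : (fun h : R => h^-1 *: (f (h *: 1 + t) - f t)) @ 0^' --> d.
  apply/cvgrPdist_le => e e0; have [r r0 hr] := h e e0.
  rewrite near_withinE; apply/nbhs_ballP; exists r => //= u.
  rewrite /ball/= sub0r normrN => ur u0.
  have := hr (u + t); rewrite addrK => /(_ ur).
  rewrite /GRing.scale/= mulr1 => hh; rewrite distrC.
  rewrite -ler_pdivrMr ?normr_gt0// -normf_div in hh.
  apply: le_trans hh; rewrite le_eqVlt; apply/orP; left; apply/eqP.
  by congr (`|_|); field.
apply: DeriveDef; first by apply/cvg_ex; exists d.
exact: cvg_lim cv.
Qed.

Lemma is_derive_local f g t d r : 0 < r ->
  (forall s, `|s - t| < r -> f s = g s) -> is_derive t 1 f d -> is_derive t 1 g d.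
Proof.
move=> r0 fg /is_deriveP h; apply/is_deriveP => e /h[r' r'0 hr].
exists (Num.min r r'); first by rewrite lt_min r0.
move=> s; rewrite lt_min => /andP[sr sr'].
by rewrite -!fg ?subrr ?normr0//; exact: hr.
Qed.

Lemma is_derive_affine f (a b t d : R) : is_derive (a * t + b) 1 f d ->
  is_derive t 1 (fun s => f (a * s + b)) (a * d).
Proof.
move=> /is_deriveP h; apply/is_deriveP => e e0.
have a0 : 0 < `|a| + 1 by rewrite ltr_wpDl.
have ea : 0 < e / (`|a| + 1) by rewrite divr_gt0.
have [r r0 hr] := h _ ea.
exists (r / (`|a| + 1)); first by rewrite divr_gt0.
move=> s; rewrite ltr_pdivlMr// => sr.
have E : a * s + b - (a * t + b) = a * (s - t) by ring.
have := hr (a * s + b); rewrite E normrM => hh.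
have -> : f (a * s + b) - f (a * t + b) - (s - t) * (a * d) =
  f (a * s + b) - f (a * t + b) - a * (s - t) * d by ring.
apply: (le_trans (hh _)).
  apply: le_lt_trans sr; rewrite mulrC ler_wpM2l// lerDl ler01//.
rewrite mulrA ler_wpM2r// mulrAC ler_pdivrMr// ler_wpM2l ?(ltW e0)// lerDl//.
Qed.

Lemma is_derive_cont f t d : is_derive t 1 f d -> {for t, continuous f}.
Proof. by move=> [h _]; apply: differentiable_continuous; exact/derivable1_diffP. Qed.

Lemma is_derive_homo f df a b : a <= b ->
  (forall t, a <= t <= b -> is_derive t 1 f (df t)) ->
  (forall t, a <= t <= b -> 0 <= df t) -> f a <= f b.
Proof.
move=> ab fd df0.
have [||c] := @MVT_segment R f df a b ab.
- by move=> t; rewrite in_itv/= => /andP[/ltW h1 /ltW h2]; apply: fd; rewrite h1.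
- apply: continuous_in_subspaceT => t /set_mem/=; rewrite in_itv/= => h.
  exact: is_derive_cont (fd _ h).
rewrite in_itv/= => h E; rewrite -subr_ge0 E mulr_ge0 ?df0// subr_ge0//.
Qed.

(** The functions [t^-k exp(-1/t)], extended by [0]; the family is closed under
    differentiation up to linear combinations. *)
Definition expinv (k : nat) t : R :=
  if 0 < t then t^-1 ^+ k * expR (- t^-1) else 0.

Lemma expinv_le0 k t : t <= 0 -> expinv k t = 0.
Proof. by rewrite /expinv leNgt => /negbTE->. Qed.

(** Quadratic decay at [0] gives differentiability there, with derivative [0]. *)
Lemma expinv_sqr_bound k : exists2 C : R, 0 < C & forall t, `|expinv k t| <= C * t ^+ 2.
Proof.
exists (k.+2)`!%:R => [|t]; first by rewrite ltr0n fact_gt0.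
have F0 : (0 : R) < (k.+2)`!%:R by rewrite ltr0n fact_gt0.
rewrite /expinv; case: ifPn => [t0|_]; last by rewrite normr0 mulr_ge0 ?sqr_ge0// ltW.
have u0 : 0 < t^-1 by rewrite invr_gt0.
rewrite ger0_norm; last by rewrite mulr_ge0 ?exprn_ge0 ?expR_ge0// ltW.
rewrite expRN ler_pdivrMr ?expR_gt0//.
have := expR_ge1Dxn k.+1 (ltW u0).
set E := expR t^-1; move=> hE.
have : t^-1 ^+ k.+2 / (k.+2)`!%:R <= E by move: hE; lra.
rewrite ler_pdivrMr// => h2.
rewrite -(ler_pM2l (exprn_gt0 2 u0)) -exprD add2n (le_trans h2)//.
have -> : t^-1 ^+ 2 * ((k.+2)`!%:R * t ^+ 2 * E) = E * (k.+2)`!%:R * (t^-1 * t) ^+ 2.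
  by rewrite exprMn; ring.
by rewrite mulVf ?gt_eqF// expr1n mulr1.
Qed.

Lemma is_derive_expinv k t :
  is_derive t 1 (expinv k) (- k%:R * expinv k.+1 t + expinv k.+2 t).
Proof.
have [t0|t0|->] := ltgtP t 0.
- rewrite [expinv k.+1 t]expinv_le0 ?ltW// [expinv k.+2 t]expinv_le0 ?ltW//.
  rewrite mulr0 addr0.
  apply: (is_derive_local (r := - t) _ _ (is_derive_cst 0 t 1)).
    by rewrite oppr_gt0.
  by move=> s; rewrite ltr_norml => /andP[_ h]; rewrite expinv_le0//; move: h; lra.
- have tn : t != 0 by rewrite gt_eqF.
  have dinv : is_derive t 1 (fun s : R => s^-1) (- t ^- 2).
    apply: DeriveDef; first exact: derivableV.
    by rewrite deriveV// derive_id /GRing.scale/= mulr1.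
  have dexp : is_derive t 1 (fun s => expR (- s^-1)) (t ^- 2 * expR (- t^-1)).
    have dm := is_deriveN dinv; rewrite opprK in dm.
    have := @is_derive1_comp R expR (\- (fun s : R => s^-1)) t _ _ (is_derive_expR _) dm.
    by rewrite mulrC; exact.
  have dpow := @is_deriveX _ _ (fun s : R => s^-1) k t 1 _ dinv.
  have D := is_deriveM dpow dexp.
  rewrite mulrfctE !exprfctE in D.
  have -> : - k%:R * expinv k.+1 t + expinv k.+2 t =
     (t^-1 ^+ k) *: (t ^- 2 * expR (- t^-1)) +
     expR (- t^-1) *: (k%:R * t^-1 ^+ k.-1 *: - t ^- 2).
    rewrite /expinv t0 /GRing.scale/=.
    case: k {dpow D} => [|k].
      by rewrite oppr0 !mul0r mulr0 addr0 add0r mul1r exprVn.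
    by rewrite !exprS /=; field.
  apply: (is_derive_local (r := t) _ _ D) => // s.
  by rewrite ltr_norml => /andP[h _]; rewrite /expinv ifT//; move: h; lra.
- rewrite !expinv_le0 // mulr0 addr0.
  apply/is_deriveP => e e0; have [C C0 hC] := expinv_sqr_bound k.
  exists (e / C); first by rewrite divr_gt0.
  move=> s; rewrite subr0 ltr_pdivlMr// mulr0 subr0 => h.
  rewrite [expinv k 0]expinv_le0// subr0; apply: (le_trans (hC s)).
  by rewrite -real_normK ?num_real// expr2 mulrA ler_wpM2r// mulrC ltW.
Qed.

(** A class of functions that is stable under differentiation by construction,
    so that infinite differentiability follows by induction on the order.
    Primitives are included because smooth steps are primitives of bumps. *)
Inductive smoothc : (R -> R) -> Prop :=
| smoothc_expinv k : smoothc (expinv k)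
| smoothc_add f g : smoothc f -> smoothc g -> smoothc (fun t => f t + g t)
| smoothc_mul f g : smoothc f -> smoothc g -> smoothc (fun t => f t * g t)
| smoothc_scale c f : smoothc f -> smoothc (fun t => c * f t)
| smoothc_affine a b f : smoothc f -> smoothc (fun t => f (a * t + b))
| smoothc_prim f F : smoothc f -> (forall t, is_derive t 1 F (f t)) -> smoothc F.

Lemma smoothc_derive f : smoothc f ->
  exists2 g, smoothc g & forall t, is_derive t 1 f (g t).
Proof.
elim=> {f} [k|f g sf [f' sf' df] sg [g' sg' dg]|f g sf [f' sf' df] sg [g' sg' dg]
           |c f _ [f' sf' df]|a b f _ [f' sf' df]|f F sf _ dF].
- exists (fun t => - k%:R * expinv k.+1 t + expinv k.+2 t).
    by apply: smoothc_add; [apply: smoothc_scale|]; exact: smoothc_expinv.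
  exact: is_derive_expinv.
- by exists (fun t => f' t + g' t) => [|t]; [exact: smoothc_add|exact: is_deriveD].
- exists (fun t => f t * g' t + g t * f' t) => [|t].
    by apply: smoothc_add; exact: smoothc_mul.
  exact: is_deriveM.
- by exists (fun t => c * f' t) => [|t]; [exact: smoothc_scale|exact: is_deriveZ].
- exists (fun t => a * f' (a * t + b)) => [|t]; last exact: is_derive_affine.
  by apply: smoothc_scale; exact: smoothc_affine.
- by exists f.
Qed.

Lemma smoothc_derivable f : smoothc f -> forall n t, derivable (derive1n n f) t 1.
Proof.
move=> sf n; elim: n f sf => [|n IHn] f sf t.
  by have [g _ /(_ t)[]] := smoothc_derive sf.
have [g sg dg] := smoothc_derive sf.
rewrite derive1Sn; have -> : derive1 f = g.
  by apply/funext => s; rewrite derive1E; case: (dg s).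
exact: IHn.
Qed.

Lemma smoothc_continuous f : smoothc f -> continuous f.
Proof. by move=> /smoothc_derive[g _ dg] t; exact: is_derive_cont (dg t). Qed.

Lemma primitive_exists f : continuous f -> (forall t, t <= 0 -> f t = 0) ->
  exists F, [/\ forall t, is_derive t 1 F (f t) & forall t, t <= 0 -> F t = 0].
Proof.
move=> cf f0.
pose F t := (\int[@lebesgue_measure R]_(x in `[(-1)%R, t]) f x)%R.
have F0 t : t <= 0 -> F t = 0.
  move=> t0; rewrite /F /Rintegral (eq_integral (cst 0%E)) ?integral0//.
  move=> x /set_mem /=; rewrite in_itv/= => /andP[_ xt].
  by rewrite f0// (le_trans xt).
exists F; split=> // t; have [t0|t0] := ltP t 0.
  rewrite f0; last exact: ltW.
  apply: (is_derive_local (r := - t) _ _ (is_derive_cst 0 t 1)).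
    by rewrite oppr_gt0.
  by move=> s; rewrite ltr_norml => /andP[_ h]; rewrite F0//; move: h; lra.
have t1 : t < t + 1 by rewrite ltrDl.
have [|||d1 d2] := @continuous_FTC1_closed R f (-1) t (t + 1) t1.
- apply: continuous_compact_integrable; first exact: segment_compact.
  exact: continuous_subspaceT.
- by rewrite (lt_le_trans _ t0)// oppr_lt0.
- exact: cf.
apply: DeriveDef; first exact: d1.
by rewrite -derive1E; exact: d2.
Qed.

(** [k] is the normalised bump [exp(-1/t) exp(-1/(1-t))] on [[0, 1]], [K] its
    primitive, which climbs from [0] to [1], and [P] the primitive of [K].
    Past [1] the primitive is affine with slope one; its offset [m] cancels in
    differences of translates. *)
Lemma unit_smooth_step : exists k K P : R -> R, exists m : R,
  [/\ smoothc k, smoothc K, smoothc P & forall t, is_derive t 1 K (k t)] /\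
  [/\ forall t, is_derive t 1 P (K t),
      forall t, 0 <= k t,
      forall t, t <= 0 -> [/\ k t = 0, K t = 0 & P t = 0]
    & forall t, 1 <= t -> [/\ k t = 0, K t = 1 & P t = t - m]].
Proof.
pose h t := expinv 0 t * expinv 0 (-1 * t + 1).
have sh : smoothc h.
  by apply: smoothc_mul; [|apply: (@smoothc_affine (-1) 1)]; exact: smoothc_expinv.
have e0 := @expinv_le0 0.
have ep t : 0 <= expinv 0 t.
  by rewrite /expinv; case: ifP => // _; rewrite expr0 mul1r expR_ge0.
have h0 t : t <= 0 -> h t = 0 by move=> t0; rewrite /h e0// mul0r.
have h1 t : 1 <= t -> h t = 0 by move=> t0; rewrite /h [X in _ * X]e0 ?mulr0//; lra.
have hp t : 0 <= h t by rewrite mulr_ge0.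
have [H [dH H0]] := primitive_exists (smoothc_continuous sh) h0.
have constH (F : R -> R) (c : R) : (forall t, 1 <= t -> is_derive t 1 F c) ->
    forall t, 1 <= t -> F t = F 1 + c * (t - 1).
  move=> dF t t1; have [||x] := @MVT_segment R F (fun=> c) 1 t t1.
  - by move=> x; rewrite in_itv/= => /andP[/ltW x1 _]; exact: dF.
  - apply: continuous_in_subspaceT => x /set_mem/=; rewrite in_itv/= => /andP[x1 _].
    exact: is_derive_cont (dF _ x1).
  by move=> _ E; rewrite -E addrC subrK.
have H1 t : 1 <= t -> H t = H 1.
  have dH0 s : 1 <= s -> is_derive s 1 H 0 by move=> s1; rewrite -(h1 s s1).
  by move=> t1; rewrite (constH H 0 dH0)// mul0r addr0.
have Hpos : 0 < H 1.
  have cH : {within `[0, 1], continuous H}.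
    by apply: continuous_subspaceT => x; exact: is_derive_cont (dH x).
  have [x] := MVT ltr01 (fun x _ => dH x) cH; rewrite in_itv/= => /andP[x0 x1]; rewrite (H0 0)// !subr0 mulr1 => ->.
  rewrite mulr_gt0// /expinv ifT ?expr0 ?mul1r ?expR_gt0//; lra.
pose K t := (H 1)^-1 * H t.
pose k t := (H 1)^-1 * h t.
have sk : smoothc k by exact: smoothc_scale.
have dK t : is_derive t 1 K (k t) by exact: is_deriveZ.
have sK : smoothc K by exact: smoothc_prim sk dK.
have K0 t : t <= 0 -> K t = 0 by move=> t0; rewrite /K (H0 _ t0) mulr0.
have K1 t : 1 <= t -> K t = 1 by move=> t1; rewrite /K (H1 _ t1) mulVf// gt_eqF.
have [P [dP P0]] := primitive_exists (smoothc_continuous sK) K0.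
exists k, K, P, (1 - P 1); split; split=> //.
- exact: smoothc_prim sK dP.
- by move=> t; rewrite mulr_ge0// invr_ge0 ltW.
- by move=> t t0; rewrite /k h0// mulr0 K0// P0.
- move=> t t1; rewrite /k h1// mulr0 K1//; split=> //.
  have dP1 s : 1 <= s -> is_derive s 1 P 1 by move=> s1; have := dP s; rewrite (K1 s s1).
  by rewrite (constH P 1 dP1)//; ring.
Qed.

End Smooth.

(** * Smooth steps as test functions *)

Section HasIntegral.
Context (R : realType).
Local Notation mu := (@lebesgue_measure R).
Local Notation T := (measurableTypeR R).
Variable J : set R.
Hypothesis mJ : measurable (J : set T).

Definition has_integral (m : R -> R) (v : R) : Prop :=
  mu.-integrable J (fun t => (m t)%:E) /\
  (\int[mu]_(t in J) (m t)%:E = v%:E)%E.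

Lemma has_integralD m1 m2 v1 v2 : has_integral m1 v1 -> has_integral m2 v2 ->
  has_integral (fun t => m1 t + m2 t) (v1 + v2).
Proof.
move=> [i1 e1] [i2 e2]; split.
  by under eq_fun do rewrite EFinD; exact: integrableD.
under eq_integral do rewrite EFinD.
by rewrite integralD// e1 e2.
Qed.

Lemma has_integralZ c m v : has_integral m v ->
  has_integral (fun t => m t * c) (v * c).
Proof.
move=> [i e]; split.
  by under eq_fun do rewrite mulrC EFinM; exact: integrableZl.
under eq_integral do rewrite mulrC EFinM.
by rewrite integralZl// e mulrC.
Qed.

Lemma has_integral_itv c a b : a <= b -> `[a, b] `<=` J ->
  has_integral (fun t => \1_`[a, b] t * c) ((b - a) * c).
Proof.
move=> ab abJ.
have E : mu (J `&` `[a, b]) = (b - a)%:E.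
  rewrite setIC setIidl// lebesgue_measure_itv/= lte_fin.
  by case: ltgtP ab => // -> _; rewrite subrr.
have [||i e] := @integrable_scaled_indic R J `[a, b] c mJ.
- exact: measurable_itv.
- by rewrite E ltry.
split.
  by under eq_fun do rewrite mulrC EFinM.
under eq_integral do rewrite mulrC EFinM.
by rewrite e E mulrC.
Qed.

End HasIntegral.

Section SmoothSteps.
Context (R : realType).
Local Notation mu := (@lebesgue_measure R).
Local Notation T := (measurableTypeR R).

(** A smooth approximation [K] of the unit jump, climbing from [0] to [1] on
    [[a, b]], with density [k]: testing against [k] averages over [[a, b]]. *)
Record smooth_step (a b : R) (k K : R -> R) : Prop := SmoothStep {
  step_lt : a < b;
  step_smooth : smoothc K;
  step_derive : forall t : R, is_derive t 1 K (k t);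
  step_ge0 : forall t : R, 0 <= k t;
  step_left : forall t : R, t <= a -> k t = 0 /\ K t = 0;
  step_right : forall t : R, b <= t -> k t = 0 /\ K t = 1 }.

Lemma step_homo a b k K : smooth_step a b k K -> forall s t, s <= t -> K s <= K t.
Proof.
move=> hb s t st; apply: (is_derive_homo st (df := k)).
  by move=> r _; exact: step_derive hb r.
by move=> r _; exact: step_ge0 hb r.
Qed.

Lemma step_01 a b k K t : smooth_step a b k K -> 0 <= K t <= 1.
Proof.
move=> hb; have [ta|/ltW at_] := leP t a.
  by have [_ ->] := step_left hb ta; rewrite lexx ler01.
have [bt|/ltW tb] := leP b t.
  by have [_ ->] := step_right hb bt; rewrite lexx ler01.
have := step_homo hb at_; have := step_homo hb tb.
have [_ ->] := step_left hb (lexx a); have [_ ->] := step_right hb (lexx b).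
by move=> -> ->.
Qed.

Lemma step_density_smooth a b k K : smooth_step a b k K -> smoothc k.
Proof.
move=> hb; have [g sg dg] := smoothc_derive (step_smooth hb).
suff -> : k = g by [].
apply/funext => t; have [_ <-] := step_derive hb t; by have [_ ->] := dg t.
Qed.

Lemma step_density_integral a b k K (J : set R) : smooth_step a b k K ->
  measurable (J : set T) -> `[a, b] `<=` J -> has_integral J k 1.
Proof.
move=> hb mJ abJ.
have ck := smoothc_continuous (step_density_smooth hb).
have mab : measurable (`[a, b] : set T) by exact: measurable_itv.
have ii : mu.-integrable `[a, b] (EFin \o k).
  apply: continuous_compact_integrable; first exact: segment_compact.
  exact: continuous_subspaceT.
have kE : (fun t => (k t)%:E) = patch (fun=> 0%E) `[a, b] (EFin \o k).
  apply/funext => t; rewrite patchE; case: ifPn => // /negP h.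
  have [ta|ta] := leP t a; first by have [-> _] := step_left hb ta.
  have [bt|bt] := leP b t; first by have [-> _] := step_right hb bt.
  by exfalso; apply: h; apply/mem_set; rewrite /= in_itv/= !ltW.
split.
  rewrite kE; apply: (@integrableS _ _ _ mu setT) => //.
  by apply/(integrable_mkcond _ mab).
rewrite kE -integral_mkcondr (setIidr abJ).
have -> : (\int[mu]_(x in `[a, b]) (EFin \o k) x = (K b)%:E - (K a)%:E)%E.
  apply: (@continuous_FTC2 _ k K a b (step_lt hb)).
  - exact: continuous_subspaceT.
  - have cK t : {for t, continuous K} by exact: is_derive_cont (step_derive hb t).
    split=> [t _||]; first by case: (step_derive hb t).
      by apply: cvg_at_right_filter; exact: cK.
    by apply: cvg_at_left_filter; exact: cK.
  - by move=> t _; rewrite derive1E; case: (step_derive hb t).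
have [_ ->] := step_left hb (lexx a); have [_ ->] := step_right hb (lexx b).
by rewrite sube0.
Qed.

(** A difference of two steps rises on one interval and falls on the other, and
    has compact support. *)
Lemma step_test_fun (J : set R) a b a1 b1 k1 K1 a2 b2 k2 K2 :
  smooth_step a1 b1 k1 K1 -> smooth_step a2 b2 k2 K2 ->
  a <= a1 -> a <= a2 -> b1 <= b -> b2 <= b -> `[a, b] `<=` J° ->
  [/\ test_fun J (fun t => K1 t - K2 t),
      derive1 (fun t => K1 t - K2 t) = (fun t => k1 t - k2 t)
    & forall t, ~ (a <= t <= b) -> K1 t - K2 t = 0].
Proof.
move=> h1 h2 aa1 aa2 bb1 bb2 abJ.
have out t : ~ (a <= t <= b) -> K1 t - K2 t = 0.
  move=> h; have [ta|ta] := leP a t.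
    have tb : b <= t by case: (leP t b) => [tb|/ltW//]; exfalso; apply: h; rewrite ta.
    have [_ ->] := step_right h1 (le_trans bb1 tb).
    by have [_ ->] := step_right h2 (le_trans bb2 tb); rewrite subrr.
  have [_ ->] := step_left h1 (ltW (lt_le_trans ta aa1)).
  by have [_ ->] := step_left h2 (ltW (lt_le_trans ta aa2)); rewrite subrr.
have sm : smoothc (fun t => K1 t - K2 t).
  have -> : (fun t => K1 t - K2 t) = (fun t => K1 t + -1 * K2 t).
    by apply/funext => t; rewrite mulN1r.
  by apply: smoothc_add; [exact: step_smooth h1|apply: smoothc_scale; exact: step_smooth h2].
split=> //.
  split; first by move=> n t; exact: smoothc_derivable.
  by exists a, b; split=> // t h; apply: out => h'; apply: h; rewrite /= in_itv.
apply/funext => t; rewrite derive1E.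
by have [_] := is_deriveB (step_derive h1 t) (step_derive h2 t).
Qed.

(** The second claim serves second-order weak derivatives: the density of [X] is
    itself a difference of steps, so that the second derivative of [X] is
    [(k_s - k_{s+h}) / h], which tests a difference quotient with increment
    [h]. *)
Lemma smooth_step_family : exists k K : R -> R -> R -> R,
  (forall e s : R, 0 < e -> smooth_step s (s + e) (k e s) (K e s)) /\
  (forall e s h : R, 0 < e -> 0 < h ->
     exists X, smooth_step s (s + h + e) (fun r => h^-1 * (K e s r - K e (s + h) r)) X).
Proof.
have [k [K [P [m [[sk sK sP dK] [dP kp left right]]]]]] := unit_smooth_step R.
pose k' e s r := e^-1 * k (e^-1 * r + - (s / e)).
pose K' e s r := K (e^-1 * r + - (s / e)).
pose P' e s r := e * P (e^-1 * r + - (s / e)).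
have E (e s r : R) : e^-1 * r + - (s / e) = (r - s) / e by ring.
have bK e s : 0 < e -> smooth_step s (s + e) (k' e s) (K' e s).
  move=> e0; split.
  - by rewrite ltrDl.
  - exact: smoothc_affine.
  - by move=> t; apply: is_derive_affine.
  - by move=> t; rewrite mulr_ge0// invr_ge0 ltW.
  - move=> t ts; rewrite /k' /K' E.
    have [|-> -> _] := left ((t - s) / e); last by rewrite mulr0.
    by rewrite pmulr_lle0 ?invr_gt0// subr_le0.
  - move=> t ts; rewrite /k' /K' E.
    have [|-> -> _] := right ((t - s) / e); last by rewrite mulr0.
    by rewrite ler_pdivlMr// mul1r lerBrDl.
exists k', K'; split=> // e s h e0 h0.
have dP' (s' t : R) : is_derive t 1 (P' e s') (K' e s' t).
  have -> : K' e s' t = e *: (e^-1 * K' e s' t).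
    by rewrite /GRing.scale/= mulVKf// gt_eqF.
  have D := is_derive_affine (dP (e^-1 * t + - (s' / e))).
  exact: is_deriveZ.
have P'l (s' t : R) : t <= s' -> P' e s' t = 0.
  move=> ts; rewrite /P' E; have [|_ _ ->] := left ((t - s') / e); last by rewrite mulr0.
  by rewrite pmulr_lle0 ?invr_gt0// subr_le0.
have P'r (s' t : R) : s' + e <= t -> P' e s' t = (t - s') - e * m.
  move=> ts; rewrite /P' E; have [|_ _ ->] := right ((t - s') / e).
    by rewrite ler_pdivlMr// mul1r lerBrDl.
  by rewrite mulrBr mulrC divfK// gt_eqF.
exists (fun r => h^-1 * (P' e s r + -1 * P' e (s + h) r)); split.
- by rewrite -addrA ltrDl addr_gt0.
- apply: smoothc_scale; apply: smoothc_add; last apply: smoothc_scale.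
    by apply: smoothc_scale; exact: smoothc_affine.
  by apply: smoothc_scale; exact: smoothc_affine.
- move=> t; have D1 := dP' s t; have D2 := dP' (s + h) t.
  have D3 : is_derive t 1 (fun r => -1 * P' e (s + h) r) (-1 * K' e (s + h) t).
    exact: is_deriveZ.
  have D4 := is_deriveD D1 D3; rewrite mulN1r in D4.
  exact: is_deriveZ.
- move=> t; rewrite mulr_ge0 ?invr_ge0 ?(ltW h0)// subr_ge0.
  have := step_homo (bK e 0 e0); rewrite /K' => mono.
  have := mono (t - (s + h)) (t - s); rewrite !E !subr0; apply.
  by rewrite lerD2l lerN2 lerDl ltW.
- move=> t ts; have tsh : t <= s + h by rewrite ler_wpDr// ltW.
  have [_ ->] := step_left (bK e s e0) ts; have [_ ->] := step_left (bK e (s + h) e0) tsh.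
  by rewrite !P'l// subrr !mulr0 addr0 mulr0.
- move=> t ts; have ts' : s + e <= t by rewrite (le_trans _ ts)// -addrA lerD2l lerDr ltW.
  have [_ ->] := step_right (bK e s e0) ts'; have [_ ->] := step_right (bK e (s + h) e0) ts.
  rewrite !P'r// subrr mulr0; split=> //.
  by field; rewrite gt_eqF.
Qed.

End SmoothSteps.

(** * Pointwise consequences of weak derivatives *)

Section WeakDerivative.
Context (R : realType) (kd : scalar_kind) (B : normedModType (scalars R kd)).
Local Notation mu := (@lebesgue_measure R).
Local Notation T := (measurableTypeR R).
Implicit Types (f g : R -> B) (s t : R).

Definition continuous_at_time f t : Prop := forall e : R, 0 < e ->
  exists2 d : R, 0 < d & forall s, `|s - t| < d -> rnorm (f s - f t) < e.

Lemma within_continuous_at_time (J : set R) f t : {within J, continuous f} ->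
  J° t -> continuous_at_time f t.
Proof.
move=> cf Jt e e0.
have : {for t, continuous f}.
  have cfi : {within J°, continuous f}.
    by apply: continuous_subspaceW cf; exact: interior_subset.
  by rewrite continuous_open_subspace in cfi; [apply: cfi; exact/mem_set|exact: open_interior].
move=> /cvg_rnormP/(_ e e0)/nbhs_ballP[d /= d0 hd]; exists d => // s sd.
by apply: hd; rewrite /ball/= distrC.
Qed.

Lemma bochner_has_integral_le (J : set R) (l : B -> R) f v m w :
  measurable (J : set T) -> norming_fun l -> is_bochner_integral J f v ->
  has_integral J m w -> {ae mu, forall t, J t -> l (f t) <= m t} -> l v <= w.
Proof.
move=> mJ hl bf [im em] h; rewrite -lee_fin -em.
exact: (bochner_integral_le mJ hl bf im h).
Qed.

Lemma norming_near (l : B -> R) f t e : norming_fun l -> 0 < e ->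
  continuous_at_time f t -> exists2 d : R, 0 < d & forall s, `|s - t| < d ->
    l (f t) - e <= l (f s) <= l (f t) + e.
Proof.
move=> hl e0 /(_ e e0)[d d0 hd]; exists d => // s /hd /ltW h.
have := norming_fun_abs hl (f s - f t); rewrite (norming_funB hl).
by move=> /le_trans/(_ h); rewrite ler_norml => /andP[]; lra.
Qed.

(** Testing with the difference of a step at [s] and a step at [t] compares
    averages of [f] near [s] and [t] with the integral of [g] over [[s, t]], up
    to an error [e] in the length of the interval.  Only an upper bound on
    [l g] is used, so that the bound [M] may have either sign. *)
Lemma weak_derivative1_le (J : set R) f g (l : B -> R) a b M s t :
  measurable (J : set T) -> norming_fun l -> weak_derivative 1 J f g ->
  `[a, b] `<=` J° -> {ae mu, forall r, a <= r <= b -> l (g r) <= M} ->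
  continuous_at_time f s -> continuous_at_time f t ->
  a <= s -> s < t -> t < b -> l (f t) - l (f s) <= M * (t - s).
Proof.
move=> mJ hl wf abJ hM cs ct as_ st tb.
have [lD lZ ll] := hl.
apply/ler_addgt0Pr => w w0.
pose w1 := w / (`|M| + 2).
have M2 : 0 < `|M| + 2 by rewrite ltr_wpDl.
have w10 : 0 < w1 by rewrite divr_gt0.
have [d1 d10 hd1] := norming_near hl w10 cs.
have [d2 d20 hd2] := norming_near hl w10 ct.
have [e [[e0 e1 e2] [e3 e4 e5]]] : exists e, [/\ 0 < e, e < d1 & e < d2] /\
    [/\ s + e <= t, t + e <= b & e <= w1].
  exists (Num.min (Num.min (d1 / 2) (d2 / 2)) (Num.min (Num.min (t - s) (b - t)) w1)).
  rewrite !lt_min !gt_min !subr_gt0 st tb w10 !divr_gt0//.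
  split; split=> //.
  - by apply/orP; left; apply/orP; left; lra.
  - by apply/orP; left; apply/orP; right; lra.
  - by rewrite -lerBrDl !ge_min lexx !orbT.
  - by rewrite -lerBrDl !ge_min lexx !orbT.
  - by rewrite !ge_min lexx !orbT.
have [k [K [bk _]]] := smooth_step_family R.
have b1 := bk e s e0; have b2 := bk e t e0.
have JJ : J° `<=` J := @interior_subset _ J.
have at_ : a <= t by rewrite (le_trans as_)// ltW.
have seb : s + e <= b by rewrite (le_trans e3)// ltW.
have [test d out] := step_test_fun b1 b2 as_ at_ seb e4 abJ.
have [v [bv1 bv2]] := wf _ test.
have sub1 : `[s, s + e] `<=` J.
  apply: subset_trans (subset_trans abJ JJ) => r /=; rewrite !in_itv/= => /andP[r1 r2].
  by rewrite (le_trans as_ r1) (le_trans r2)// (le_trans e3)// ltW.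
have sub2 : `[t, t + e] `<=` J.
  apply: subset_trans (subset_trans abJ JJ) => r /=; rewrite !in_itv/= => /andP[r1 r2].
  by rewrite (le_trans _ r1) ?(le_trans r2)// (le_trans as_)// ltW.
have lv1 : l v <= (l (f s) + w1) + - (l (f t) - w1).
  have i1 := has_integralZ mJ (l (f s) + w1) (step_density_integral b1 mJ sub1).
  have i2 := has_integralZ mJ (- (l (f t) - w1)) (step_density_integral b2 mJ sub2).
  have := has_integralD mJ i1 i2; rewrite !mul1r => i12.
  apply: (bochner_has_integral_le mJ hl bv1 i12).
  apply: aeW => r Jr; rewrite lZ derive1n1 d mulrBl mulrN.
  apply: lerD; last rewrite lerN2.
    have [r1|r1] := leP r s; first by have [-> _] := step_left b1 r1; rewrite !mul0r.
    have [r2|r2] := leP (s + e) r; first by have [-> _] := step_right b1 r2; rewrite !mul0r.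
    rewrite ler_wpM2l ?(step_ge0 b1)//.
    have rs : `|r - s| < d1 by rewrite gtr0_norm ?subr_gt0//; lra.
    by case/andP: (hd1 r rs).
  have [r1|r1] := leP r t; first by have [-> _] := step_left b2 r1; rewrite !mul0r.
  have [r2|r2] := leP (t + e) r; first by have [-> _] := step_right b2 r2; rewrite !mul0r.
  rewrite ler_wpM2l ?(step_ge0 b2)//.
  have rs : `|r - t| < d2 by rewrite gtr0_norm ?subr_gt0//; lra.
  by case/andP: (hd2 r rs).
have eta0 r : 0 <= K e s r - K e t r.
  rewrite subr_ge0; have [r1|/ltW r1] := leP r t.
    by have [_ ->] := step_left b2 r1; case/andP: (step_01 r b1).
  have [_ ->] := step_right b1 (le_trans e3 r1).
  by case/andP: (step_01 r b2).
have lv2 : l (- v) <= M * (t - s) + `|M| * e.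
  rewrite expr1 scaleN1r in bv2.
  (* the test function is at most the indicator of [s, t + e] and at least that of
     [s + e, t]; the sign of M decides which comparison gives an upper bound *)
  have M_case (c d' : R) : a <= c -> c <= d' -> d' <= b -> (d' - c) * M <= M * (t - s) + `|M| * e ->
    (forall r, (K e s r - K e t r) * M <= \1_`[c, d'] r * M) ->
    l (- v) <= M * (t - s) + `|M| * e.
    move=> ac cd db le1 le2; apply: le_trans le1.
    have sub : `[c, d'] `<=` J.
      apply: subset_trans (subset_trans abJ JJ) => r /=; rewrite !in_itv/= => /andP[r1 r2].
      by rewrite (le_trans ac r1) (le_trans r2 db).
    have ii := has_integral_itv mJ M cd sub.
    apply: (bochner_has_integral_le mJ hl bv2 ii).
    apply: ae_imply hM => r hr Jr; rewrite lZ.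
    apply: le_trans (le2 r).
    have [rab|rab] := pselect (a <= r <= b); last by rewrite out// !mul0r.
    by rewrite ler_wpM2l// hr.
  have [M0|M0] := leP 0 M.
    apply: (M_case s (t + e)) => //; first by rewrite ler_wpDr ?ltW.
      by rewrite ger0_norm//; nra.
    move=> r; rewrite ler_wpM2r//; have [/set_mem|] := boolP (r \in `[s, t + e]%classic).
      move=> h; rewrite indicE mem_set//=.
      by have /andP[_ h1] := step_01 r b1; have /andP[h2 _] := step_01 r b2; lra.
    move=> h; rewrite indicE (negbTE h)/=.
    have [r1|r1] := leP r s.
      have [_ ->] := step_left b1 r1; have [_ ->] := step_left b2 (le_trans r1 (ltW st)).
      by rewrite subrr.
    have [r2|r2] := leP (t + e) r.
      have [_ ->] := step_right b2 r2.
      have ser : s + e <= r by rewrite (le_trans _ r2)// lerD2r ltW.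
      by have [_ ->] := step_right b1 ser; rewrite subrr.
    by move/negP: h; case; apply/mem_set; rewrite /= in_itv/= !ltW.
  apply: (M_case (s + e) t) => //.
  - by rewrite (le_trans as_)// lerDl ltW.
  - exact: ltW.
  - by rewrite ltr0_norm//; nra.
  move=> r; apply: ler_wnM2r; first exact: ltW.
  rewrite indicE; case: (boolP (r \in _)) => [/set_mem|_] /=; last exact: eta0.
  rewrite in_itv/= => /andP[r1 r2].
  by have [_ ->] := step_right b1 r1; have [_ ->] := step_left b2 r2; rewrite subr0.
rewrite (norming_funN hl) in lv2.
have : `|M| * e <= `|M| * w1 by rewrite ler_wpM2l.
have -> : w = w1 * (`|M| + 2) by rewrite /w1 divfK// gt_eqF.
by move: lv1 lv2; lra.
Qed.

Definition dquot f (h t : R) : B := of_real kd h^-1 *: (f (t + h) - f t).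

(** Testing with a difference of two functions [X] of [smooth_step_family]
    isolates the difference of the two quotients on one side; on the other one,
    the test function is at most [1] in absolute value and supported in
    [[a, b]]. *)
Lemma weak_derivative2_dquot (J : set R) f g a b M s t h h' :
  normed_by_functionals B ->
  measurable (J : set T) -> weak_derivative 2 J f g ->
  `[a, b] `<=` J° -> 0 <= M -> {ae mu, forall r, a <= r <= b -> rnorm (g r) <= M} ->
  (forall r, a <= r <= b -> continuous_at_time f r) ->
  0 < h -> 0 < h' -> a <= s -> s + h < b -> a <= t -> t + h' < b ->
  rnorm (dquot f h s - dquot f h' t) <= M * (b - a).
Proof.
move=> nB mJ wf abJ M0 hM cf h0 h'0 as_ sb at_ tb.
have [l hl lE] := nB (dquot f h s - dquot f h' t).
rewrite -lE (norming_funB hl) /dquot.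
have [lD lZ ll] := hl; rewrite !lZ !(norming_funB hl).
have hl' := norming_fun_opp hl.
apply/ler_addgt0Pr => w w0.
pose w1 := w / (2 * (h^-1 + h'^-1)).
have hh : 0 < 2 * (h^-1 + h'^-1) by rewrite mulr_gt0// addr_gt0// invr_gt0.
have w10 : 0 < w1 by rewrite divr_gt0.
have ctn r : a <= r <= b -> exists2 d, 0 < d & forall x, `|x - r| < d ->
    l (f r) - w1 <= l (f x) <= l (f r) + w1.
  by move=> /cf; exact: norming_near.
have [|d1 d10 hd1] := ctn s; first by rewrite as_/=; lra.
have [|d2 d20 hd2] := ctn (s + h); first by apply/andP; split; lra.
have [|d3 d30 hd3] := ctn t; first by rewrite at_/=; lra.
have [|d4 d40 hd4] := ctn (t + h'); first by apply/andP; split; lra.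
have [e [[e0 e1 e2] [e3 e4 e5 e6]]] : exists e, [/\ 0 < e, e < d1 & e < d2] /\
    [/\ e < d3, e < d4, s + h + e <= b & t + h' + e <= b].
  exists (Num.min (Num.min (Num.min (d1 / 2) (d2 / 2)) (Num.min (d3 / 2) (d4 / 2)))
     (Num.min (b - (s + h)) (b - (t + h')))).
  rewrite !lt_min !gt_min !subr_gt0 sb tb !divr_gt0//.
  split; split=> //.
  - by do 2 (apply/orP; left); apply/orP; left; lra.
  - by do 2 (apply/orP; left); apply/orP; right; lra.
  - by apply/orP; left; apply/orP; right; apply/orP; left; lra.
  - by apply/orP; left; apply/orP; right; apply/orP; right; lra.
  - by rewrite -lerBrDl !ge_min lexx !orbT.
  - by rewrite -lerBrDl !ge_min lexx !orbT.
have [k [K [bk bX]]] := smooth_step_family R.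
have [X1 b1] := bX e s h e0 h0; have [X2 b2] := bX e t h' e0 h'0.
have [test d out] := step_test_fun b1 b2 as_ at_ e5 e6 abJ.
have JJ : J° `<=` J := @interior_subset _ J.
have abJ' : `[a, b] `<=` J := subset_trans abJ JJ.
have [v [bv1 bv2]] := wf _ test.
have sub r : a <= r -> r + e <= b -> `[r, r + e] `<=` J.
  move=> ar rb; apply: subset_trans abJ' => x /=; rewrite !in_itv/= => /andP[x1 x2].
  by rewrite (le_trans ar x1) (le_trans x2).
have s1 : `[s, s + e] `<=` J by apply: sub; lra.
have s2 : `[s + h, s + h + e] `<=` J by apply: sub; lra.
have s3 : `[t, t + e] `<=` J by apply: sub; lra.
have s4 : `[t + h', t + h' + e] `<=` J by apply: sub; lra.
have dd r : derive1n 2 (fun r => X1 r - X2 r) r =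
    h^-1 * (k e s r - k e (s + h) r) - h'^-1 * (k e t r - k e (t + h') r).
  rewrite derive1nS derive1n1 d derive1E.
  have D1 := is_deriveZ h^-1 (is_deriveB (step_derive (bk e s e0) r) (step_derive (bk e (s + h) e0) r)).
  have D2 := is_deriveZ h'^-1 (is_deriveB (step_derive (bk e t e0) r) (step_derive (bk e (t + h') e0) r)).
  by have [_] := is_deriveB D1 D2.
have near_bd x dx r : 0 < dx -> e < dx -> (forall y, `|y - x| < dx ->
     l (f x) - w1 <= l (f y) <= l (f x) + w1) ->
     k e x r * (l (f x) - w1) <= k e x r * l (f r) <= k e x r * (l (f x) + w1).
  move=> dx0 ed hx; have bx := bk e x e0.
  have [r1|r1] := leP r x; first by have [-> _] := step_left bx r1; rewrite !mul0r lexx.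
  have [r2|r2] := leP (x + e) r; first by have [-> _] := step_right bx r2; rewrite !mul0r lexx.
  have rx : `|r - x| < dx by rewrite gtr0_norm ?subr_gt0//; lra.
  by have /andP[h1 h2] := hx r rx; rewrite !ler_wpM2l// (step_ge0 bx).
(* each of the four densities averages f near one of the points s, s + h, t, t + h' *)
have lv1 : l v <= h^-1 * ((l (f s) + w1) - (l (f (s + h)) - w1))
    - h'^-1 * ((l (f t) - w1) - (l (f (t + h')) + w1)).
  have i1 := has_integralZ mJ (h^-1 * (l (f s) + w1)) (step_density_integral (bk e s e0) mJ s1).
  have i2 := has_integralZ mJ (- h^-1 * (l (f (s + h)) - w1)) (step_density_integral (bk e (s + h) e0) mJ s2).
  have i3 := has_integralZ mJ (- h'^-1 * (l (f t) - w1)) (step_density_integral (bk e t e0) mJ s3).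
  have i4 := has_integralZ mJ (h'^-1 * (l (f (t + h')) + w1)) (step_density_integral (bk e (t + h') e0) mJ s4).
  have := has_integralD mJ (has_integralD mJ i1 i2) (has_integralD mJ i3 i4).
  rewrite !mul1r => i.
  have -> : h^-1 * ((l (f s) + w1) - (l (f (s + h)) - w1))
    - h'^-1 * ((l (f t) - w1) - (l (f (t + h')) + w1)) =
    h^-1 * (l (f s) + w1) + - h^-1 * (l (f (s + h)) - w1) +
     (- h'^-1 * (l (f t) - w1) + h'^-1 * (l (f (t + h')) + w1)) by ring.
  apply: (bochner_has_integral_le mJ hl bv1 i).
  apply: aeW => r Jr; rewrite lZ dd.
  have /andP[_ h1] := near_bd s d1 r d10 e1 hd1.
  have /andP[h2 _] := near_bd (s + h) d2 r d20 e2 hd2.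
  have /andP[h3 _] := near_bd t d3 r d30 e3 hd3.
  have /andP[_ h4] := near_bd (t + h') d4 r d40 e4 hd4.
  have hi : 0 <= h^-1 by rewrite invr_ge0 ltW.
  have hi' : 0 <= h'^-1 by rewrite invr_ge0 ltW.
  have := ler_wpM2l hi h1; have := ler_wpM2l hi h2.
  have := ler_wpM2l hi' h3; have := ler_wpM2l hi' h4; lra.
have lv2 : - l v <= (b - a) * M.
  have -> : - l v = - l ((-1) ^+ 2 *: v) by rewrite sqrrN expr1n scale1r.
  have ab : a <= b by rewrite (le_trans as_)//; lra.
  apply: (bochner_has_integral_le mJ hl' bv2 (has_integral_itv mJ M ab abJ')).
  apply: ae_imply hM => r hr Jr; rewrite lZ.
  have [rab|rab] := pselect (a <= r <= b); last first.
    by rewrite out// mul0r oppr0 mulr_ge0// indicE.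
  rewrite indicE mem_set ?mul1r /=; last by rewrite in_itv.
  have := norming_fun_abs hl (g r); have /andP[x1 x2] := step_01 r b1.
  have /andP[y1 y2] := step_01 r b2 => hlg.
  have hz : `|X1 r - X2 r| <= 1 by rewrite ler_norml; apply/andP; split; lra.
  apply: (le_trans (ler_norm _)); rewrite normrN normrM.
  have := hr rab => hgM; apply: (@le_trans _ _ (1 * `|l (g r)|)).
    by rewrite ler_wpM2r.
  by rewrite mul1r (le_trans hlg).
have -> : w = 2 * (h^-1 + h'^-1) * w1 by rewrite /w1 mulrC divfK// gt_eqF.
by move: lv1 lv2; lra.
Qed.

End WeakDerivative.

(** * Differentiability and functions of class C^{1,1} *)

Section AeExists.
Context (R : realType).
Local Notation mu := (@lebesgue_measure R).

Lemma ae_exists (P : R -> Prop) a b : a < b -> {ae mu, forall t, P t} ->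
  exists t, a < t < b /\ P t.
Proof.
move=> ab [N [mN N0 hN]]; apply: contrapT => h.
have : (mu `]a, b[ <= mu N)%E.
  apply: le_mu => // t /=; rewrite in_itv/= => tab.
  by apply: hN => /= Pt; apply: h; exists t.
rewrite N0 lebesgue_measure_itv/= lte_fin ab lee_fin subr_le0.
by rewrite leNgt ab.
Qed.

Lemma itv_sub_halfline_interior a b : 0 < a -> `[a, b] `<=` (halfline R)°.
Proof.
move=> a0 t /=; rewrite in_itv/= => /andP[at_ _].
apply/nbhs_ballP; exists a => //= s; rewrite /ball/= => h.
by rewrite /halfline/= in_itv/= andbT; move: h; rewrite ltr_norml => /andP[]; lra.
Qed.

Lemma measurable_halfline : measurable (halfline R : set (measurableTypeR R)).
Proof. exact: measurable_itv. Qed.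

End AeExists.

Section VectorDerivative.
Context (R : realType) (kd : scalar_kind) (B : normedModType (scalars R kd)).
Local Notation mu := (@lebesgue_measure R).
Local Notation T := (measurableTypeR R).
Implicit Types (f g : R -> B) (s t : R).

(** Only real increments occur, scaled through [of_real]; this is one notion for
    both scalar fields. *)
Definition vderiv f t (d : B) : Prop := forall e : R, 0 < e ->
  exists2 r : R, 0 < r & forall s, `|s - t| < r ->
    rnorm (f s - f t - of_real kd (s - t) *: d) <= e * `|s - t|.

Lemma ae_bound_everywhere f M :
  (forall t, 0 < t -> continuous_at_time f t) ->
  {ae mu, forall t, halfline R t -> rnorm (f t) <= M} ->
  forall t, 0 < t -> rnorm (f t) <= M.
Proof.
move=> cf hM t t0; apply/ler_addgt0Pr => e e0.
have [d d0 hd] := cf t t0 e e0.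
have [|s [/andP[s1 s2] hs]] := @ae_exists R _ t (t + d) _ hM; first by rewrite ltrDl.
have sd : `|s - t| < d by rewrite gtr0_norm ?subr_gt0//; lra.
have := hd s sd; rewrite rnormB => h.
apply: (le_trans (rnorm_sub _ (f s))); rewrite lerD ?(ltW h)//; apply: hs.
by rewrite /halfline/= in_itv/= andbT ltW// (lt_trans t0).
Qed.

Hypothesis nB : normed_by_functionals B.

(** [weak_derivative1_le] for a functional that attains the norm of
    [f t - f s]. *)
Lemma weak_derivative1_lipschitz (J : set R) f g a b M s t :
  measurable (J : set T) -> weak_derivative 1 J f g ->
  `[a, b] `<=` J° -> {ae mu, forall r, a <= r <= b -> rnorm (g r) <= M} ->
  (forall r, a <= r <= b -> continuous_at_time f r) ->
  a <= s -> s <= t -> t < b -> rnorm (f t - f s) <= M * (t - s).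
Proof.
move=> mJ wf abJ hM cf as_ st tb.
move: st; rewrite le_eqVlt => /predU1P[->|st]; first by rewrite !subrr rnorm0 mulr0.
have [l hl <-] := nB (f t - f s); rewrite (norming_funB hl).
apply: (weak_derivative1_le (g := g) mJ hl wf abJ) => //.
- apply: ae_imply hM => r hr /hr h; apply: le_trans h.
  by apply: le_trans (norming_fun_abs hl _); exact: ler_norm.
- by apply: cf; rewrite as_ (ltW (lt_trans st tb)).
- by apply: cf; rewrite (le_trans as_ (ltW st)) ltW.
Qed.

(** Near a point of continuity [l g] is within [e] of [l (g t)], and
    [weak_derivative1_le] transfers this to the increments of [f]. *)
Lemma weak_derivative1_vderiv (J : set R) f g t : measurable (J : set T) ->
  weak_derivative 1 J f g -> J° t ->
  (forall s, J° s -> continuous_at_time f s) -> continuous_at_time g t ->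
  vderiv f t (g t).
Proof.
move=> mJ wf Jt cf cg e e0.
have [d d0 hd] := cg e e0.
have /nbhs_ballP[r /= r0 hr] : nbhs t J°.
  by apply: open_nbhs_nbhs; split=> //; exact: open_interior.
pose q := Num.min d r / 2.
have q0 : 0 < q by rewrite divr_gt0// lt_min d0.
have qd : q < d.
  by rewrite /q ltr_pdivrMr// gt_min; apply/orP; left; lra.
have qr : q < r.
  by rewrite /q ltr_pdivrMr// gt_min; apply/orP; right; lra.
have abJ : `[t - q, t + q] `<=` J°.
  move=> s /=; rewrite in_itv/= => /andP[s1 s2]; apply: hr; rewrite /ball/=.
  by rewrite ltr_norml; apply/andP; split; lra.
have hg (l : B -> R) : norming_fun l ->
    {ae mu, forall x, t - q <= x <= t + q -> l (g x) <= l (g t) + e}.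
  move=> hl; apply: aeW => x /andP[x1 x2]; have xd : `|x - t| < d.
    by rewrite ltr_norml; apply/andP; split; lra.
  have := norming_fun_abs hl (g x - g t); rewrite (norming_funB hl).
  by move=> /(le_trans (ler_norm _)); have := hd x xd; lra.
exists q => // s sq; move: (sq); rewrite ltr_norml => /andP[q1 q2].
have [l hl <-] := nB (f s - f t - of_real kd (s - t) *: g t).
have [lD lZ ll] := hl; rewrite !(norming_funB hl) lZ.
have Jc x : t - q <= x <= t + q -> continuous_at_time f x.
  by move=> h; apply: cf; apply: abJ; rewrite /= in_itv.
have ct : continuous_at_time f t by apply: Jc; apply/andP; split; lra.
have cs : continuous_at_time f s by apply: Jc; apply/andP; split; lra.
have [st|ts|->] := ltgtP s t.
- have hl' := norming_fun_opp hl.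
  have a1 : t - q <= s by lra.
  have a2 : t < t + q by lra.
  have := weak_derivative1_le mJ hl' wf abJ (hg _ hl') cs ct a1 st a2.
  by rewrite ltr0_norm ?subr_lt0//; lra.
- have a1 : t - q <= t by lra.
  have a2 : s < t + q by lra.
  have := weak_derivative1_le mJ hl wf abJ (hg _ hl) ct cs a1 ts a2.
  by rewrite gtr0_norm ?subr_gt0//; lra.
- by rewrite !subrr mul0r subrr normr0 mulr0.
Qed.

End VectorDerivative.

(** Restricted to [t > 0], which is enough for statements that hold almost
    everywhere and avoids one-sided derivatives at [0]. *)
Record C11 (R : realType) (kd : scalar_kind) (B : normedModType (scalars R kd))
    (f df : R -> B) (L : R) : Prop := {
  C11_ge0 : 0 <= L;
  C11_bound : forall t, 0 < t -> rnorm (f t) <= L;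
  C11_dbound : forall t, 0 < t -> rnorm (df t) <= L;
  C11_lip : forall s t, 0 < s -> 0 < t -> rnorm (f t - f s) <= L * `|t - s|;
  C11_dlip : forall s t, 0 < s -> 0 < t -> rnorm (df t - df s) <= L * `|t - s|;
  C11_deriv : forall t, 0 < t -> vderiv f t (df t) }.

(** Completeness along geometric sequences.  The constant [4] leaves room for
    summing real and imaginary parts when the space is the complex field. *)
Definition seq_complete (R : realType) (kd : scalar_kind)
    (B : normedModType (scalars R kd)) : Prop :=
  forall (a : nat -> B) (C : R),
    (forall n, rnorm (a n.+1 - a n) <= C * 2^-1 ^+ n) ->
    exists l, forall n, rnorm (a n - l) <= C * 4 * 2^-1 ^+ n.

Section SeqComplete.
Context (R : realType) (kd : scalar_kind).

Lemma complete_seq_complete (B : completeNormedModType (scalars R kd)) :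
  seq_complete B.
Proof.
move=> a C h; have [l hl] := rnorm_complete h; exists l => n.
have C0 : 0 <= C by have := h 0%N; rewrite expr0 mulr1; apply/le_trans/rnorm_ge0.
apply: (le_trans (hl n)); rewrite ler_wpM2r// ler_wpM2l// ler_nat//.
Qed.

End SeqComplete.

(** Over the complex field, the real and imaginary parts converge separately. *)
Lemma scalars_seq_complete (R : realType) (kd : scalar_kind) :
  @seq_complete R kd (scalars R kd)^o.
Proof.
have real (a : nat -> R) (C : R) : (forall n, `|a n.+1 - a n| <= C * 2^-1 ^+ n) ->
    exists l, forall n, `|a n - l| <= C * 2 * 2^-1 ^+ n.
  exact: (@rnorm_complete R RealScalars R^o).
case: kd => a C h.
  by apply: complete_seq_complete; exact: h.
have C0 : 0 <= C by have := h 0%N; rewrite expr0 mulr1; apply/le_trans/rnorm_ge0.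
have normE (z : R[i]) : @rnorm R ComplexScalars (scalars R ComplexScalars)^o z =
    Num.sqrt (complex.Re z ^+ 2 + complex.Im z ^+ 2).
  by case: z.
have le_comp (b c d : R) : Num.sqrt (b ^+ 2 + c ^+ 2) <= d -> `|b| <= d /\ `|c| <= d.
  move=> hd; have h1 : `|b| <= Num.sqrt (b ^+ 2 + c ^+ 2).
    by rewrite -sqrtr_sqr ler_sqrt ?lerDl ?sqr_ge0// addr_ge0 ?sqr_ge0.
  have h2 : `|c| <= Num.sqrt (b ^+ 2 + c ^+ 2).
    by rewrite -sqrtr_sqr ler_sqrt ?lerDr ?sqr_ge0// addr_ge0 ?sqr_ge0.
  by split; [exact: le_trans h1 hd|exact: le_trans h2 hd].
have comp n : `|complex.Re (a n.+1) - complex.Re (a n)| <= C * 2^-1 ^+ n /\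
    `|complex.Im (a n.+1) - complex.Im (a n)| <= C * 2^-1 ^+ n.
  by apply: le_comp; have := h n; rewrite normE !raddfB.
have [l1 hl1] := real _ _ (fun n => proj1 (comp n)).
have [l2 hl2] := real _ _ (fun n => proj2 (comp n)).
exists (Complex l1 l2) => n; rewrite normE !raddfB /=.
have := hl1 n; have := hl2 n.
set b := complex.Re _ - l1; set c := complex.Im _ - l2; set d := _ * 2^-1 ^+ n => h1 h2.
have -> : C * 4 * 2^-1 ^+ n = d + d by rewrite /d; ring.
have d0 : 0 <= d by exact: le_trans (normr_ge0 _) h1.
rewrite -(ger0_norm (addr_ge0 d0 d0)) -sqrtr_sqr ler_sqrt ?sqr_ge0//.
have hb : b ^+ 2 <= d ^+ 2 by rewrite -real_normK ?num_real// ler_sqr ?nnegrE.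
have hc : c ^+ 2 <= d ^+ 2 by rewrite -real_normK ?num_real// ler_sqr ?nnegrE.
have -> : (d + d) ^+ 2 = 4 * d ^+ 2 by ring.
by have := sqr_ge0 d; lra.
Qed.

Section SecondOrder.
Context (R : realType) (kd : scalar_kind) (B : normedModType (scalars R kd)).
Local Notation mu := (@lebesgue_measure R).
Hypotheses (nB : normed_by_functionals B) (sB : seq_complete B).

(** By [weak_derivative2_dquot] any two difference quotients taken inside
    [[a, b]] differ by at most [M (b - a)].  Those with increments [2^-n]
    therefore converge; the limit is the derivative and is Lipschitz. *)
Lemma sobolev2_C11 (f : R -> B) : {within halfline R, continuous f} ->
  Sobolev_infty 2 (halfline R) f -> exists df L, C11 f df L.
Proof.
move=> wcf [[_ [Mf hMf]] hj].
have [g [[_ [Mg' hMg']] wg]] := hj 2%N isT.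
have cf t : 0 < t -> continuous_at_time f t.
  move=> t0; apply: (within_continuous_at_time wcf).
  by apply: (itv_sub_halfline_interior (b := t) t0); rewrite /= in_itv/= lexx.
have bf := ae_bound_everywhere cf hMf.
pose M := `|Mg'|.
have M0 : 0 <= M by rewrite normr_ge0.
have Mf0 : 0 <= Mf by apply: le_trans (bf 1 ltr01); exact: rnorm_ge0.
(* the bound of weak_derivative2_dquot asks for s + h < b strictly; b is enlarged a little *)
have key s t h h' a b : 0 < a -> 0 < h -> 0 < h' -> a <= s -> s + h <= b ->
    a <= t -> t + h' <= b -> rnorm (dquot f h s - dquot f h' t) <= M * (b - a).
  move=> a0 h0 h'0 as_ sb at_ tb.
  apply/ler_addgt0Pr => e e0.
  have den : 0 < M + 1 by lra.
  have -> : M * (b - a) + e = M * (b + e / (M + 1) - a) + (e - M * (e / (M + 1))) by ring.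
  have ee : 0 < e / (M + 1) by rewrite divr_gt0.
  apply: (@le_trans _ _ (M * (b + e / (M + 1) - a))).
    apply: (weak_derivative2_dquot (g := g) nB (@measurable_halfline R) wg) => //.
    - exact: itv_sub_halfline_interior.
    - apply: ae_imply hMg' => r hr /andP[r1 r2].
      apply: (@le_trans _ _ Mg'); last exact: ler_norm.
      by apply: hr; rewrite /halfline/= in_itv/= andbT ltW// (lt_le_trans a0).
    - by move=> r /andP[r1 r2]; apply: cf; exact: lt_le_trans r1.
    - by lra.
    - by lra.
  rewrite lerDl subr_ge0 mulrA ler_pdivrMr// mulrC ler_pM2l//; lra.
have pw n : 0 < 2^-1 ^+ n :> R by rewrite exprn_gt0.
have limD t : exists l, 0 < t -> forall n, rnorm (dquot f (2^-1 ^+ n) t - l) <= M * 4 * 2^-1 ^+ n.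
  have [t0|t0] := ltP 0 t; last by exists 0.
  have [l hl] : exists l, forall n, rnorm (dquot f (2^-1 ^+ n) t - l) <= M * 4 * 2^-1 ^+ n.
    apply: sB => n.
    apply: (le_trans (key t t (2^-1 ^+ n.+1) (2^-1 ^+ n) t (t + 2^-1 ^+ n) _ _ _ _ _ _ _)) => //.
    - by rewrite lerD2l exprS; have := pw n; lra.
    - by rewrite addrAC subrr add0r.
  by exists l.
have [df hdf] := choice limD.
have key2 s t h a b : 0 < a -> 0 < h -> a <= s -> s + h <= b -> a <= t -> t <= b ->
    rnorm (dquot f h s - df t) <= M * (b - a).
  move=> a0 h0 as_ sb at_ tb; have t0 := lt_le_trans a0 at_.
  apply: (@ler_approx_exp_half _ _ _ (M * 1 + M * 4)) => n.
  apply: (le_trans (rnormDB _ (dquot f (2^-1 ^+ n) t) _)).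
  rewrite mulrDl addrA; apply: lerD; last exact: hdf.
  apply: (le_trans (key s t h (2^-1 ^+ n) a (b + 2^-1 ^+ n) _ _ _ _ _ _ _)) => //.
  - by rewrite ler_wpDr// ltW.
  - by rewrite lerD2r.
  - by rewrite mulr1 -mulrDr; rewrite le_eqVlt; apply/orP; left; apply/eqP; ring.
have undq s h : 0 < h -> f (s + h) - f s = of_real kd h *: dquot f h s.
  by move=> h0; rewrite /dquot rscalerA mulfV ?rscaler1// gt_eqF.
have right s h : 0 < s -> 0 < h ->
    rnorm (f (s + h) - f s - of_real kd h *: df s) <= M * h * h.
  move=> s0 h0; rewrite undq// -scalerBr rnormZ gtr0_norm// mulrC ler_pM2r//.
  have := key2 s s h s (s + h); rewrite addrAC subrr add0r; apply=> //.
  by rewrite lerDl ltW.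
have left s h : 0 < s -> 0 < h ->
    rnorm (f (s + h) - f s - of_real kd h *: df (s + h)) <= M * h * h.
  move=> s0 h0; rewrite undq// -scalerBr rnormZ gtr0_norm// mulrC ler_pM2r//.
  have := key2 s (s + h) h s (s + h); rewrite addrAC subrr add0r; apply=> //.
  by rewrite lerDl ltW.
have dq1 s : 0 < s -> rnorm (dquot f 1 s) <= 2 * Mf.
  move=> s0; rewrite /dquot invr1 rscaler1; apply: (le_trans (rnormBD _ _)).
  by have := bf s s0; have := bf (s + 1) (addr_gt0 s0 ltr01); lra.
have dfb s : 0 < s -> rnorm (df s) <= 2 * Mf + M.
  move=> s0; apply: (le_trans (rnorm_sub _ (dquot f 1 s))).
  apply: lerD; first exact: dq1.
  rewrite rnormB; have := key2 s s 1 s (s + 1).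
  rewrite addrAC subrr add0r mulr1; apply=> //.
  by rewrite lerDl.
have dlip s t : 0 < s -> s < t -> rnorm (df t - df s) <= 2 * M * (t - s).
  move=> s0 st; have ts : 0 < t - s by rewrite subr_gt0.
  apply: (le_trans (rnormDB _ (dquot f (t - s) s) _)).
  have -> : 2 * M * (t - s) = M * (t - s) + M * (t - s) by ring.
  rewrite rnormB; apply: lerD.
    by apply: key2 => //; [rewrite [s + _]addrC subrK|exact: ltW].
  by apply: key2 => //; [rewrite [s + _]addrC subrK|exact: ltW].
have lip s t : 0 < s -> s < t -> rnorm (f t - f s) <= (2 * Mf + 2 * M) * (t - s).
  move=> s0 st; have ts : 0 < t - s by rewrite subr_gt0.
  have [t1|t1] := leP (t - s) 1.
    apply: (le_trans (rnorm_sub _ (of_real kd (t - s) *: df s))).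
    have := right s (t - s) s0 ts; rewrite [s + _]addrC subrK => h1.
    rewrite rnormZ gtr0_norm//.
    have h2 : (t - s) * rnorm (df s) <= (t - s) * (2 * Mf + M) by rewrite ler_pM2l// dfb.
    have h3 : M * (t - s) * (t - s) <= M * (t - s) * 1 by rewrite ler_wpM2l// mulr_ge0// ltW.
    lra.
  apply: (le_trans (rnormBD _ _)); have := bf s s0; have := bf t (lt_trans s0 st).
  by move=> h1 h2; nra.
exists df, (2 * Mf + 2 * M); split.
- by rewrite addr_ge0// mulr_ge0.
- by move=> t t0; apply: (le_trans (bf t t0)); lra.
- by move=> t t0; apply: (le_trans (dfb t t0)); lra.
- move=> s t s0 t0; have [st|ts|->] := ltgtP s t.
  + by rewrite gtr0_norm ?subr_gt0// lip.
  + by rewrite rnormB ltr0_norm ?subr_lt0// opprB lip.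
  + by rewrite !subrr rnorm0 normr0 mulr0.
- have w a : 0 <= a -> 2 * M * a <= (2 * Mf + 2 * M) * a by move=> a0; rewrite ler_wpM2r// lerDr mulr_ge0.
  move=> s t s0 t0; have [st|ts|->] := ltgtP s t.
  + by rewrite gtr0_norm ?subr_gt0//; apply: (le_trans (dlip _ _ s0 st)); apply: w; rewrite subr_ge0 ltW.
  + rewrite rnormB ltr0_norm ?subr_lt0// opprB; apply: (le_trans (dlip _ _ t0 ts)).
    by apply: w; rewrite subr_ge0 ltW.
  + by rewrite !subrr rnorm0 normr0 mulr0.
- move=> t t0 e e0; have den : 0 < M + 1 by lra.
  exists (Num.min t (e / (M + 1))); first by rewrite lt_min t0 divr_gt0.
  move=> s; rewrite lt_min => /andP[st se].
  have hM : M * `|s - t| <= e.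
    move: se; rewrite ltr_pdivlMr// => /ltW; apply: le_trans.
    by rewrite mulrC ler_wpM2l// lerDl.
  have [lt_st|lt_ts|->] := ltgtP s t.
  + have s0 : 0 < s by move: st; rewrite ltr0_norm ?subr_lt0//; lra.
    have ts : 0 < t - s by rewrite subr_gt0.
    have h := left s (t - s) s0 ts; rewrite [s + (t - s)]addrC subrK rnormB in h.
    have -> : f s - f t - of_real kd (s - t) *: df t =
        of_real kd (t - s) *: df t - (f t - f s).
      by rewrite -(opprB t s) rmorphN scaleNr opprK opprB addrC.
    apply: (le_trans h); move: hM; rewrite ltr0_norm ?subr_lt0// opprB => hM.
    by rewrite ler_pM2r.
  + have ts : 0 < s - t by rewrite subr_gt0.
    have := right t (s - t) t0 ts; rewrite [t + (s - t)]addrC subrK => h.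
    apply: (le_trans h); move: hM; rewrite gtr0_norm// => hM.
    by rewrite ler_pM2r.
  + by rewrite !subrr rmorph0 scale0r subrr rnorm0 normr0 mulr0.
Qed.

End SecondOrder.

(** * Calculus of vector-valued derivatives *)

Section NormingExt.
Context (R : realType) (kd : scalar_kind) (B : normedModType (scalars R kd)).
Hypothesis nB : normed_by_functionals B.

(** Reduces identities between linear combinations of vectors to identities
    between real numbers. *)
Lemma norming_ext (v v' : B) : (forall l, norming_fun l -> l v = l v') -> v = v'.
Proof.
move=> h; apply/eqP; rewrite -subr_eq0; apply/eqP/rnorm_eq0.
by have [l hl <-] := nB (v - v'); rewrite (norming_funB hl) h// subrr.
Qed.

Lemma vderivD (f g : R -> B) t d d' : vderiv f t d -> vderiv g t d' ->
  vderiv (fun s => f s + g s) t (d + d').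
Proof.
move=> hf hg e e0; have e2 : 0 < e / 2 by rewrite divr_gt0.
have [r r0 hr] := hf _ e2; have [r' r'0 hr'] := hg _ e2.
exists (Num.min r r'); first by rewrite lt_min r0.
move=> s; rewrite lt_min => /andP[/hr h1 /hr' h2].
have -> : f s + g s - (f t + g t) - of_real kd (s - t) *: (d + d') =
  (f s - f t - of_real kd (s - t) *: d) + (g s - g t - of_real kd (s - t) *: d').
  apply: norming_ext => l hl; have [lD lZ _] := hl.
  by rewrite !(lD, lZ, norming_funN hl); ring.
by apply: (le_trans (rnormD _ _)); lra.
Qed.

Lemma vderivN (f : R -> B) t d : vderiv f t d -> vderiv (fun s => - f s) t (- d).
Proof.
move=> hf e /hf[r r0 hr]; exists r => // s /hr; rewrite -rnormN.
by rewrite scalerN !opprD !opprK.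
Qed.

Lemma vderivB (f g : R -> B) t d d' : vderiv f t d -> vderiv g t d' ->
  vderiv (fun s => f s - g s) t (d - d').
Proof. by move=> hf hg; apply: vderivD => //; exact: vderivN. Qed.

Lemma vderiv_shift (f : R -> B) t h d : vderiv f (t + h) d ->
  vderiv (fun s => f (s + h)) t d.
Proof.
move=> hf e /hf[r r0 hr]; exists r => // s sr.
have E : s + h - (t + h) = s - t by ring.
by have := hr (s + h); rewrite E; exact.
Qed.

Lemma vderivZ (th : R -> R) (w : R -> B) (t dth : R) d : is_derive t 1 th dth ->
  vderiv w t d ->
  vderiv (fun s => of_real kd (th s) *: w s) t
    (of_real kd dth *: w t + of_real kd (th t) *: d).
Proof.
move=> /is_deriveP hth hw e e0.
pose c := 3 * (`|th t| + 1 + rnorm (w t) + (`|dth| + 1) * rnorm d).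
have c1 : 0 < c.
  rewrite /c mulr_gt0//; have := rnorm_ge0 (w t); have := rnorm_ge0 d.
  move=> h1 h2; have : 0 <= (`|dth| + 1) * rnorm d by rewrite mulr_ge0// addr_ge0.
  by have := normr_ge0 (th t); lra.
pose e1 := Num.min 1 (e / c).
have e10 : 0 < e1 by rewrite lt_min ltr01 divr_gt0.
have e1c : e1 * c <= e by rewrite -ler_pdivlMr// ge_min lexx orbT.
have e11 : e1 <= 1 by rewrite ge_min lexx.
have [r1 r10 h1] := hth _ ltr01; have [r2 r20 h2] := hth _ e10.
have [r3 r30 h3] := hw _ e10.
have a0 : 0 < `|dth| + 1 by rewrite ltr_wpDl.
exists (Num.min (Num.min r1 r2) (Num.min r3 (e1 / (`|dth| + 1)))).
  by rewrite !lt_min r10 r20 r30 divr_gt0.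
move=> s; rewrite !lt_min => /andP[/andP[/h1 k1 /h2 k2] /andP[/h3 k3 k4]].
have [l hl <-] := nB (of_real kd (th s) *: w s - of_real kd (th t) *: w t -
  of_real kd (s - t) *: (of_real kd dth *: w t + of_real kd (th t) *: d)).
have [lD lZ ll] := hl; rewrite !(norming_funB hl, lD, lZ).
have k5 : `|th s - th t| <= (`|dth| + 1) * `|s - t|.
  have := ler_normD (th s - th t - (s - t) * dth) ((s - t) * dth).
  by rewrite subrK normrM; lra.
have k6 : `|th s - th t| <= e1.
  by apply: (le_trans k5); rewrite mulrC -ler_pdivlMr// ltW.
have k7 : `|th s| <= `|th t| + 1.
  by have := ler_normD (th s - th t) (th t); rewrite subrK; lra.
have k8 : `|l (w s) - l (w t) - (s - t) * l d| <= e1 * `|s - t|.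
  apply: le_trans k3; rewrite -(norming_funB hl) -lZ -(norming_funB hl).
  exact: norming_fun_abs.
have k9 := norming_fun_abs hl (w t); have k10 := norming_fun_abs hl d.
have -> : th s * l (w s) - th t * l (w t) - (s - t) * (dth * l (w t) + th t * l d) =
  th s * (l (w s) - l (w t) - (s - t) * l d) + (th s - th t - (s - t) * dth) * l (w t)
  + (th s - th t) * (s - t) * l d by ring.
apply: (le_trans (ler_norm _)); apply: (le_trans (ler_normD _ _)).
have x0 := normr_ge0 (s - t).
have m1 : `|th s * (l (w s) - l (w t) - (s - t) * l d)| <= (`|th t| + 1) * (e1 * `|s - t|).
  by rewrite normrM ler_pM.
have m2 : `|(th s - th t - (s - t) * dth) * l (w t)| <= e1 * `|s - t| * rnorm (w t).
  by rewrite normrM ler_pM.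
have m3 : `|(th s - th t) * (s - t) * l d| <= e1 * `|s - t| * rnorm d.
  by rewrite !normrM ler_pM// ?mulr_ge0// ler_wpM2r.
have := ler_normD (th s * (l (w s) - l (w t) - (s - t) * l d)) ((th s - th t - (s - t) * dth) * l (w t)).
have m4 : e1 * c * `|s - t| <= e * `|s - t| by rewrite ler_wpM2r.
have m5 : 0 <= e1 * `|s - t| by rewrite mulr_ge0// ltW.
have m6 : 0 <= e1 * `|s - t| * (`|dth| * rnorm d) by rewrite mulr_ge0// mulr_ge0// rnorm_ge0.
have m7 : 0 <= e1 * `|s - t| * rnorm d by rewrite mulr_ge0// rnorm_ge0.
have m8 : 0 <= e1 * `|s - t| * rnorm (w t) by rewrite mulr_ge0// rnorm_ge0.
have m9 : 0 <= e1 * `|s - t| * (`|th t| + 1) by rewrite mulr_ge0// addr_ge0.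
move: m4; rewrite /c; lra.
Qed.

Lemma vderiv_unique (f : R -> B) t d d' : vderiv f t d -> vderiv f t d' -> d = d'.
Proof.
move=> h1 h2; apply/eqP; rewrite -subr_eq0; apply/eqP/rnorm_eq0/eqP.
rewrite eq_le rnorm_ge0 andbT; apply/ler_addgt0Pr => e e0; rewrite add0r.
have e2 : 0 < e / 2 by rewrite divr_gt0.
have [r r0 hr] := h1 _ e2; have [r' r'0 hr'] := h2 _ e2.
pose q := Num.min r r' / 2.
have q0 : 0 < q by rewrite divr_gt0// lt_min r0.
have qr : q < r by rewrite /q ltr_pdivrMr// gt_min; apply/orP; left; lra.
have qr' : q < r' by rewrite /q ltr_pdivrMr// gt_min; apply/orP; right; lra.
have E : t + q - t = q by rewrite addrAC subrr add0r.
have := hr (t + q); have := hr' (t + q); rewrite E gtr0_norm// => /(_ qr') a1 /(_ qr) a2.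
rewrite -(ler_pM2l q0).
have -> : q * rnorm (d - d') = rnorm (of_real kd q *: (d - d')) by rewrite rnormZ gtr0_norm.
have -> : of_real kd q *: (d - d') =
  (f (t + q) - f t - of_real kd q *: d') - (f (t + q) - f t - of_real kd q *: d).
  apply: norming_ext => l hl; have [lD lZ _] := hl.
  by rewrite !(norming_funB hl, lD, lZ, norming_funN hl); ring.
by apply: (le_trans (rnormBD _ _)); lra.
Qed.

Lemma vderiv_lipschitz_bound (f : R -> B) t d K : vderiv f t d ->
  (forall s, t < s -> rnorm (f s - f t) <= K * (s - t)) -> rnorm d <= K.
Proof.
move=> h hK; apply/ler_addgt0Pr => e e0.
have [r r0 hr] := h _ e0.
have q0 : 0 < r / 2 by rewrite divr_gt0.
have E : t + r / 2 - t = r / 2 by rewrite addrAC subrr add0r.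
have := hr (t + r / 2); have := hK (t + r / 2); rewrite E gtr0_norm//.
move=> /(_ _)/wrap[]; first by rewrite ltrDl.
move=> a1 /(_ _)/wrap[]; first by lra.
move=> a2; rewrite -(ler_pM2l q0).
have -> : r / 2 * rnorm d = rnorm (of_real kd (r / 2) *: d) by rewrite rnormZ gtr0_norm.
apply: (le_trans (rnorm_sub _ (f (t + r / 2) - f t))).
by rewrite (rnormB (of_real _ _ *: _)); lra.
Qed.

End NormingExt.

Section RealLinear.
Context (R : realType) (kd : scalar_kind) (B B' : normedModType (scalars R kd)).

(** Real-linear maps commute with [vderiv], whichever the scalar field. *)
Definition rlinear (F : B -> B') : Prop :=
  [/\ forall x y, F (x + y) = F x + F y,
      forall (r : R) x, F (of_real kd r *: x) = of_real kd r *: F x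
    & exists2 C : R, 0 < C & forall x, rnorm (F x) <= C * rnorm x].

Lemma rlinearB F x y : rlinear F -> F (x - y) = F x - F y.
Proof.
case=> FD FZ _; have -> : - y = of_real kd (-1) *: y by rewrite rmorphN1 scaleN1r.
by rewrite FD FZ rmorphN1 scaleN1r.
Qed.

Lemma C11_rlinear F (f df : R -> B) L : rlinear F -> C11 f df L ->
  exists L', C11 (fun t => F (f t)) (fun t => F (df t)) L'.
Proof.
move=> hF [L0 b1 b2 b3 b4 b5]; have [FD FZ [C C0 hC]] := hF.
exists (C * L); split.
- by rewrite mulr_ge0// ltW.
- by move=> t t0; apply: (le_trans (hC _)); rewrite ler_pM2l// b1.
- by move=> t t0; apply: (le_trans (hC _)); rewrite ler_pM2l// b2.
- move=> s t s0 t0; rewrite -(rlinearB _ _ hF); apply: (le_trans (hC _)).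
  by rewrite -mulrA ler_pM2l// b3.
- move=> s t s0 t0; rewrite -(rlinearB _ _ hF); apply: (le_trans (hC _)).
  by rewrite -mulrA ler_pM2l// b4.
- move=> t t0 e e0; have [r r0 hr] := b5 t t0 (e / C) (divr_gt0 e0 C0).
  exists r => // s sr; rewrite -FZ -!(rlinearB _ _ hF); apply: (le_trans (hC _)).
  by have := hr s sr; rewrite -(ler_pM2l C0) mulrA [C * (e / C)]mulrC divfK// gt_eqF.
Qed.

End RealLinear.

Lemma C11_add (R : realType) (kd : scalar_kind) (B : normedModType (scalars R kd))
    (f df g dg : R -> B) L L' : normed_by_functionals B ->
  C11 f df L -> C11 g dg L' ->
  C11 (fun t => f t + g t) (fun t => df t + dg t) (L + L').
Proof.
move=> nB [L0 b1 b2 b3 b4 b5] [L'0 c1 c2 c3 c4 c5]; split.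
- exact: addr_ge0.
- by move=> t t0; apply: (le_trans (rnormD _ _)); rewrite lerD ?b1 ?c1.
- by move=> t t0; apply: (le_trans (rnormD _ _)); rewrite lerD ?b2 ?c2.
- move=> s t s0 t0; rewrite opprD addrACA mulrDl.
  by apply: (le_trans (rnormD _ _)); rewrite lerD ?b3 ?c3.
- move=> s t s0 t0; rewrite opprD addrACA mulrDl.
  by apply: (le_trans (rnormD _ _)); rewrite lerD ?b4 ?c4.
- by move=> t t0; apply: vderivD => //; [exact: b5|exact: c5].
Qed.

Section VGronwall.
Context (R : realType) (kd : scalar_kind) (X : hilbertType R kd).
Local Notation mu := (@lebesgue_measure R).

(** The product rule for the square of the norm, as the upper estimate that
    [dini_gronwall] requires. *)
Lemma vderiv_sq (w : R -> X) t d : vderiv w t d -> forall e, 0 < e ->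
  exists2 r, 0 < r & forall s, `|s - t| < r ->
    rnorm (w s) ^+ 2 <= rnorm (w t) ^+ 2 + (s - t) * (2 * rdot d (w t)) + e * `|s - t|.
Proof.
move=> hw e e0.
have nw := rnorm_ge0 (w t); have nd := rnorm_ge0 d.
pose e1 := Num.min 1 (e / (4 * (rnorm (w t) + 1))).
have e10 : 0 < e1 by rewrite lt_min ltr01 divr_gt0// mulr_gt0// ltr_wpDl.
have e11 : e1 <= 1 by rewrite ge_min lexx.
have e12 : e1 * (4 * (rnorm (w t) + 1)) <= e.
  by rewrite -ler_pdivlMr ?mulr_gt0 ?ltr_wpDl// ge_min lexx orbT.
have [r r0 hr] := hw _ e10.
have den : 0 < 2 * (rnorm d + 1) ^+ 2 by rewrite mulr_gt0// exprn_gt0// ltr_wpDl.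
exists (Num.min r (e / (2 * (rnorm d + 1) ^+ 2))); first by rewrite lt_min r0 divr_gt0.
move=> s; rewrite lt_min => /andP[/hr h1]; rewrite ltr_pdivlMr// => h2.
set x := `|s - t| in h1 h2 *; have x0 : 0 <= x := normr_ge0 _.
have -> : w s = w t + (w s - w t) by rewrite addrC subrK.
rewrite rnormD_sqr -addrA -[in leRHS]addrA lerD2l.
set rho := w s - w t - of_real kd (s - t) *: d in h1.
have E : w s - w t = of_real kd (s - t) *: d + rho by rewrite /rho [RHS]addrC subrK.
have n1 : rnorm (w s - w t) <= x * (rnorm d + 1).
  rewrite E; apply: (le_trans (rnormD _ _)); rewrite rnormZ -/x.
  have : e1 * x <= 1 * x by rewrite ler_wpM2r.
  by lra.
have n2 : rnorm (w s - w t) ^+ 2 <= x * (e / 2).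
  have : rnorm (w s - w t) ^+ 2 <= (x * (rnorm d + 1)) ^+ 2.
    by rewrite ler_sqr ?nnegrE ?rnorm_ge0 ?mulr_ge0 ?addr_ge0.
  move=> /le_trans; apply; rewrite exprMn expr2 -mulrA ler_wpM2l//.
  by move: h2; lra.
have n3 : rdot (w t) (w s - w t) <= (s - t) * rdot d (w t) + rnorm (w t) * (e1 * x).
  rewrite E rdotDr rdotZr (rdotC (w t) d) lerD2l.
  by apply: (le_trans (rdot_le _ _)); rewrite ler_wpM2l.
have n4 : rnorm (w t) * (e1 * x) * 4 <= e * x.
  apply: (@le_trans _ _ (e1 * (4 * (rnorm (w t) + 1)) * x)); last by rewrite ler_wpM2r.
  have : 0 <= e1 * x by rewrite mulr_ge0// ltW.
  by lra.
lra.
Qed.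

(** Applied to [|D|^2], with [2 c |D|] split by Young's inequality into
    [c^2 / (- al)] and [(- al) |D|^2], the estimate has the form
    required by [dini_gronwall]. *)
Lemma vgronwall (D : R -> X) (a b al c L : R) : a <= b -> al < 0 -> 0 <= c -> 0 <= L ->
  (forall s t, a <= s -> s <= t -> t <= b -> rnorm (D t - D s) <= L * (t - s)) ->
  {ae mu, forall t, a <= t < b -> exists2 d, vderiv D t d &
     rdot d (D t) <= al * rnorm (D t) ^+ 2 + c * rnorm (D t)} ->
  rnorm (D b) <= Num.max (rnorm (D a)) (c / - al).
Proof.
move=> ab al0 c0 L0 hL hD.
have k0 : 0 < - al by rewrite oppr_gt0.
pose W := rnorm (D a) + L * (b - a).
have W0 : 0 <= W by rewrite addr_ge0 ?rnorm_ge0// mulr_ge0// subr_ge0.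
have hW t : a <= t -> t <= b -> rnorm (D t) <= W.
  move=> at_ tb; apply: (le_trans (rnorm_sub _ (D a))); rewrite lerD2l.
  apply: (le_trans (hL a t (lexx a) at_ tb)).
  by rewrite ler_wpM2l// lerD2r.
have := @dini_gronwall R a b (2 * W * L) (- al) (c ^+ 2 / - al) (fun t => rnorm (D t) ^+ 2) ab.
move=> /(_ _ k0)/wrap[]; first by rewrite !mulr_ge0.
move=> /(_ _)/wrap[].
  move=> s t as_ st tb.
  have -> : rnorm (D t) ^+ 2 - rnorm (D s) ^+ 2 = (rnorm (D t) + rnorm (D s)) * (rnorm (D t) - rnorm (D s)) by ring.
  have h1 := rnorm_sub (D t) (D s); have h2 := hL s t as_ st tb.
  have h3 := hW t (le_trans as_ st) tb; have h4 := hW s as_ (le_trans st tb).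
  have h5 := rnorm_ge0 (D t); have h6 := rnorm_ge0 (D s).
  have Lts : 0 <= L * (t - s) by rewrite mulr_ge0// subr_ge0.
  apply: (@le_trans _ _ ((rnorm (D t) + rnorm (D s)) * (L * (t - s)))).
    by rewrite ler_wpM2l ?addr_ge0//; lra.
  rewrite -mulrA ler_wpM2r//; lra.
move=> /(_ _)/wrap[].
  apply: ae_imply hD => t ht /ht[d hd hdot] e e0.
  have [r r0 hr] := vderiv_sq hd e0; exists r => // s ts str sb.
  have sr : `|s - t| < r by rewrite gtr0_norm ?subr_gt0//; lra.
  have st0 : 0 < s - t by rewrite subr_gt0.
  apply: (le_trans (hr s sr)); rewrite gtr0_norm// -addrA lerD2l.
  rewrite [_ * (s - t)]mulrC (mulrC e) -mulrDr ler_pM2l// lerD2r.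
  have : 2 * (c * rnorm (D t)) <= c ^+ 2 / - al + - al * rnorm (D t) ^+ 2.
    have := sqr_ge0 (c - (- al) * rnorm (D t)); rewrite sqrrB => h.
    rewrite -(ler_pM2l k0).
    have -> : - al * (c ^+ 2 / - al + - al * rnorm (D t) ^+ 2) = c ^+ 2 + (- al * rnorm (D t)) ^+ 2.
      by field; rewrite lt_eqF.
    by move: h; lra.
  by move: hdot; lra.
set m := Num.max (rnorm (D a)) _ => h.
have m0 : 0 <= m by rewrite le_max rnorm_ge0.
rewrite -ler_sqr ?nnegrE ?rnorm_ge0//; apply: (le_trans h).
have qa : c ^+ 2 / - al / - al = (c / - al) ^+ 2 by field; rewrite lt_eqF.
rewrite qa ge_max; apply/andP; split; rewrite ler_sqr ?nnegrE ?rnorm_ge0 ?divr_ge0 ?(ltW k0)// /m le_max lexx ?orbT//.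
Qed.

End VGronwall.

(** * The funnel feedback *)

Section Psi.
Context (R : realType) (kd : scalar_kind) (U : hilbertType R kd).
Implicit Types (e : U) (r : R).

Definition gain r e : R := (1 - r ^+ 2 * rnorm e ^+ 2)^-1.

Lemma psiE r e : psi r e = of_real kd (gain r e) *: e.
Proof. by []. Qed.

Lemma gain_den r e : 0 < r -> r * rnorm e < 1 -> 0 < 1 - r ^+ 2 * rnorm e ^+ 2.
Proof.
move=> r0 re1; have re0 : 0 <= r * rnorm e by rewrite mulr_ge0 ?rnorm_ge0// ltW.
by rewrite -exprMn subr_gt0 expr2; nra.
Qed.

Lemma gain_ge1 r e : 0 < r -> r * rnorm e < 1 -> 1 <= gain r e.
Proof.
move=> r0 re1; rewrite /gain -[leLHS]invr1 lef_pV2 ?posrE ?ltr01 ?gain_den//.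
by rewrite gerBl mulr_ge0// sqr_ge0.
Qed.

Lemma gain_homo r e1 e2 : 0 < r -> r * rnorm e2 < 1 -> rnorm e1 <= rnorm e2 ->
  gain r e1 <= gain r e2.
Proof.
move=> r0 re2 e12.
have re1 : r * rnorm e1 < 1 by apply: le_lt_trans re2; rewrite ler_pM2l.
rewrite /gain lef_pV2 ?posrE ?gain_den// lerD2l lerN2 ler_wpM2l ?sqr_ge0//.
by rewrite ler_sqr ?nnegrE ?rnorm_ge0.
Qed.

(** [psi] is the sum of the identity and of [(gain - 1) e], whose radial profile
    is nondecreasing; the latter is monotone by the Cauchy-Schwarz
    inequality. *)
Lemma psi_strongly_monotone r e1 e2 : 0 < r -> r * rnorm e1 < 1 -> r * rnorm e2 < 1 ->
  rnorm (e1 - e2) ^+ 2 <= rdot (psi r e1 - psi r e2) (e1 - e2).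
Proof.
move=> r0 re1 re2; rewrite !psiE rdotBl !rdotBr !rdotZl !rdotxx rnormB_sqr.
have := gain_ge1 r0 re1; have := gain_ge1 r0 re2.
have mono : 0 <= (rnorm e1 - rnorm e2) *
    ((gain r e1 - 1) * rnorm e1 - (gain r e2 - 1) * rnorm e2).
  have g1 := gain_ge1 r0 re1; have g2 := gain_ge1 r0 re2.
  have n1 := rnorm_ge0 e1; have n2 := rnorm_ge0 e2.
  have [h|/ltW h] := leP (rnorm e1) (rnorm e2).
    have g := gain_homo r0 re2 h.
    rewrite -mulrNN mulr_ge0 ?oppr_ge0 ?subr_le0// ler_pM// ?subr_ge0// lerD2r//.
  have g := gain_homo r0 re1 h.
  by rewrite mulr_ge0 ?subr_ge0// ler_pM// ?subr_ge0// lerD2r.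
rewrite (rdotC e2 e1); have := rdot_le e1 e2; move: mono.
set d := rdot e1 e2; set a := rnorm e1; set b := rnorm e2.
set l := gain r e1; set m := gain r e2 => mono hd m1 l1.
have : (l + m - 2) * d <= (l + m - 2) * (a * b) by rewrite ler_wpM2l//; lra.
by move: mono; rewrite !expr2; lra.
Qed.

(** The gain only depends on [r |e|], so a factor can be moved between the two
    arguments. *)
Lemma psi_scale (th r r' : R) e : th * r = r' ->
  psi r (of_real kd th *: e) = of_real kd th *: psi r' e.
Proof.
move=> <-; rewrite !psiE !rscalerA /gain rnormZ exprMn real_normK ?num_real//.
by rewrite mulrC; congr (of_real kd (_ * _^-1) *: e); ring.
Qed.

Lemma psi_lipschitz r e1 e2 k : 0 < r -> r * rnorm e1 < 1 -> r * rnorm e2 < 1 ->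
  gain r e1 <= k -> gain r e2 <= k ->
  rnorm (psi r e1 - psi r e2) <= (k + 2 * k ^+ 2) * rnorm (e1 - e2).
Proof.
move=> r0 re1 re2 k1 k2.
have g1 := gain_ge1 r0 re1; have g2 := gain_ge1 r0 re2.
have n1 := rnorm_ge0 e1; have n2 := rnorm_ge0 e2.
have d1 := gain_den r0 re1; have d2 := gain_den r0 re2.
have E : psi r e1 - psi r e2 =
    of_real kd (gain r e1) *: (e1 - e2) + of_real kd (gain r e1 - gain r e2) *: e2.
  apply: (norming_ext (@hilbert_normed_by_functionals R kd U)) => l hl; have [lD lZ _] := hl.
  by rewrite !psiE !(norming_funB hl, lD, lZ); ring.
rewrite E; apply: (le_trans (rnormD _ _)); rewrite !rnormZ mulrDl.
have g0 : 0 <= gain r e1 by lra.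
apply: lerD; first by rewrite ger0_norm// ler_wpM2r// rnorm_ge0.
have -> : gain r e1 - gain r e2 =
   gain r e1 * gain r e2 * (r ^+ 2 * (rnorm e1 + rnorm e2) * (rnorm e1 - rnorm e2)).
  rewrite /gain; have -> : r ^+ 2 * (rnorm e1 + rnorm e2) * (rnorm e1 - rnorm e2) =
      (1 - r ^+ 2 * rnorm e2 ^+ 2) - (1 - r ^+ 2 * rnorm e1 ^+ 2) by ring.
  move: (1 - r ^+ 2 * rnorm e1 ^+ 2) (1 - r ^+ 2 * rnorm e2 ^+ 2) d1 d2 => a b a0 b0.
  by field; rewrite !gt_eqF.
have tri : `|rnorm e1 - rnorm e2| <= rnorm (e1 - e2).
  rewrite ler_norml; have := rnorm_sub e1 e2; have := rnorm_sub e2 e1.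
  by rewrite (rnormB e2 e1) => h1 h2; apply/andP; split; lra.
have kk : gain r e1 * gain r e2 <= k ^+ 2 by rewrite expr2 ler_pM//; lra.
have rr : r ^+ 2 * (rnorm e1 + rnorm e2) * rnorm e2 <= 2.
  have x1 : 0 <= r * rnorm e1 by rewrite mulr_ge0// ltW.
  have x2 : 0 <= r * rnorm e2 by rewrite mulr_ge0// ltW.
  have -> : r ^+ 2 * (rnorm e1 + rnorm e2) * rnorm e2 =
    (r * rnorm e1 + r * rnorm e2) * (r * rnorm e2) by ring.
  by nra.
have p1 : 0 <= gain r e1 * gain r e2 by rewrite mulr_ge0//; lra.
have p2 : 0 <= r ^+ 2 * (rnorm e1 + rnorm e2) * rnorm e2.
  by rewrite mulr_ge0// mulr_ge0 ?sqr_ge0 ?addr_ge0.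
have p3 : 0 <= r ^+ 2 * (rnorm e1 + rnorm e2).
  by rewrite mulr_ge0 ?sqr_ge0// addr_ge0.
rewrite normrM (ger0_norm p1) normrM (ger0_norm p3).
apply: (@le_trans _ _ (gain r e1 * gain r e2 * (r ^+ 2 * (rnorm e1 + rnorm e2) * rnorm e2) * `|rnorm e1 - rnorm e2|)).
  by rewrite le_eqVlt; apply/orP; left; apply/eqP; ring.
apply: ler_pM => //; first by rewrite mulr_ge0.
by rewrite [2 * _]mulrC; apply: ler_pM.
Qed.

End Psi.

(** * Uniform estimates for the lifted closed loop *)

Section Estimate.
Context (R : realType) (kd : scalar_kind) (X U : hilbertType R kd).
Local Notation mu := (@lebesgue_measure R).
Variables (S : boundary_control_system X U) (alpha : R).
Hypotheses (S1 : system_S1 S alpha) (alpha_lt0 : alpha < 0).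
Local Notation A := (bcs_A S).
Local Notation emb := (bcs_emb S).
Local Notation Bo := (bcs_B S).
Local Notation C := (bcs_C S).

Lemma S1_rdot z : rdot (A z) (emb z) <= rdot (Bo z) (C z) + alpha * rnorm (emb z) ^+ 2.
Proof. exact: S1. Qed.

Definition funnel_state (r : R) (z : bcs_dom S) : Prop :=
  [/\ 0 < r, r * rnorm (C z) < 1 & Bo z = - psi r (C z)].

Lemma funnel_dissipation r z : funnel_state r z ->
  rdot (A z) (emb z) <= - (gain r (C z) * rnorm (C z) ^+ 2) + alpha * rnorm (emb z) ^+ 2.
Proof.
move=> [r0 rC Bz]; apply: (le_trans (S1_rdot z)).
by rewrite Bz rdotNl psiE rdotZl rdotxx.
Qed.

(** By [psi_scale] the rescaled state [(r1 / r2) z1] obeys the feedback law with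
    parameter [r2], to which strong monotonicity applies. *)
Lemma funnel_dissipation_scaled r1 r2 z1 z2 z : funnel_state r1 z1 -> funnel_state r2 z2 ->
  z = of_real kd (r1 / r2) *: z1 - z2 ->
  rdot (A z) (emb z) <= - rnorm (of_real kd (r1 / r2) *: C z1 - C z2) ^+ 2
     + alpha * rnorm (emb z) ^+ 2.
Proof.
move=> [r10 rC1 Bz1] [r20 rC2 Bz2] zE; apply: (le_trans (S1_rdot z)).
rewrite lerD2r zE.
set th := r1 / r2.
have thr : th * r2 = r1 by rewrite /th divfK// gt_eqF.
have th0 : 0 < th by rewrite divr_gt0.
have -> : C (of_real kd th *: z1 - z2) = of_real kd th *: C z1 - C z2.
  by rewrite linearB linearZ.
have -> : Bo (of_real kd th *: z1 - z2) =
    - (psi r2 (of_real kd th *: C z1) - psi r2 (C z2)).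
  by rewrite (psi_scale _ thr) linearB linearZ /= Bz1 Bz2 scalerN opprB addrC opprK.
rewrite rdotNl lerN2.
apply: psi_strongly_monotone => //.
by rewrite rnormZ gtr0_norm// mulrA [r2 * _]mulrC thr.
Qed.

Definition funnel_solution_at (w f : R -> X) (phi : R -> R) t : Prop :=
  exists z, [/\ emb z = w t, vderiv w t (A z + f t) & funnel_state (phi t) z].

Variables (w f : R -> X) (phi dphi : R -> R) (F Lp p0 : R).
Hypotheses (fb : forall t, 0 < t -> rnorm (f t) <= F)
  (fl : forall s t, 0 < s -> 0 < t -> rnorm (f t - f s) <= F * `|t - s|)
  (p00 : 0 < p0) (pp : forall t, 0 < t -> p0 <= phi t)
  (pb : forall t, 0 < t -> phi t <= Lp)
  (dpb : forall t, 0 < t -> `|dphi t| <= Lp)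
  (pl : forall s t, 0 < s -> 0 < t -> `|phi t - phi s| <= Lp * `|t - s|)
  (dpl : forall s t, 0 < s -> 0 < t -> `|dphi t - dphi s| <= Lp * `|t - s|)
  (pd : forall t : R, 0 < t -> is_derive t 1 phi (dphi t))
  (wloc : forall T, exists2 L, 0 <= L & forall s t, 0 < s -> s <= t -> t <= T ->
     rnorm (w t - w s) <= L * (t - s))
  (wae : {ae mu, forall t, 0 < t -> funnel_solution_at w f phi t}).

Let F0 : 0 <= F. Proof. by apply: le_trans (fb ltr01); exact: rnorm_ge0. Qed.
Let Lp0 : 0 <= Lp. Proof. by apply: le_trans (dpb ltr01); exact: normr_ge0. Qed.
Let phi0 t : 0 < t -> 0 < phi t. Proof. by move=> t0; apply: lt_le_trans (pp t0). Qed.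

(** All hypotheses concern positive times, so Gronwall's inequality is started
    at time [1]; the local Lipschitz bound covers the times before. *)
Lemma funnel_solution_bounded : exists2 W : R, 0 <= W & forall t, 0 < t -> rnorm (w t) <= W.
Proof.
have [L1 L10 hL1] := wloc 1.
exists (rnorm (w 1) + L1 + F / - alpha).
  by rewrite !addr_ge0 ?rnorm_ge0// divr_ge0// oppr_ge0 ltW.
have Fa : 0 <= F / - alpha by rewrite divr_ge0// oppr_ge0 ltW.
move=> t t0; have [t1|/ltW t1] := leP t 1.
  apply: (le_trans (rnorm_sub _ (w 1))); rewrite rnormB -addrA lerD2l ler_wpDr//.
  apply: (le_trans (hL1 t 1 t0 t1 (lexx 1))).
  by rewrite -[leRHS]mulr1 ler_wpM2l//; lra.
have [L L0 hL] := wloc t.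
have := @vgronwall R kd X w 1 t alpha F L t1 alpha_lt0 F0 L0.
move=> /(_ _)/wrap[].
  by move=> s r s1 sr rt; apply: hL => //; exact: lt_le_trans s1.
move=> /(_ _)/wrap[].
  apply: ae_imply wae => r hr /andP[r1 _].
  have r0 : 0 < r by exact: lt_le_trans r1.
  have [z [ez dz fz]] := hr r0; exists (A z + f r) => //.
  rewrite rdotDl -ez; apply: lerD.
    apply: (le_trans (funnel_dissipation fz)).
    rewrite gerDr oppr_le0 mulr_ge0 ?sqr_ge0//.
    by case: fz => p q _; have := gain_ge1 p q; lra.
  by apply: (le_trans (rdot_le _ _)); rewrite ler_wpM2r ?rnorm_ge0// fb.
move=> /le_trans; apply; rewrite ge_max; apply/andP; split.
  by rewrite -addrA lerDl addr_ge0.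
by rewrite lerDr addr_ge0// rnorm_ge0.
Qed.

(** Gronwall's inequality for [D = th w(. + h) - w].  Its right-hand side is
    [A D + th' w(. + h) + (th - 1) f(. + h) + f(. + h) - f], where [th'] and
    [th - 1] are [O(h)] because [phi] is [C^{1,1}] and bounded below.  The
    initial value at time [1] is [O(h)] by the local Lipschitz bound. *)
Lemma funnel_solution_lipschitz : exists2 K : R, 0 <= K &
  forall s t, 0 < s -> 0 < t -> rnorm (w t - w s) <= K * `|t - s|.
Proof.
have [W W0 hW] := funnel_solution_bounded.
have a0 : 0 < - alpha by rewrite oppr_gt0.
pose c1 := Lp / p0.
have c10 : 0 <= c1 by rewrite divr_ge0// ltW.
pose c2 := (Lp * Lp + Lp * Lp) / p0 ^+ 2.
have p02 : 0 < p0 ^+ 2 by rewrite exprn_gt0.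
have c20 : 0 <= c2 by rewrite divr_ge0 ?addr_ge0 ?mulr_ge0// ltW.
pose c3 := c2 * W + c1 * F + F.
have c30 : 0 <= c3 by rewrite /c3 !addr_ge0// mulr_ge0.
have [L2 L20 hL2] := wloc 2.
pose c4 := c1 * W + L2 + c3 / - alpha.
have c3a : 0 <= c3 / - alpha by rewrite divr_ge0// ltW.
have c40 : 0 <= c4 by rewrite /c4 !addr_ge0// mulr_ge0.
pose K := c1 * W + c4 + L2 + 2 * W.
have K0 : 0 <= K by rewrite /K !addr_ge0// mulr_ge0.
have th1 t h : 0 < t -> 0 <= h -> `|phi (t + h) / phi t - 1| <= c1 * h.
  move=> t0 h0; have th0 : 0 < t + h by rewrite ltr_pwDl.
  have -> : phi (t + h) / phi t - 1 = (phi (t + h) - phi t) / phi t.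
    by field; rewrite gt_eqF// phi0.
  rewrite normrM normfV (gtr0_norm (phi0 t0)) ler_pdivrMr ?phi0//.
  apply: (le_trans (pl t0 th0)).
  rewrite addrAC subrr add0r ger0_norm// -mulrA -[X in _ <= c1 * X](mulrC (phi t)) /c1.
  rewrite mulrA ler_wpM2r//.
  by rewrite -[leLHS](divfK (lt0r_neq0 p00)) ler_wpM2l ?pp.
have main T h : 1 <= T -> 0 <= h -> h <= 1 -> rnorm (w (T + h) - w T) <= (c1 * W + c4) * h.
  move=> T1 h0 h1; have T0 : 0 < T by exact: lt_le_trans T1.
  pose th t := phi (t + h) / phi t.
  pose D t := of_real kd (th t) *: w (t + h) - w t.
  have ph t : 0 < t -> 0 < t + h by move=> t0; rewrite ltr_pwDl.
  pose dth t := dphi (t + h) / phi t - phi (t + h) * dphi t / phi t ^+ 2.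
  have thd (t : R) : 0 < t -> is_derive t 1 th (dth t).
    move=> t0; have pt0 : phi t != 0 by rewrite gt_eqF// phi0.
    have dinv : is_derive t 1 (fun s => (phi s)^-1) (- (phi t) ^- 2 * dphi t).
      have [dd dv] := pd t0.
      apply: DeriveDef; first exact: derivableV.
      by rewrite deriveV// dv.
    have dsh : is_derive t 1 (fun s => phi (1 * s + h)) (1 * dphi (1 * t + h)).
      by apply: is_derive_affine; apply: pd; rewrite mul1r ph.
    have E : (fun s : R => phi (1 * s + h)) = (fun s => phi (s + h)).
      by apply/funext => s; rewrite mul1r.
    rewrite E !mul1r in dsh.
    have := is_deriveM dsh dinv.
    have -> : phi (t + h) *: (- phi t ^- 2 * dphi t) + (phi t)^-1 *: dphi (t + h) = dth t.
      by rewrite /dth /GRing.scale/=; field.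
    by [].
  have dthb t : 0 < t -> `|dth t| <= c2 * h.
    move=> t0; have pt := phi0 t0.
    have -> : dth t = ((dphi (t + h) - dphi t) * phi t - (phi (t + h) - phi t) * dphi t) / phi t ^+ 2.
      by rewrite /dth; field; rewrite gt_eqF.
    rewrite normrM normfV [ `|phi t ^+ 2|]ger0_norm ?sqr_ge0//.
    rewrite ler_pdivrMr ?exprn_gt0//.
    have := pl t0 (ph t t0); have := dpl t0 (ph t t0).
    rewrite [t + h - t]addrAC subrr add0r (ger0_norm h0) => i1 i2.
    have i3 : `|(dphi (t + h) - dphi t) * phi t| <= Lp * h * Lp.
      by rewrite normrM ler_pM// gtr0_norm// pb.
    have i4 : `|(phi (t + h) - phi t) * dphi t| <= Lp * h * Lp.
      by rewrite normrM ler_pM// dpb.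
    apply: (le_trans (ler_normB _ _)).
    have i5 : p0 ^+ 2 <= phi t ^+ 2 by rewrite ler_sqr ?nnegrE ?pp// ltW.
    have -> : c2 * h * phi t ^+ 2 = (Lp * Lp + Lp * Lp) * h * (phi t ^+ 2 / p0 ^+ 2).
      by rewrite /c2; field; rewrite gt_eqF.
    have i6 : 1 <= phi t ^+ 2 / p0 ^+ 2 by rewrite ler_pdivlMr// mul1r.
    have i7 : 0 <= (Lp * Lp + Lp * Lp) * h by rewrite mulr_ge0// addr_ge0// mulr_ge0.
    have := ler_wpM2l i7 i6; lra.
  have thb t : 0 < t -> `|th t| <= c1 + 1.
    move=> t0; have := th1 t h t0 h0; rewrite -/(th t) => i1.
    have := ler_normD (th t - 1) 1; rewrite subrK normr1 => i2.
    have : c1 * h <= c1 * 1 by rewrite ler_wpM2l.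
    by lra.
  have thl s t : 0 < s -> s <= t -> `|th t - th s| <= c2 * h * (t - s).
    move=> s0; rewrite le_eqVlt => /predU1P[->|st]; first by rewrite !subrr normr0 mulr0.
    have cth : {within `[s, t], continuous th}.
      apply: continuous_in_subspaceT => x /set_mem/=; rewrite in_itv/= => /andP[sx _].
      exact: is_derive_cont (thd x (lt_le_trans s0 sx)).
    have [x|x xst ->] := @MVT R th dth s t st _ cth.
      by rewrite in_itv/= => /andP[sx _]; apply: thd; exact: lt_trans sx.
    rewrite normrM [ `|t - s|]gtr0_norm ?subr_gt0// ler_pM2r ?subr_gt0//.
    by apply: dthb; move: xst; rewrite in_itv/= => /andP[sx _]; exact: lt_trans sx.
  have [L L0 hL] := wloc (T + h).
  have Dl s t : 1 <= s -> s <= t -> t <= T ->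
      rnorm (D t - D s) <= ((c1 + 1) * L + c2 * h * W + L) * (t - s).
    move=> s1 st tT; have s0 : 0 < s by exact: lt_le_trans s1.
    have t0 : 0 < t by exact: lt_le_trans st.
    have -> : D t - D s = of_real kd (th t) *: (w (t + h) - w (s + h)) +
       of_real kd (th t - th s) *: w (s + h) - (w t - w s).
      apply: (norming_ext (@hilbert_normed_by_functionals R kd X)) => l hl; have [lD lZ _] := hl.
      by rewrite /D !(norming_funB hl, lD, lZ); ring.
    apply: (le_trans (rnormBD _ _)); rewrite 2!mulrDl; apply: lerD; last first.
      by apply: hL => //; rewrite (le_trans tT)// lerDl.
    apply: (le_trans (rnormD _ _)); rewrite !rnormZ; apply: lerD.
      rewrite -mulrA; apply: ler_pM; rewrite ?rnorm_ge0//; first exact: thb.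
      have := hL (s + h) (t + h) (ph s s0); rewrite !lerD2r => /(_ st tT).
      by have -> : t + h - (s + h) = t - s by ring.
    rewrite [leRHS]mulrAC; apply: ler_pM; rewrite ?rnorm_ge0//; first exact: thl.
    by apply: hW; exact: ph.
  have cD0 : 0 <= (c1 + 1) * L + c2 * h * W + L.
    have x1 : 0 <= (c1 + 1) * L by rewrite mulr_ge0// addr_ge0.
    have x2 : 0 <= c2 * h * W by rewrite mulr_ge0// mulr_ge0.
    by rewrite addr_ge0// addr_ge0.
  have c3h : 0 <= c3 * h by rewrite mulr_ge0.
  have := @vgronwall R kd X D 1 T alpha (c3 * h) _ T1 alpha_lt0 c3h cD0 Dl.
  move=> /(_ _)/wrap[].
    apply: ae_imply (ae_and wae (ae_shift h wae)) => t [ht hth] /andP[t1 _].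
    have t0 : 0 < t by exact: lt_le_trans t1.
    have [z [ez dz fz]] := ht t0; have [zh [ezh dzh fzh]] := hth (ph t t0).
    pose zz := of_real kd (th t) *: zh - z.
    have embz : emb zz = D t by rewrite /zz linearB linearZ /= ez ezh.
    (* everything in the derivative of D besides the generator applied to zz; it is O(h) *)
    pose rr := of_real kd (dth t) *: w (t + h) + of_real kd (th t - 1) *: f (t + h)
       + (f (t + h) - f t).
    exists (A zz + rr).
      have v1 := vderivZ (@hilbert_normed_by_functionals R kd X) (thd t t0) (vderiv_shift dzh).
      have v3 := vderivB (@hilbert_normed_by_functionals R kd X) v1 dz.
      suff -> : A zz + rr = of_real kd (dth t) *: w (t + h) +
         of_real kd (th t) *: (A zh + f (t + h)) - (A z + f t) by exact: v3.
      apply: (norming_ext (@hilbert_normed_by_functionals R kd X)) => l hl; have [lD lZ _] := hl.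
      rewrite /zz /rr linearB linearZ /=.
      by rewrite !(norming_funB hl, lD, lZ); ring.
    rewrite rdotDl; apply: lerD.
      rewrite -embz; apply: (le_trans (funnel_dissipation_scaled fzh fz (erefl zz))).
      by rewrite gerDr oppr_le0 sqr_ge0.
    apply: (le_trans (rdot_le _ _)); rewrite ler_wpM2r ?rnorm_ge0//.
    apply: (le_trans (rnormD _ _)); rewrite 2!mulrDl; apply: lerD; last first.
      by have := fl t0 (ph t t0); rewrite [t + h - t]addrAC subrr add0r (ger0_norm h0).
    apply: (le_trans (rnormD _ _)); rewrite !rnormZ; apply: lerD.
      rewrite [leRHS]mulrAC; apply: ler_pM; rewrite ?rnorm_ge0//; first exact: dthb.
      by apply: hW; exact: ph.
    rewrite [leRHS]mulrAC; apply: ler_pM; rewrite ?rnorm_ge0//; first exact: th1.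
    by apply: fb; exact: ph.
  move=> hD.
  have hD1 : rnorm (D 1) <= (c1 * W + L2) * h.
    have -> : D 1 = of_real kd (th 1 - 1) *: w (1 + h) + (w (1 + h) - w 1).
      apply: (norming_ext (@hilbert_normed_by_functionals R kd X)) => l hl; have [lD lZ _] := hl.
      by rewrite /D !(norming_funB hl, lD, lZ); ring.
    apply: (le_trans (rnormD _ _)); rewrite rnormZ mulrDl; apply: lerD.
      rewrite mulrAC; apply: ler_pM; rewrite ?rnorm_ge0//; first exact: th1.
      by apply: hW; exact: ph.
    have := hL2 1 (1 + h) ltr01; rewrite [1 + h - 1]addrAC subrr add0r; apply; first by rewrite lerDl.
    by lra.
  have hDT : rnorm (D T) <= c4 * h.
    apply: (le_trans hD); rewrite ge_max; apply/andP; split.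
      by apply: (le_trans hD1); rewrite ler_wpM2r// lerDl.
    by rewrite mulrAC ler_wpM2r// lerDr addr_ge0// mulr_ge0.
  have -> : w (T + h) - w T = D T - of_real kd (th T - 1) *: w (T + h).
    apply: (norming_ext (@hilbert_normed_by_functionals R kd X)) => l hl; have [lD lZ _] := hl.
    by rewrite /D !(norming_funB hl, lD, lZ); ring.
  apply: (le_trans (rnormBD _ _)); rewrite rnormZ addrC mulrDl; apply: lerD => //.
  rewrite mulrAC; apply: ler_pM; rewrite ?rnorm_ge0//; first exact: th1.
  by apply: hW; exact: ph.
exists K => //.
suff hs s t : 0 < s -> s <= t -> rnorm (w t - w s) <= K * (t - s).
  move=> s t s0 t0; have [st|/ltW ts] := leP s t.
    by rewrite ger0_norm ?subr_ge0// hs.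
  by rewrite rnormB ler0_norm ?subr_le0// opprB hs.
move=> s0 st; have t0 : 0 < t by exact: lt_le_trans st.
have ts0 : 0 <= t - s by rewrite subr_ge0.
(* long increments are controlled by the sup bound, short ones starting after time 1 by
   the Gronwall estimate, the remaining ones lie in (0, 2] *)
have [ts1|ts1] := leP (t - s) 1; last first.
  apply: (le_trans (rnormBD _ _)); have := hW s s0; have := hW t t0 => i1 i2.
  apply: (@le_trans _ _ (K * 1)); last by rewrite ler_wpM2l// ltW.
  have : 0 <= c1 * W by rewrite mulr_ge0.
  by rewrite /K; lra.
have [s1|s1] := leP 1 s.
  have := main s (t - s) s1 ts0 ts1; rewrite [s + (t - s)]addrC subrK => /le_trans; apply.
  by rewrite ler_wpM2r// /K -addrA lerDl addr_ge0// mulr_ge0.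
apply: (le_trans (hL2 s t s0 st _)); first by lra.
rewrite ler_wpM2r// /K.
have : 0 <= c1 * W by rewrite mulr_ge0.
by lra.
Qed.

End Estimate.

(** * From bounded intervals to the half-line *)

Section Transfer.
Context (R : realType) (kd : scalar_kind) (B : normedModType (scalars R kd)).
Local Notation mu := (@lebesgue_measure R).
Local Notation T := (measurableTypeR R).

(** The approximating simple functions are extended by zero. *)
Lemma bochner_transfer (J1 J2 : set R) (f1 f2 : R -> B) v :
  measurable (J1 : set T) -> measurable (J2 : set T) -> J1 `<=` J2 ->
  strongly_measurable J2 f2 ->
  {ae mu, forall t, J1 t -> f1 t = f2 t} ->
  (forall t, J2 t -> ~ J1 t -> f2 t = 0) ->
  is_bochner_integral J1 f1 v -> is_bochner_integral J2 f2 v.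
Proof.
move=> mJ1 mJ2 J12 sm [N [mN N0 hN]] out [_ [s [si c0 cv]]].
split=> //.
pose s' n t := if t \in J1 then s n t else 0.
have range' n : range (s' n) `<=` range (s n) `|` [set 0].
  by move=> _ [t _ <-]; rewrite /s'; case: ifP => _; [left; exists t|right].
have pre n b : b != 0 -> J2 `&` s' n @^-1` [set b] = J1 `&` s n @^-1` [set b].
  move=> b0; apply/seteqP; split=> t [Jt] /=; rewrite /s'.
    by case: ifPn => [/set_mem|_ h] //; rewrite -h eqxx in b0.
  by move=> h; split; [exact: J12|rewrite mem_set].
have simp n : simple_fun (s' n).
  have [[fs ms] _] := si n; split.
    by apply: sub_finite_set (range' n) _; rewrite finite_setU.
  move=> b; have [->|b0] := eqVneq b 0; last first.
    have -> : s' n @^-1` [set b] = J1 `&` s n @^-1` [set b].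
      apply/seteqP; split=> t /=; rewrite /s'.
        by case: ifPn => [/set_mem//|_ h]; rewrite -h eqxx in b0.
      by move=> [h1 h2]; rewrite mem_set.
    exact: measurableI.
  have -> : s' n @^-1` [set 0] = (J1 `&` s n @^-1` [set 0]) `|` ~` J1.
    apply/seteqP; split=> t /=; rewrite /s'.
      by case: ifPn => [/set_mem h1 h2|/negP h _]; [left|right=> h'; apply: h; apply/mem_set].
    by case=> [[h1 h2]|h]; [rewrite mem_set|rewrite memNset].
  by apply: measurableU; [exact: measurableI|exact: measurableC].
have intE n : simple_integral J2 (s' n) = simple_integral J1 (s n).
  have [[fs ms] _] := si n.
  have [fs' _] := simp n.
  pose W := range (s n) `|` [set 0].
  have null (b : B) (J : set R) (sn : R -> B) : ~ range sn b ->
      fine (mu (J `&` sn @^-1` [set b])) = 0.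
    move=> h; have -> : sn @^-1` [set b] = set0.
      by apply/seteqP; split=> t //= E; apply: h; exists t.
    by rewrite setI0 measure0.
  rewrite /simple_integral (@fsbig_widen _ _ _ _ (range (s' n)) W) //=.
    rewrite (@fsbig_widen _ _ _ _ (range (s n)) W) //=; last 2 first.
    - by move=> b bs; left.
    - by move=> b [_ nb]; rewrite /= null// rmorph0 scale0r.
      apply: eq_fsbigr => b _; have [->|b0] := eqVneq b 0; first by rewrite !scaler0.
      by rewrite pre.
  by move=> b [_ nb]; rewrite /= null// rmorph0 scale0r.
exists s'; split=> [n||].
- split; first exact: simp.
  by move=> b b0; rewrite pre//; case: (si n) => _; exact.
- have le n : (\int[mu]_(t in J2) (rnorm (f2 t - s' n t))%:E <=
               \int[mu]_(t in J1) (rnorm (f1 t - s n t))%:E)%E.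
    apply: (ae_le_nnintegral mN N0) => [t _|t _|t Nt J2t]; [exact: rnorm_ge0..|].
    rewrite /s'; case: ifPn => [/set_mem J1t|/negP h].
      right; split=> //; have -> // : f2 t = f1 t.
      by apply: contrapT => h; apply: Nt; apply: hN => /= /(_ J1t) /esym.
    by left; rewrite out ?subrr ?rnorm0// => h'; apply: h; exact/mem_set.
  apply: (@squeeze_cvge _ _ _ _ (cst 0%E) _ _ _ _ _ c0); last exact: cvg_cst.
  apply: nearW => n; rewrite le andbT.
  by apply: integral_ge0 => t _; rewrite lee_fin rnorm_ge0.
- by under eq_fun do rewrite intE.
Qed.

Lemma rel_continuousZ (G : set R) (th : R -> R) (f : R -> B) :
  continuous th -> rel_continuous G f ->
  rel_continuous G (fun t => of_real kd (th t) *: f t).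
Proof.
move=> cth cf t Gt e e0.
have a0 : 0 < 2 * (`|th t| + 1) by rewrite mulr_gt0// ltr_wpDl.
have b0 : 0 < 2 * (rnorm (f t) + 1) by rewrite mulr_gt0// ltr_wpDl// rnorm_ge0.
have [d1 d10 h1] := cf t Gt _ (divr_gt0 e0 a0).
pose m := Num.min 1 (e / (2 * (rnorm (f t) + 1))).
have m0 : 0 < m by rewrite lt_min ltr01 divr_gt0.
have /cvgrPdist_lt/(_ m m0)/nbhs_ballP[d2 /= d20 h2] : th x @[x --> t] --> th t := cth t.
exists (Num.min d1 d2); first by rewrite lt_min d10.
move=> s Gs; rewrite lt_min => /andP[/(h1 s Gs) k1 k2].
have : `|th t - th s| < m by apply: h2; rewrite /ball/= distrC.
rewrite distrC lt_min => /andP[k3 k4].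
have -> : of_real kd (th s) *: f s - of_real kd (th t) *: f t =
    of_real kd (th s) *: (f s - f t) + of_real kd (th s - th t) *: f t.
  by rewrite scalerBr rmorphB scalerBl addrA subrK.
apply: (le_lt_trans (rnormD _ _)); rewrite !rnormZ.
have k5 : `|th s| <= `|th t| + 1.
  by have := ler_normD (th s - th t) (th t); rewrite subrK; lra.
have n1 := rnorm_ge0 (f s - f t); have n2 := rnorm_ge0 (f t).
have k6 : `|th s| * rnorm (f s - f t) <= (`|th t| + 1) * rnorm (f s - f t) by rewrite ler_wpM2r.
have k7 : (`|th t| + 1) * rnorm (f s - f t) < e / 2.
  by move: k1; rewrite !ltr_pdivlMr//; lra.
have k8 : `|th s - th t| * rnorm (f t) <= e / 2.
  have : `|th s - th t| * (2 * (rnorm (f t) + 1)) < e by rewrite -ltr_pdivlMr.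
  by have := normr_ge0 (th s - th t); lra.
lra.
Qed.

End Transfer.

Section HalfLine.
Context (R : realType) (kd : scalar_kind) (B : normedModType (scalars R kd)).
Local Notation mu := (@lebesgue_measure R).

Lemma interior_halfline_gt0 (t : R) : (halfline R)° t -> 0 < t.
Proof.
move=> /nbhs_ballP[e /= e0 he].
have : halfline R (t - e / 2).
  apply: he; rewrite /ball/= opprB addrC subrK ger0_norm ?divr_ge0//; first by lra.
  exact: ltW.
by rewrite /halfline/= in_itv/= andbT; lra.
Qed.

Lemma itv_interior (a b c : R) : 0 < a -> b < c -> `[a, b] `<=` (`[0, c]%classic)°.
Proof.
move=> a0 bc t /=; rewrite in_itv/= => /andP[at_ tb].
apply/nbhs_ballP; exists (Num.min a (c - b)) => /=; first by rewrite lt_min a0 subr_gt0.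
move=> s; rewrite /ball/= lt_min => /andP[].
by rewrite !ltr_norml => /andP[? ?] /andP[? ?]; rewrite in_itv/=; apply/andP; split; lra.
Qed.

(** A test function on the half-line has its support in some bounded interval,
    where the hypothesis applies; outside, all integrands vanish. *)
Lemma weak_derivative1_halfline (x g : R -> B) (dx : nat -> R -> B) (G : set R) :
  rel_continuous G x -> rel_continuous G g ->
  {ae mu, forall t, halfline R t -> G t} ->
  (forall n, weak_derivative 1 `[0, n.+1%:R] x (dx n)) ->
  (forall n t, G t -> t < n.+1%:R -> dx n t = g t) ->
  weak_derivative 1 (halfline R) x g.
Proof.
move=> cx cg aeG wx dxg eta [deta [a [b [abJ out]]]].
pose n := Num.truncn `|b|.
have bn : b < n.+1%:R by apply: le_lt_trans (ler_norm b) _; exact: truncnS_gt.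
have test : test_fun `[0, n.+1%:R] eta.
  split=> //; exists a, b; split=> // t abt.
  have t0 := interior_halfline_gt0 (abJ _ abt).
  move: abt => /=; rewrite in_itv/= => /andP[_ tb].
  by apply: (itv_interior (a := t) t0 (le_lt_trans tb bn)); rewrite /= in_itv/= lexx.
have [v [bv1 bv2]] := wx n _ test.
have sub : `[0, n.+1%:R] `<=` halfline R.
  by move=> t /=; rewrite /halfline/= !in_itv/= andbT => /andP[].
have past (t : R) : halfline R t -> ~ `[0, n.+1%:R]%classic t -> n.+1%:R < t.
  rewrite /halfline/= !in_itv/= andbT => t0 h; rewrite ltNge; apply/negP => h'.
  by apply: h; rewrite t0.
have eta0 (t : R) : b < t -> eta t = 0.
  by move=> bt; apply: out; rewrite /= in_itv/= [t <= b]leNgt bt andbF.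
have deta0 (t : R) : b < t -> derive1n 1 eta t = 0.
  move=> bt; rewrite derive1n1 derive1E.
  have [] := @is_derive_local R (cst 0) eta t 0 (t - b) _ _ (is_derive_cst 0 t 1) => //.
    by rewrite subr_gt0.
  by move=> s; rewrite ltr_norml => /andP[h _]; rewrite eta0//; move: h; lra.
have ceta k : continuous (derive1n k eta).
  by move=> t; apply: differentiable_continuous; exact/derivable1_diffP/deta.
have mJ : measurable (`[0, n.+1%:R]%classic : set (measurableTypeR R)) by exact: measurable_itv.
exists v; split.
- refine (bochner_transfer mJ (@measurable_halfline R) sub _ _ _ bv1).
  + apply: rel_continuous_strongly_measurable aeG.
    by apply: rel_continuousZ cx; exact: ceta.
  + exact: aeW.
  + by move=> t Jt nt; rewrite deta0 ?rmorph0 ?scale0r// (lt_trans bn)// past.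
- refine (bochner_transfer mJ (@measurable_halfline R) sub _ _ _ bv2).
  + apply: rel_continuous_strongly_measurable aeG.
    by apply: rel_continuousZ cg; exact: (ceta 0%N).
  (* at the right endpoint dx n need not agree with g *)
  + have aen : {ae mu, forall t : R, t != n.+1%:R}.
      apply/(negligibleS _ (_ : mu.-negligible [set n.+1%:R])).
        by move=> t /= /negP; rewrite negbK => /eqP.
      by apply/negligibleP; [exact: measurable_set1|exact: lebesgue_measure_set1].
    apply: ae_imply (ae_and aeG aen) => t [ht tn] Jt.
    rewrite (dxg n t)//; first by apply: ht; exact: sub.
    move: Jt => /=; rewrite in_itv/= => /andP[_]; rewrite le_eqVlt => /orP[/eqP E|//].
    by rewrite E eqxx in tn.
  + by move=> t Jt nt; rewrite eta0 ?rmorph0 ?scale0r// (lt_trans bn)// past.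
Qed.

End HalfLine.

(** * The lifted closed loop at almost every time *)

Section Funnel.
Context (R : realType).

Lemma funnel_C11 (phi : R -> R) : funnel_class phi -> exists dphi Lp p0,
  0 < p0 /\ [/\ forall t, 0 < t -> p0 <= phi t,
      forall t, 0 < t -> phi t <= Lp,
      forall t, 0 < t -> `|dphi t| <= Lp
    & forall t : R, 0 < t -> is_derive t 1 phi (dphi t)] /\
  (forall s t, 0 < s -> 0 < t -> `|phi t - phi s| <= Lp * `|t - s|) /\
  (forall s t, 0 < s -> 0 < t -> `|dphi t - dphi s| <= Lp * `|t - s|).
Proof.
move=> [cphi sphi infp].
have [dphi [Lp [L0 b1 b2 b3 b4 b5]]] := @sobolev2_C11 R RealScalars _
  (@scalars_normed_by_functionals R RealScalars)
  (@scalars_seq_complete R RealScalars) phi cphi sphi.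
exists dphi, Lp, (inf [set phi t | t in halfline R]); split=> //; split; [split|split].
- move=> t t0; apply: ge_inf; last first.
    by exists t => //; rewrite /halfline/= in_itv/= andbT ltW.
  by apply: contrapT => h; move: infp; rewrite inf_out ?ltxx// => -[_ /h].
- by move=> t t0; apply: le_trans (b1 t t0); exact: ler_norm.
- exact: b2.
- move=> t t0; apply/is_deriveP => e e0; have [r r0 hr] := b5 t t0 e e0.
  by exists r => // s sr; exact: hr.
- exact: b3.
- exact: b4.
Qed.

End Funnel.

Section Lift.
Context (R : realType) (kd : scalar_kind) (X U : hilbertType R kd).
Variable S : boundary_control_system X U.
Local Notation D := (bcs_dom S).

Lemma bounded_linear_rlinear (Y Z : normedModType (scalars R kd)) (F : {linear Y -> Z}) :
  bounded_op F -> rlinear F.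
Proof.
move=> bF; split=> [x y|r x|]; [exact: linearD|exact: linearZ|].
exact: bounded_op_pos.
Qed.

(** [q = Q yref + p zc], where [Q] is a bounded right inverse of [C] on the
    kernel of [B] and [zc] solves [B zc = c], [C zc = 0]. *)
Lemma boundary_lift (yref : R -> U) (p : R -> scalars R kd) (c : U) :
  system_S3 S -> controller_C1 yref -> controller_C2 p ->
  exists (q dq : R -> D) L, C11 q dq L /\
    forall t, bcs_B S (q t) = p t *: c /\ bcs_C S (q t) = yref t.
Proof.
move=> S3 [cy sy] [cp sp _ _].
have nH (Y : hilbertType R kd) := @hilbert_normed_by_functionals R kd Y.
have [dy [Ly hy]] := sobolev2_C11 (nH U) (@complete_seq_complete R kd U) cy sy.
have [dp [Lp' hp]] := @sobolev2_C11 R kd _ (@scalars_normed_by_functionals R kd)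
  (@scalars_seq_complete R kd) p cp sp.
have [Q [QD QZ Qb Qi]] := bounded_right_inverse (bcs_B_bounded S) (bcs_C_bounded S) (S3 0).
have [zc [zB zC]] := S3 c 0.
have rQ : rlinear Q by [].
have rz : @rlinear R kd (scalars R kd)^o D (fun a => a *: zc).
  split=> [a b|r a|].
  - exact: scalerDl.
  - by rewrite scalerA.
  - exists (rnorm zc + 1) => [|a]; first by rewrite ltr_wpDl// rnorm_ge0.
    rewrite rnormZk mulrC; apply: ler_wpM2r; first exact: (rnorm_ge0 a).
    by rewrite lerDl.
have [L1 h1] := C11_rlinear rQ hy.
have [L2 h2] := C11_rlinear rz hp.
exists (fun t => Q (yref t) + p t *: zc), (fun t => Q (dy t) + dp t *: zc), (L1 + L2).
split; first exact: (C11_add (nH _) h1 h2).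
move=> t; have [q1 q2] := Qi (yref t).
by rewrite !linearD !linearZ /= q1 q2 zB zC scaler0 add0r addr0.
Qed.

End Lift.

Section ClosedLoop.
Context (R : realType) (kd : scalar_kind) (X U : hilbertType R kd).
Local Notation mu := (@lebesgue_measure R).
Variables (S : boundary_control_system X U).
Local Notation A := (bcs_A S).
Local Notation emb := (bcs_emb S).
Local Notation Bo := (bcs_B S).
Local Notation C := (bcs_C S).
Variables (x0 : bcs_dom S) (yref : R -> U) (p : R -> scalars R kd) (phi : R -> R).
Variables (x : R -> X) (dx : nat -> R -> X).
Hypothesis cx : forall n : nat, {within (`[0, n.+1%:R]%classic : set R), continuous x}.
Hypothesis hdx : forall n : nat, [/\ Linfty `[0, n.+1%:R]%classic (dx n),
  weak_derivative 1 `[0, n.+1%:R]%classic x (dx n)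
  & {ae mu, forall t, `[0, n.+1%:R]%classic t ->
      {for t, continuous (dx n)} /\ closed_loop_at x0 yref p phi t (x t) (dx n t)}].

(** The times at which every local representative [dx n] of the derivative is
    continuous and the equations hold; they have full measure. *)
Definition good_time t : Prop := 0 < t /\ forall n : nat, t < n.+1%:R ->
  continuous_at_time (dx n) t /\ closed_loop_at x0 yref p phi t (x t) (dx n t).

(** The derivatives [dx n] on the intervals [[0, n + 1]] agree at good times, so
    any choice of [n] with [t < n + 1] gives the same global derivative. *)
Definition state_velocity t : X := dx (Num.truncn t) t.

Let nX := @hilbert_normed_by_functionals R kd X.

Lemma ae_good_time : {ae mu, forall t, halfline R t -> good_time t}.
Proof.
have h0 : {ae mu, forall t : R, t != 0}.
  apply/(negligibleS _ (_ : mu.-negligible [set 0])).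
    by move=> t /= /negP; rewrite negbK => /eqP.
  by apply/negligibleP; [exact: measurable_set1|exact: lebesgue_measure_set1].
have hn : {ae mu, forall t, forall n : nat, `[0, n.+1%:R]%classic t ->
      {for t, continuous (dx n)} /\ closed_loop_at x0 yref p phi t (x t) (dx n t)}.
  by apply: ae_foralln => n; case: (hdx n).
apply: ae_imply (ae_and h0 hn) => t [t0 ht]; rewrite /halfline/= in_itv/= andbT => t0'.
have tp : 0 < t by rewrite lt_def t0.
split=> // n tn; have [|c1 c2] := ht n; first by rewrite /= in_itv/= t0' ltW.
split=> // e e0.
have /cvg_rnormP/(_ e e0)/nbhs_ballP[d /= d0 hd] : dx n s @[s --> t] --> dx n t := c1.
by exists d => // s sd; apply: hd; rewrite /ball/= distrC.
Qed.

Lemma state_continuous (t : R) : 0 < t -> continuous_at_time x t.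
Proof.
move=> t0; refine (within_continuous_at_time (@cx (Num.truncn t)) _).
by apply: (itv_interior (a := t) t0 (truncnS_gt t)); rewrite /= in_itv/= lexx.
Qed.

Lemma state_interior (n : nat) (t : R) : ((`[0, n.+1%:R]%classic : set R)°) t -> 0 < t.
Proof.
move=> h; apply: interior_halfline_gt0; apply: interiorS h => s /=.
by rewrite /halfline/= !in_itv/= andbT => /andP[].
Qed.

Lemma good_vderiv n t : 0 < t -> t < n.+1%:R -> continuous_at_time (dx n) t ->
  vderiv x t (dx n t).
Proof.
move=> t0 tn cd; have [_ wd _] := hdx n.
apply: (weak_derivative1_vderiv nX (measurable_itv _) wd) => //.
  by apply: (itv_interior (a := t) t0 tn); rewrite /= in_itv/= lexx.
by move=> s /state_interior s0; exact: state_continuous.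
Qed.

(** Both sides are the derivative of [x] at [t], which is unique. *)
Lemma good_velocity n t : good_time t -> t < n.+1%:R -> dx n t = state_velocity t.
Proof.
move=> [t0 ht] tn; have [c1 _] := ht n tn.
have [c2 _] := ht (Num.truncn t) (truncnS_gt t).
apply: (vderiv_unique nX (f := x) (t := t)); apply: good_vderiv => //.
exact: truncnS_gt.
Qed.

(** Near a good time a single [dx n] represents the velocity. *)
Lemma velocity_rel_continuous : rel_continuous good_time state_velocity.
Proof.
move=> t gt e e0; pose n := (Num.truncn t).+1.
have tn : t + 1 < n.+1%:R by rewrite -[n.+1]addn1 natrD ltrD2r; exact: truncnS_gt.
have tn' : t < n.+1%:R by lra.
have [_ /(_ n tn')[c _]] := gt.
have [d d0 hd] := c e e0.
exists (Num.min d 1); first by rewrite lt_min d0 ltr01.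
move=> s gs; rewrite lt_min => /andP[sd s1].
have sn : s < n.+1%:R by move: s1; rewrite ltr_norml => /andP[_]; lra.
by rewrite -!(good_velocity (n := n))//; exact: hd.
Qed.

Lemma good_state t : good_time t -> vderiv x t (state_velocity t) /\
  exists z, [/\ emb z = x t, A z = state_velocity t, psi_dom (phi t) (C z - yref t) &
    Bo z = p t *: (Bo x0 + psi (phi 0) (initial_error x0 yref)) - psi (phi t) (C z - yref t)].
Proof.
move=> [t0 ht]; have [c cl] := ht (Num.truncn t) (truncnS_gt t).
split; first by apply: good_vderiv => //; exact: truncnS_gt.
have [z [u [y [e [e1 [e2 [e3 [e4 [e5 [e6 e7]]]]]]]]]] := cl.
exists z; split=> //; first by rewrite e4 -e5.
by rewrite e3 e7 e5 e4.
Qed.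

Lemma state_locally_lipschitz T : exists2 L : R, 0 <= L & forall s t, 0 < s ->
  s <= t -> t <= T -> rnorm (x t - x s) <= L * (t - s).
Proof.
pose n := (Num.truncn `|T|).+1.
have Tn : T + 1 < n.+1%:R.
  rewrite -[n.+1]addn1 natrD ltrD2r; apply: le_lt_trans (ler_norm T) _.
  exact: truncnS_gt.
have [[_ [M hM]] wd _] := hdx n.
exists `|M| => // s t s0 st tT.
apply: (weak_derivative1_lipschitz nX (measurable_itv _) wd (a := s) (b := T + 1)) => //.
- exact: itv_interior.
- apply: ae_imply hM => r hr /andP[r1 r2]; apply: le_trans (ler_norm M).
  apply: hr; rewrite /= in_itv/= (ltW (lt_le_trans s0 r1)).
  by rewrite (le_trans r2)// ltW.
- by move=> r /andP[r1 _]; apply: state_continuous; exact: lt_le_trans r1.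
- by rewrite (le_lt_trans tT)// ltrDl.
Qed.

End ClosedLoop.

(** * Boundedness and continuity of the input *)

Section Feedback.
Context (R : realType) (kd : scalar_kind) (X U : hilbertType R kd).
Variables (S : boundary_control_system X U) (alpha : R).
Hypotheses (S1 : system_S1 S alpha) (alpha_lt0 : alpha < 0).
Local Notation A := (bcs_A S).
Local Notation emb := (bcs_emb S).
Local Notation C := (bcs_C S).
Variables (w f : R -> X) (phi : R -> R) (F Lp p0 W K : R).
Variables (G : set R) (zeta : R -> bcs_dom S).
Hypotheses (G0 : forall t, G t -> 0 < t)
  (fb : forall t, 0 < t -> rnorm (f t) <= F)
  (p00 : 0 < p0) (pp : forall t, 0 < t -> p0 <= phi t)
  (pb : forall t, 0 < t -> phi t <= Lp)
  (pl : forall s t, 0 < s -> 0 < t -> `|phi t - phi s| <= Lp * `|t - s|)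
  (wb : forall t, 0 < t -> rnorm (w t) <= W)
  (wl : forall s t, 0 < s -> 0 < t -> rnorm (w t - w s) <= K * `|t - s|)
  (zw : forall t, G t -> emb (zeta t) = w t)
  (zd : forall t, G t -> vderiv w t (A (zeta t) + f t))
  (zf : forall t, G t -> funnel_state (phi t) (zeta t)).

Let phi0 t : 0 < t -> 0 < phi t. Proof. by move=> t0; apply: lt_le_trans (pp t0). Qed.
Let W0 : 0 <= W. Proof. exact: le_trans (rnorm_ge0 _) (wb ltr01). Qed.
Let F0 : 0 <= F. Proof. exact: le_trans (rnorm_ge0 _) (fb ltr01). Qed.
Let Lp0 : 0 <= Lp.
Proof. by apply: le_trans (pb ltr01); rewrite ltW ?phi0. Qed.
Let K0 : 0 <= K.
Proof.
have := wl ltr01 (ltr0Sn R 1); have -> : `|2%:R - 1| = 1 :> R by rewrite ger0_norm; lra.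
by rewrite mulr1; apply: le_trans; exact: rnorm_ge0.
Qed.

(** [A zeta = w' - f], and [w'] is bounded by the Lipschitz constant of
    [w]. *)
Lemma generator_bounded t : G t -> rnorm (A (zeta t)) <= K + F.
Proof.
move=> gt; have t0 := G0 gt.
have h : rnorm (A (zeta t) + f t) <= K.
  apply: (vderiv_lipschitz_bound (zd gt)) => s ts.
  by have := wl t0 (lt_trans t0 ts); rewrite gtr0_norm ?subr_gt0.
have := rnormBD (A (zeta t) + f t) (f t); rewrite addrK.
by have := fb t0; lra.
Qed.

(** [gain = 1 + phi^2 gain |C zeta|^2], and the dissipation inequality bounds
    [gain |C zeta|^2] by [|A zeta| |w|]. *)
Lemma gain_bounded t : G t -> gain (phi t) (C (zeta t)) <= 1 + Lp ^+ 2 * ((K + F) * W).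
Proof.
move=> gt; have t0 := G0 gt; have [r0 rC _] := zf gt.
have d0 := gain_den r0 rC.
have := funnel_dissipation S1 (zf gt).
have := rdot_le (- A (zeta t)) (emb (zeta t)).
rewrite rdotNl rnormN => h1 h2.
have h3 : alpha * rnorm (emb (zeta t)) ^+ 2 <= 0 by rewrite nmulr_rle0// sqr_ge0.
have h4 : rnorm (A (zeta t)) * rnorm (emb (zeta t)) <= (K + F) * W.
  by apply: ler_pM; rewrite ?rnorm_ge0 ?generator_bounded ?zw ?wb.
have -> : gain (phi t) (C (zeta t)) = 1 +
    phi t ^+ 2 * (gain (phi t) (C (zeta t)) * rnorm (C (zeta t)) ^+ 2).
  have : gain (phi t) (C (zeta t)) * (1 - phi t ^+ 2 * rnorm (C (zeta t)) ^+ 2) = 1.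
    by rewrite /gain mulVf// gt_eqF.
  by lra.
rewrite lerD2l; apply: ler_pM; rewrite ?sqr_ge0//.
- by rewrite mulr_ge0 ?sqr_ge0// /gain invr_ge0 ltW.
- by rewrite ler_sqr ?nnegrE ?pb// ltW.
- by lra.
Qed.

Let kap := 1 + Lp ^+ 2 * ((K + F) * W).
Let kap0 : 0 <= kap.
Proof. by rewrite /kap addr_ge0// mulr_ge0 ?sqr_ge0// mulr_ge0// addr_ge0. Qed.

Lemma feedback_bounded t : G t -> rnorm (psi (phi t) (C (zeta t))) <= kap / p0.
Proof.
move=> gt; have t0 := G0 gt; have [r0 rC _] := zf gt.
rewrite psiE rnormZ ger0_norm; last by have := gain_ge1 r0 rC; lra.
apply: ler_pM; rewrite ?rnorm_ge0//; first by have := gain_ge1 r0 rC; lra.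
  exact: gain_bounded.
rewrite -[p0^-1]mul1r ler_pdivlMr// mulrC; apply: le_trans (ltW rC).
by rewrite ler_wpM2r ?rnorm_ge0// pp.
Qed.

(** [n] is [|th e(s) - e(t)|] with [th = phi s / phi t].  Its square is at most
    [|A z| |emb z|] for [z = th zeta s - zeta t] by
    [funnel_dissipation_scaled]: the first factor is bounded and the second one
    is [O(|s - t|)].  Since [psi] is Lipschitz where the gain is bounded, this
    is a modulus of continuity of order one half. *)
Lemma feedback_modulus : exists c1 c2 c3, [/\ 0 <= c1, 0 <= c2, 0 <= c3 &
  forall s t, G s -> G t -> exists2 n : R, 0 <= n /\ n ^+ 2 <= c3 * `|s - t| &
    rnorm (psi (phi s) (C (zeta s)) - psi (phi t) (C (zeta t))) <= c1 * `|s - t| + c2 * n].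
Proof.
pose m := Lp / p0.
have m0 : 0 <= m by rewrite divr_ge0// ltW.
have KF0 : 0 <= K + F by rewrite addr_ge0.
exists (m * (kap / p0)), (kap + 2 * kap ^+ 2), ((m + 1) * (K + F) * (m * W + K)).
split.
- by rewrite mulr_ge0// divr_ge0// ltW.
- by rewrite addr_ge0// mulr_ge0// sqr_ge0.
- by rewrite mulr_ge0 ?mulr_ge0 ?addr_ge0// mulr_ge0.
move=> s t gs gt; have s0 := G0 gs; have t0 := G0 gt.
have [rs0 rs bs] := zf gs; have [rt0 rt bt] := zf gt.
pose th := phi s / phi t.
have th0 : 0 < th by rewrite divr_gt0.
have vt : (phi t)^-1 <= p0^-1 by rewrite lef_pV2 ?posrE ?pp.
have v0 : 0 <= (phi t)^-1 by rewrite invr_ge0 ltW.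
have thm : th <= m by apply: ler_pM; rewrite ?pb// ltW.
have th1 : `|th - 1| <= m * `|s - t|.
  have -> : th - 1 = (phi s - phi t) / phi t by rewrite /th; field; rewrite gt_eqF.
  rewrite normrM normfV (gtr0_norm rt0) /m mulrAC.
  by apply: ler_pM => //; exact: pl.
have thr : th * phi t = phi s by rewrite /th divfK// gt_eqF.
pose z := of_real kd th *: zeta s - zeta t.
have := funnel_dissipation_scaled S1 (zf gs) (zf gt) (erefl z).
rewrite -/th.
set n := rnorm _; exists n; first split; first exact: rnorm_ge0.
  have ez : rnorm (emb z) <= (m * W + K) * `|s - t|.
    have -> : emb z = of_real kd (th - 1) *: w s + (w s - w t).
      apply: (norming_ext (@hilbert_normed_by_functionals R kd X)) => l hl.
      have [lD lZ _] := hl.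
      by rewrite /z linearB linearZ /= !zw// !(norming_funB hl, lD, lZ); ring.
    apply: (le_trans (rnormD _ _)); rewrite rnormZ mulrDl lerD ?wl//.
    by rewrite mulrAC ler_pM ?rnorm_ge0 ?wb.
  have az : rnorm (A z) <= (m + 1) * (K + F).
    rewrite /z linearB linearZ /=; apply: (le_trans (rnormBD _ _)).
    rewrite rnormZ (gtr0_norm th0) mulrDl mul1r lerD ?generator_bounded//.
    by rewrite ler_pM ?rnorm_ge0 ?generator_bounded// ltW.
  have := rdot_le (- A z) (emb z); rewrite rdotNl rnormN.
  have h3 : alpha * rnorm (emb z) ^+ 2 <= 0 by rewrite nmulr_rle0// sqr_ge0.
  have h4 : rnorm (A z) * rnorm (emb z) <= (m + 1) * (K + F) * ((m * W + K) * `|s - t|).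
    by apply: ler_pM; rewrite ?rnorm_ge0.
  rewrite -[_ * _ * `|s - t|]mulrA; lra.
have E : psi (phi s) (C (zeta s)) - psi (phi t) (C (zeta t)) =
    (psi (phi t) (of_real kd th *: C (zeta s)) - psi (phi t) (C (zeta t)))
    - of_real kd (th - 1) *: psi (phi s) (C (zeta s)).
  apply: (norming_ext (@hilbert_normed_by_functionals R kd U)) => l hl.
  have [lD lZ _] := hl.
  by rewrite (psi_scale _ thr) !(norming_funB hl, lD, lZ); ring.
(* rescaling the error at time s costs O(|s - t|); the rest is psi at the parameter phi t *)
rewrite E; apply: (le_trans (rnormBD _ _)); rewrite addrC lerD//.
  rewrite rnormZ mulrAC ler_pM ?rnorm_ge0//.
  exact: feedback_bounded.
have nth : rnorm (of_real kd th *: C (zeta s)) = th * rnorm (C (zeta s)).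
  by rewrite rnormZ gtr0_norm.
apply: psi_lipschitz => //.
- by rewrite nth mulrA [phi t * _]mulrC thr.
- by rewrite /gain nth exprMn mulrA -exprMn [phi t * _]mulrC thr; exact: gain_bounded.
- exact: gain_bounded.
Qed.

Lemma feedback_rel_continuous : rel_continuous G (fun t => psi (phi t) (C (zeta t))).
Proof.
have [c1 [c2 [c3 [c10 c20 c30 hc]]]] := feedback_modulus.
move=> t gt e e0.
pose a := e / (2 * (c1 + 1)); pose b := e / (2 * (c2 + 1)).
have a0 : 0 < a by rewrite divr_gt0// mulr_gt0// ltr_wpDl.
have b0 : 0 < b by rewrite divr_gt0// mulr_gt0// ltr_wpDl.
exists (Num.min a (b ^+ 2 / (c3 + 1))).
  by rewrite lt_min a0 divr_gt0// ?exprn_gt0// ltr_wpDl.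
move=> s gs; rewrite lt_min => /andP[sa sb].
have [n [n0 n2] hn] := hc s t gs gt; apply: (le_lt_trans hn).
have nb : n <= b.
  rewrite -ler_sqr ?nnegrE ?(ltW b0)//; apply: (le_trans n2).
  apply: (@le_trans _ _ ((c3 + 1) * `|s - t|)); first by rewrite ler_wpM2r// lerDl.
  by rewrite mulrC -ler_pdivlMr ?ltr_wpDl// ltW.
have ea : (c1 + 1) * a = e / 2 by rewrite /a; field; rewrite gt_eqF// ltr_wpDl.
have eb : (c2 + 1) * b = e / 2 by rewrite /b; field; rewrite gt_eqF// ltr_wpDl.
have h1 : c1 * `|s - t| <= c1 * a by rewrite ler_wpM2l// ltW.
have h2 : c2 * n <= c2 * b by rewrite ler_wpM2l.
lra.
Qed.

End Feedback.

(** The estimates for [w = x - q] transferred back to the state and the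
    input. *)
Lemma closed_loop_bounded (R : realType) (kd : scalar_kind) (X U : hilbertType R kd)
    (S : boundary_control_system X U) (alpha : R)
    (S1 : system_S1 S alpha) (S3 : system_S3 S) (alpha_lt0 : alpha < 0)
    (x0 : bcs_dom S) (yref : R -> U) (p : R -> scalars R kd) (phi : R -> R)
    (C1 : controller_C1 yref) (C2 : controller_C2 p) (fc : funnel_class phi)
    (x : R -> X) (dx : nat -> R -> X)
    (cx : forall n : nat, {within (`[0, n.+1%:R]%classic : set R), continuous x})
    (hdx : forall n : nat, [/\ Linfty `[0, n.+1%:R]%classic (dx n),
      weak_derivative 1 `[0, n.+1%:R]%classic x (dx n)
      & {ae @lebesgue_measure R, forall t, `[0, n.+1%:R]%classic t ->
        {for t, continuous (dx n)} /\ closed_loop_at x0 yref p phi t (x t) (dx n t)}]) :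
  let G := good_time x0 yref p phi x dx in
  exists (u : R -> U) (K : R), [/\
    forall t, 0 < t -> rnorm (x t) <= K,
    forall s t, 0 < s -> 0 < t -> rnorm (x t - x s) <= K * `|t - s|,
    forall t, G t -> exists2 z : bcs_dom S, bcs_emb S z = x t & u t = bcs_B S z,
    rel_continuous G u
    & forall t, G t -> rnorm (u t) <= K].
Proof.
move=> G.
have [dphi [Lp [p0 [p00 [[pp pb dpb pd] [pl dpl]]]]]] := @funnel_C11 R phi fc.
pose c := bcs_B S x0 + psi (phi 0) (initial_error x0 yref).
have [q [dq [L [hq qBC]]]] := boundary_lift c S3 C1 C2.
have nX := @hilbert_normed_by_functionals R kd X.
have eb : bounded_op (bcs_emb S) by refine (continuous_linear_bounded_op _); exact: bcs_emb_continuous.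
have [La ha] := C11_rlinear (bounded_linear_rlinear (bcs_A_bounded S)) hq.
have [Le he] := C11_rlinear (bounded_linear_rlinear eb) hq.
have [Lb hb] := C11_rlinear (bounded_linear_rlinear (bcs_B_bounded S)) hq.
pose w t := x t - bcs_emb S (q t).
pose f t := bcs_A S (q t) - bcs_emb S (dq t).
have fb t : 0 < t -> rnorm (f t) <= La + Le.
  move=> t0; apply: (le_trans (rnormBD _ _)); apply: lerD.
    exact: (C11_bound ha).
  exact: (C11_dbound he).
have fl s t : 0 < s -> 0 < t -> rnorm (f t - f s) <= (La + Le) * `|t - s|.
  move=> s0 t0; rewrite /f mulrDl.
  have -> : bcs_A S (q t) - bcs_emb S (dq t) - (bcs_A S (q s) - bcs_emb S (dq s)) =
     (bcs_A S (q t) - bcs_A S (q s)) - (bcs_emb S (dq t) - bcs_emb S (dq s)).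
    by apply: (norming_ext nX) => l hl; rewrite !(norming_funB hl); ring.
  apply: (le_trans (rnormBD _ _)); apply: lerD.
    exact: (C11_lip ha).
  exact: (C11_dlip he).
have hstate t : exists z, G t -> [/\ bcs_emb S z = x t,
    bcs_A S z = state_velocity dx t, psi_dom (phi t) (bcs_C S z - yref t) &
    bcs_B S z = p t *: c - psi (phi t) (bcs_C S z - yref t)].
  have [gt|ngt] := pselect (G t); last by exists 0.
  by have [_ [z hz]] := good_state cx hdx gt; exists z.
have [z hz] := choice hstate.
pose zeta t := z t - q t.
have G0 t : G t -> 0 < t by case.
have Cz t : bcs_C S (zeta t) = bcs_C S (z t) - yref t.
  by rewrite /zeta linearB; have [_ ->] := qBC t.
have zw t : G t -> bcs_emb S (zeta t) = w t.
  by move=> /hz[e _ _ _]; rewrite /zeta linearB e.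
have zd t : G t -> vderiv w t (bcs_A S (zeta t) + f t).
  move=> gt; have [xd _] := good_state cx hdx gt; have [_ e _ _] := hz t gt.
  have -> : bcs_A S (zeta t) + f t = state_velocity dx t - bcs_emb S (dq t).
    by rewrite /zeta /f linearB e addrA subrK.
  by apply: (vderivB nX xd); exact: (C11_deriv he (G0 t gt)).
have zf t : G t -> funnel_state (phi t) (zeta t).
  move=> gt; have [_ _ [r0 rC] e] := hz t gt; split; rewrite ?Cz//.
  by rewrite /zeta linearB e; have [-> _] := qBC t; rewrite addrAC subrr add0r.
have aeG := ae_good_time hdx.
have wae : {ae @lebesgue_measure R, forall t, 0 < t -> funnel_solution_at S w f phi t}.
  apply: ae_imply aeG => t ht t0.
  have gt : G t by apply: ht; rewrite /halfline/= in_itv/= andbT ltW.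
  by exists (zeta t); split; [exact: zw|exact: zd|exact: zf].
have wloc T : exists2 l, 0 <= l & forall s t, 0 < s -> s <= t -> t <= T ->
    rnorm (w t - w s) <= l * (t - s).
  have [k k0 hk] := state_locally_lipschitz cx hdx T.
  exists (k + Le) => [|s t s0 st tT]; first by rewrite addr_ge0// (C11_ge0 he).
  have -> : w t - w s = (x t - x s) - (bcs_emb S (q t) - bcs_emb S (q s)).
    by apply: (norming_ext nX) => l hl; rewrite !(norming_funB hl); ring.
  apply: (le_trans (rnormBD _ _)); rewrite mulrDl; apply: lerD; first exact: hk.
  have := C11_lip he s0 (lt_le_trans s0 st).
  by rewrite ger0_norm// subr_ge0.
have [W W0 hW] := funnel_solution_bounded S1 alpha_lt0 fb wloc wae.
have [K K0 hK] := funnel_solution_lipschitz S1 alpha_lt0 fb fl p00 pp pb dpb pl dpl pd wloc wae.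
have psb := feedback_bounded S1 alpha_lt0 G0 fb p00 pp pb hW hK zw zd zf.
have psc := feedback_rel_continuous S1 alpha_lt0 G0 fb p00 pp pb pl hW hK zw zd zf.
set kp := (X in forall t, _ -> _ <= X) in psb.
have kp0 : 0 <= `|kp| by [].
have xE t : x t = w t + bcs_emb S (q t) by rewrite /w subrK.
have uE t : G t -> bcs_B S (z t) = bcs_B S (q t) - psi (phi t) (bcs_C S (zeta t)).
  by move=> /hz[_ _ _ ->]; rewrite Cz; have [-> _] := qBC t.
exists (fun t => bcs_B S (z t)), (W + K + Le + Lb + `|kp|).
have le0 := C11_ge0 he; have lb0 := C11_ge0 hb.
split.
- move=> t t0; rewrite xE; apply: (le_trans (rnormD _ _)).
  by have := hW t t0; have := C11_bound he t0; lra.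
- move=> s t s0 t0; have -> : x t - x s = (w t - w s) + (bcs_emb S (q t) - bcs_emb S (q s)).
    by rewrite !xE opprD addrACA.
  apply: (le_trans (rnormD _ _)).
  have := hK s t s0 t0; have := C11_lip he s0 t0 => h1 h2.
  have : (K + Le) * `|t - s| <= (W + K + Le + Lb + `|kp|) * `|t - s|.
    by rewrite ler_wpM2r//; lra.
  by rewrite mulrDl; lra.
- by move=> t /hz[e _ _ _]; exists (z t).
- move=> t gt e e0; have e2 : 0 < e / 2 by rewrite divr_gt0.
  have [d d0 hd] := psc t gt _ e2.
  have L1 : 0 < 2 * (Lb + 1) by rewrite mulr_gt0// ltr_wpDl.
  exists (Num.min d (e / (2 * (Lb + 1)))); first by rewrite lt_min d0 divr_gt0.
  move=> s gs; rewrite lt_min ltr_pdivlMr// => /andP[/(hd s gs) h1 h2].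
  rewrite !uE// opprB.
  have -> : bcs_B S (q s) - psi (phi s) (bcs_C S (zeta s)) +
      (psi (phi t) (bcs_C S (zeta t)) - bcs_B S (q t)) =
      (bcs_B S (q s) - bcs_B S (q t)) -
      (psi (phi s) (bcs_C S (zeta s)) - psi (phi t) (bcs_C S (zeta t))).
    apply: (norming_ext (@hilbert_normed_by_functionals R kd U)) => l hl.
    by have [lD _ _] := hl; rewrite !(norming_funB hl, lD); ring.
  apply: (le_lt_trans (rnormBD _ _)).
  have := C11_lip hb (G0 t gt) (G0 s gs); have := normr_ge0 (s - t); lra.
- move=> t gt; rewrite uE//; apply: (le_trans (rnormBD _ _)).
  have := C11_bound hb (G0 t gt); have := psb t gt; have := ler_norm kp; lra.
Qed.

Theorem theorem3p6 (R : realType) (kd : scalar_kind) (X U : hilbertType R kd)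
    (S : boundary_control_system X U) (alpha : R)
    (S1 : system_S1 S alpha) (S2 : system_S2 S alpha) (S3 : system_S3 S)
    (alpha_lt0 : alpha < 0)
    (x0 : bcs_dom S) (yref : R -> U) (p : R -> scalars R kd) (phi : R -> R)
    (C1 : controller_C1 yref) (C2 : controller_C2 p)
    (C3 : controller_C3 x0 yref phi)
    (x : R -> X) (xsol : global_solution x0 yref p phi x) :
  Sobolev_infty 1 (halfline R) x /\
  exists2 u : R -> U,
    {ae @lebesgue_measure R, forall t, halfline R t ->
      exists2 z : bcs_dom S, bcs_emb S z = x t & u t = bcs_B S z} &
    Linfty (halfline R) u.
Proof.
have [_ sol] := xsol.
have sol' (n : nat) := sol n.+1%:R (ltr0Sn R n).
have cx (n : nat) : {within (`[0, n.+1%:R]%classic : set R), continuous x}.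
  by have [] := sol' n.
have [dx hdx] := choice (fun n => let: And4 _ _ _ h := sol' n in h).
have [u [K [xb xl ux uc ub]]] := closed_loop_bounded S1 S3 alpha_lt0 C1 C2 C3.1 cx hdx.
have aeG := ae_good_time hdx; set G := good_time _ _ _ _ _ _ in aeG ux uc ub.
have nX := @hilbert_normed_by_functionals R kd X.
have xc : rel_continuous G x.
  move=> t [t0 _] e e0; have [d d0 hd] := state_continuous cx t0 e0.
  by exists d => // s _; exact: hd.
have vc := velocity_rel_continuous cx hdx.
have K0 : 0 <= K := le_trans (rnorm_ge0 _) (xb 1 ltr01).
split; last first.
  exists u; first by apply: ae_imply aeG => t h /h; exact: ux.
  split; first exact: rel_continuous_strongly_measurable uc aeG.
  by exists K; apply: ae_imply aeG => t h /h; exact: ub.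
split.
  split; first exact: rel_continuous_strongly_measurable xc aeG.
  by exists K; apply: ae_imply aeG => t h /h[t0 _]; exact: xb.
case=> [//|[|//]] _; exists (state_velocity dx); split.
  split; first exact: rel_continuous_strongly_measurable vc aeG.
  exists K; apply: ae_imply aeG => t h /h gt.
  have [t0 _] := gt; have [dv _] := good_state cx hdx gt.
  apply: (vderiv_lipschitz_bound dv) => s ts.
  by have := xl t s t0 (lt_trans t0 ts); rewrite gtr0_norm ?subr_gt0.
apply: (weak_derivative1_halfline xc vc aeG (dx := dx)).
  by move=> n; have [] := hdx n.
by move=> n t gt tn; have := good_velocity cx hdx gt tn; exact.
Qed.
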